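(* Let $(X,\phi)$ be a non-compact, strictly $\phi$-convex calibrated manifold with $\phi$ of degree $p$, and suppose $\phi$ is exact. Given a compactly supported current $S\in\mathcal E'_{p-1}(X)$ of dimension $p-1$, there exists a $\phi$-positive current $T\in\mathcal E'_p(X)$ with $S=\partial T$ if and only if $$S(\alpha)\ \ge\ 0\quad\text{for all }\alpha\in\mathcal E^{p-1}(X)\text{ such that }d\alpha\text{ is }\Lambda^+(\phi)\text{-positive}.$$
   Context: A calibrated manifold $(X,\phi)$ of degree $p\ge 1$ is a connected smooth riemannian manifold $X$ together with a closed smooth $p$-form $\phi$ such that $\phi(\xi)\le 1$ for every unit simple tangent $p$-vector $\xi$ on $X$. $G_x(\phi)$ denotes the set of unit simple $p$-vectors $\xi$ at $x$ with $\phi(\xi)=1$ ($\phi$-planes), and $G(\phi)=\bigcup_xG_x(\phi)$. For $f\in C^\infty(X)$, the $\phi$-Hessian of $f$ is the $p$-form $\mathcal H^\phi(f)(v_1,\dots,v_p)=\sum_{i=1}^p\phi(v_1,\dots,\nabla_{v_i}(\nabla f),\dots,v_p)$ ($\nabla_{v_i}(\nabla f)$ in the $i$-th slot, $\nabla$ the Levi-Civita connection). $f$ is strictly $\phi$-plurisubharmonic if $\mathcal H^\phi(f)(\xi)>0$ for all $\xi\in G(\phi)$. $X$ is strictly $\phi$-convex if it admits a smooth strictly $\phi$-plurisubharmonic function $f$ with $\{f\le c\}$ compact for all $c\in\mathbb R$. $\phi$ is exact if $\phi=d\eta$ for some smooth $(p-1)$-form $\eta$ on $X$. $\mathcal E^k(X)$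 is the space of smooth $k$-forms on $X$ with its $C^\infty$ topology, and $\mathcal E'_k(X)$ is its dual, the space of compactly supported currents of dimension $k$. The boundary is $(\partial T)(\alpha)=T(d\alpha)$. (The paper writes $\int_S\alpha$ for $S(\alpha)$.) A smooth $p$-form $\beta$ is $\Lambda^+(\phi)$-positive if $\beta(\xi)\ge 0$ for all $\xi\in G(\phi)$. A $\phi$-positive (also called $\Lambda_+(\phi)$-positive) current is a $p$-dimensional current $T$ which is representable by integration, $T(\beta)=\int\beta(\vec T)\,d\|T\|$, where $\|T\|$ is a Radon measure and $\vec T_x$ lies in the convex hull of $G_x(\phi)\subset\Lambda_pT_xX$ for $\|T\|$-almost every $x$. Equivalently, $T(\beta)\ge 0$ for every compactly supported $\Lambda^+(\phi)$-positive $p$-form $\beta$. *)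

(* Defs.v *)
From HB Require Import structures.
From mathcomp Require Import all_boot all_order all_algebra.
From mathcomp Require Import all_classical all_reals all_analysis.
From mathcomp Require Import ring.

Set Implicit Arguments.
Unset Strict Implicit.
Unset Printing Implicit Defensive.

Import Order.TTheory GRing.Theory Num.Theory.
Import numFieldNormedType.Exports.

Local Open Scope classical_set_scope.
Local Open Scope ring_scope.

Fixpoint Ck_on {R : realType} {V W : normedModType R} (k : nat)
    (U : set V) (f : V -> W) : Prop :=
  if k is k'.+1 then
    (forall x, U x -> differentiable f x) /\ forall v, Ck_on k' U ('D_v f)
  else forall x, U x -> {for x, continuous f}.

Definition smooth_on {R : realType} {V W : normedModType R}
    (U : set V) (f : V -> W) : Prop := forall k, Ck_on k U f.

Section SmoothClosure.
Context {R : realType} {V : normedModType R}.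
Implicit Types (U : set V).

Lemma near_eq_differentiable {W : normedModType R} (f g : V -> W) (x : V) :
  {near x, f =1 g} -> differentiable f x -> differentiable g x.
Proof.
move=> fg df.
have dg : g \o shift x = cst (g x) + 'd f x +o_ 0 id.
  apply/eqaddoP => e e0.
  have := diff_locally df => /eqaddoP /(_ e e0) H.
  have fg' : \forall h \near (0 : V), f (h + x) = g (h + x).
    move: fg; rewrite (near_shift 0 x) => /= H1.
    by apply: filterS H1 => h /=; rewrite subr0.
  near=> h.
  have : `| ((f \o shift x) - (cst (f x) + 'd f x)) h| <= e * `|id h| by near: h.
  rewrite !fctE /= (nbhs_singleton fg).
  suff -> : f (h + x) = g (h + x) by [].
  by near: h.
have dgE := diff_unique (diff_continuous df) dg.
apply/diff_locallyP; split; rewrite dgE //; exact: diff_continuous.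
Unshelve. all: by end_near. Qed.

Lemma eq_Ck_on {W : normedModType R} k U (f g : V -> W) : open U ->
  (forall x, U x -> f x = g x) -> Ck_on k U f -> Ck_on k U g.
Proof.
move=> oU; have near_eq (f' g' : V -> W) x : U x ->
    (forall x, U x -> f' x = g' x) -> {near x, f' =1 g'}.
  by move=> Ux fg; apply: filterS (open_nbhs_nbhs (conj oU Ux)).
elim: k f g => [|k IHk] f g fg /=.
  move=> cf x Ux; rewrite /prop_for /continuous_at -(fg _ Ux).
  exact: cvg_trans (near_eq_cvg (near_eq _ _ _ Ux fg)) (cf x Ux).
move=> [df dCk]; split=> [x Ux|v].
  exact: near_eq_differentiable (near_eq _ _ _ Ux fg) (df x Ux).
apply: IHk (dCk v) => x Ux.
exact: (near_eq_derive v (near_eq _ _ _ Ux fg)).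
Qed.

Lemma Ck_onW {W : normedModType R} k U (f : V -> W) :
  Ck_on k.+1 U f -> Ck_on k U f.
Proof.
elim: k f => [|k IHk] f [df dCk]; first by move=> x /df /differentiable_continuous.
by split=> // v; apply: IHk.
Qed.

Lemma Ck_on_cst {W : normedModType R} k U (c : W) : Ck_on k U (cst c : V -> W).
Proof.
elim: k c => [|k IHk] c /=; first by move=> x _; exact: cst_continuous.
split=> [x _|v]; first exact: differentiable_cst.
suff -> : 'D_v (cst c : V -> W) = cst 0 by [].
by apply/funext => x; rewrite derive_cst.
Qed.

Lemma Ck_onD {W : normedModType R} k U (f g : V -> W) : open U ->
  Ck_on k U f -> Ck_on k U g -> Ck_on k U (f + g).
Proof.
move=> oU; elim: k f g => [|k IHk] f g /=.
  by move=> cf cg x Ux; apply: continuousD; [exact: cf|exact: cg].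
move=> [df dCf] [dg dCg]; split=> [x Ux|v].
  by apply: differentiableD; [exact: df|exact: dg].
apply: eq_Ck_on (IHk _ _ (dCf v) (dCg v)) => // x Ux.
by rewrite deriveD //; apply: diff_derivable; [exact: df|exact: dg].
Qed.

Lemma Ck_onM k U (f g : V -> R) : open U ->
  Ck_on k U f -> Ck_on k U g -> Ck_on k U (f * g).
Proof.
move=> oU; elim: k f g => [|k IHk] f g.
  by move=> cf cg x Ux; apply: continuousM; [exact: cf|exact: cg].
move=> Cf Cg; have [df dCf] := Cf; have [dg dCg] := Cg; split=> [x Ux|v].
  by apply: differentiableM; [exact: df|exact: dg].
have := Ck_onD oU (IHk _ _ (Ck_onW Cf) (dCg v)) (IHk _ _ (Ck_onW Cg) (dCf v)).
apply: eq_Ck_on => // x Ux.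
rewrite deriveM //; apply: diff_derivable; [exact: df|exact: dg].
Qed.

End SmoothClosure.

Lemma derive_smooth_on {R : realType} {V W : normedModType R} (U : set V)
  (f : V -> W) v : smooth_on U f -> smooth_on U ('D_v f).
Proof. by move=> sf k; have [_] := sf k.+1; apply. Qed.

                                                                               
                                                                               
                                                               
Record smooth_manifold (R : realType) (n : nat) := SmoothManifold {
  carrier :> ptopologicalType ;
  carrier_hausdorff : hausdorff_space carrier ;
  carrier_second_countable : @second_countable carrier ;
  chart : Type ;
  chart_dom : chart -> set carrier ;
  chart_coord : chart -> carrier -> 'rV[R]_n ;
  chart_param : chart -> 'rV[R]_n -> carrier ;
  chart_dom_open : forall i, open (chart_dom i) ;
  chart_cod_open : forall i, open (chart_coord i @` chart_dom i) ;
  coordK : forall i x, chart_dom i x -> chart_param i (chart_coord i x) = x ;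
  coord_continuous : forall i x, chart_dom i x ->
    {for x, continuous (chart_coord i)} ;
  param_continuous : forall i u, (chart_coord i @` chart_dom i) u ->
    {for u, continuous (chart_param i)} ;
  chart_cover : forall x, exists i, chart_dom i x ;
  transition_smooth : forall i j,
    smooth_on (chart_coord i @` (chart_dom i `&` chart_dom j))
      (chart_coord j \o chart_param i) }.

Section SmoothFunctions.
Context {R : realType} {n : nat} (X : smooth_manifold R n).

Definition smoothfun_pred : {pred X -> R} := fun f => `[< forall i : chart X,
  smooth_on (chart_coord i @` chart_dom i) (f \o chart_param i : 'rV[R]_n -> R) >].

Record smoothfun := SmoothFun {
  smoothfun_val :> X -> R ; _ : smoothfun_val \in smoothfun_pred }.

HB.instance Definition _ := [isSub for smoothfun_val].
HB.instance Definition _ := [Choice of smoothfun by <:].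

Lemma smoothfun_subring_closed : subring_closed smoothfun_pred.
Proof.
split=> [|f g /asboolP sf /asboolP sg|f g /asboolP sf /asboolP sg].
- by apply/asboolP => i k; exact: Ck_on_cst.
- apply/asboolP => i k.
  have := Ck_onD (@chart_cod_open _ _ X i) (sf i k)
    (Ck_onM (@chart_cod_open _ _ X i) (Ck_on_cst k _ (-1 : R^o)) (sg i k)).
  congr Ck_on; apply/funext => u.
  by rewrite !fctE /= mulN1r.
- apply/asboolP => i k.
  exact: (Ck_onM (@chart_cod_open _ _ X i) (sf i k) (sg i k)).
Qed.

HB.instance Definition _ := GRing.isSubringClosed.Build (X -> R) smoothfun_pred
  smoothfun_subring_closed.

Lemma smoothfun_scaler_closed : GRing.scaler_closed smoothfun_pred.
Proof.
move=> a f /asboolP sf; apply/asboolP => i k.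
exact: (Ck_onM (@chart_cod_open _ _ X i) (Ck_on_cst k _ (a : R^o)) (sf i k)).
Qed.

HB.instance Definition _ := GRing.isScaleClosed.Build R (X -> R) smoothfun_pred
  smoothfun_scaler_closed.

HB.instance Definition _ := GRing.SubChoice_isSubComPzRing.Build _ _ smoothfun
  (subringClosedP _).
HB.instance Definition _ := [SubZmodule_isSubLmodule of smoothfun by <:].

End SmoothFunctions.

Section VectorFields.
Context {R : realType} {n : nat} (X : smooth_manifold R n).
Local Notation C := (smoothfun X).

                                                                              
                                  
Definition vfield_pred : {pred C -> C} := fun D => `[<
  (forall (a : R) f g, D (a *: f + g) = a *: D f + D g) /\
  (forall f g, D (f * g) = D f * g + f * D g) >].

Record vfield := VField {
  vfield_val :> C -> C ; _ : vfield_val \in vfield_pred }.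

HB.instance Definition _ := [isSub for vfield_val].
HB.instance Definition _ := [Choice of vfield by <:].

Lemma smoothfun_scaleAl (a : R) (f g : C) : a *: (f * g) = a *: f * g.
Proof. by apply/val_inj/funext => x; exact: mulrA. Qed.

Lemma smoothfun_scaleAr (a : R) (f g : C) : a *: (f * g) = f * (a *: g).
Proof. by rewrite mulrC smoothfun_scaleAl mulrC. Qed.

Lemma vfield_zmod_closed : zmod_closed vfield_pred.
Proof.
split.
  have E f : (0 : C -> C) f = 0 by [].
  by apply/asboolP; split=> *; rewrite !E ?scaler0 ?mul0r ?mulr0 addr0.
move=> D E /asboolP[D1 D2] /asboolP[E1 E2].
have BE f : (D - E) f = D f - E f by [].
apply/asboolP; split=> *; rewrite !BE.
  by rewrite D1 E1 scalerBr opprD addrACA.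
by rewrite D2 E2 mulrBl mulrBr opprD addrACA.
Qed.

HB.instance Definition _ := GRing.isZmodClosed.Build (C -> C) vfield_pred
  vfield_zmod_closed.
HB.instance Definition _ := [SubChoice_isSubZmodule of vfield by <:].

Lemma vfieldP (V : vfield) (a : R) f g : V (a *: f + g) = a *: V f + V g.
Proof. by case: V => D /= /asboolP[]. Qed.

Lemma vfieldM (V : vfield) f g : V (f * g) = V f * g + f * V g.
Proof. by case: V => D /= /asboolP[]. Qed.

Lemma vfieldD (V : vfield) f g : V (f + g) = V f + V g.
Proof. by have := vfieldP V 1 f g; rewrite !scale1r. Qed.

Lemma vfield0 (V : vfield) : V 0 = 0.
Proof. by apply: (addrI (V 0)); rewrite -vfieldD !addr0. Qed.

Lemma vfieldN (V : vfield) f : V (- f) = - V f.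
Proof. by apply: (addrI (V f)); rewrite -vfieldD !subrr vfield0. Qed.

Lemma vfieldZ (V : vfield) (a : R) f : V (a *: f) = a *: V f.
Proof. by have := vfieldP V a f 0; rewrite vfield0 !addr0. Qed.

Lemma vfield_addE (V W : vfield) f : (V + W) f = V f + W f.
Proof. by []. Qed.

Lemma vfield_oppE (V : vfield) f : (- V) f = - V f.
Proof. by []. Qed.

Lemma eq_vfield (V W : vfield) : (forall f, V f = W f) -> V = W.
Proof. by move=> VW; apply/val_inj/funext. Qed.

Lemma vfield_scale_subproof (f : C) (V : vfield) :
  (fun g => f * V g) \in vfield_pred.
Proof.
apply/asboolP; split=> [a g h|g h].
  by rewrite vfieldP mulrDr smoothfun_scaleAr.
by rewrite vfieldM mulrDr mulrA mulrCA.
Qed.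

Definition vfield_scale (f : C) (V : vfield) : vfield :=
  VField (vfield_scale_subproof f V).

Fact vfield_scaleA (f g : C) (V : vfield) :
  vfield_scale f (vfield_scale g V) = vfield_scale (f * g) V.
Proof. by apply: eq_vfield => h; exact: mulrA. Qed.
Fact vfield_scale1 : left_id 1 vfield_scale.
Proof. by move=> V; apply: eq_vfield => h; exact: mul1r. Qed.
Fact vfield_scaleDr : right_distributive vfield_scale +%R.
Proof. by move=> f V W; apply: eq_vfield => h; exact: mulrDr. Qed.
Fact vfield_scaleDl (V : vfield) : {morph vfield_scale^~ V : f g / f + g}.
Proof. by move=> f g; apply: eq_vfield => h; exact: mulrDl. Qed.

HB.instance Definition _ := GRing.Zmodule_isLmodule.Build C vfield
  vfield_scaleA vfield_scale1 vfield_scaleDr vfield_scaleDl.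

Lemma vfield_scaleE (f : C) (V : vfield) g : (f *: V) g = f * V g.
Proof. by []. Qed.

Lemma bracket_subproof (V W : vfield) :
  (fun f => V (W f) - W (V f)) \in vfield_pred.
Proof.
apply/asboolP; split=> [a f g|f g].
  by rewrite !vfieldP scalerBr opprD addrACA.
rewrite !vfieldM !vfieldD !vfieldM mulrBl mulrBr.
ring.
Qed.

Definition bracket (V W : vfield) : vfield := VField (bracket_subproof V W).

End VectorFields.

Section Alternating.
Context {R : realType} {n : nat} {X : smooth_manifold R n}.
Local Notation C := (smoothfun X).
Local Notation T := (vfield X).

Definition upd (k : nat) (V : 'I_k -> T) (i : 'I_k) (W : T) : 'I_k -> T :=
  fun j => if j == i then W else V j.

                                                                          
                    
Definition is_form (k : nat) (a : ('I_k -> T) -> C) : Prop :=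
  (forall V i (f : C) W W',
    a (upd V i (f *: W + W')) = f * a (upd V i W) + a (upd V i W')) /\
  (forall V i j, i != j -> V i = V j -> a V = 0).

Lemma updE k (V : 'I_k -> T) i W : upd V i W i = W.
Proof. by rewrite /upd eqxx. Qed.

Lemma upd_neq k (V : 'I_k -> T) i j W : j != i -> upd V i W j = V j.
Proof. by rewrite /upd => /negPf->. Qed.

Lemma upd_id k (V : 'I_k -> T) i : upd V i (V i) = V.
Proof. by apply/funext => j; rewrite /upd; case: eqP => // ->. Qed.

Lemma updK k (V : 'I_k -> T) i W W' : upd (upd V i W) i W' = upd V i W'.
Proof. by apply/funext => j; rewrite /upd; case: eqP. Qed.

Lemma updC k (V : 'I_k -> T) i j W W' : i != j ->
  upd (upd V i W) j W' = upd (upd V j W') i W.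
Proof.
move=> ij; apply/funext => l; rewrite /upd.
by case: eqP => // ->; rewrite eq_sym (negPf ij).
Qed.

Lemma formD k a (V : 'I_k -> T) i W W' : is_form a ->
  a (upd V i (W + W')) = a (upd V i W) + a (upd V i W').
Proof. by case=> aL _; have := aL V i 1 W W'; rewrite scale1r mul1r. Qed.

Lemma formZ k a (V : 'I_k -> T) i f W : is_form a ->
  a (upd V i (f *: W)) = f * a (upd V i W).
Proof.
move=> fa; have a0 : a (upd V i 0) = 0.
  by apply: (addrI (a (upd V i 0))); rewrite -formD // !addr0.
by have := fa.1 V i f W 0; rewrite a0 !addr0.
Qed.

Lemma form_antisym k a (V : 'I_k -> T) i j W W' : is_form a -> i != j ->
  a (upd (upd V i W) j W') = - a (upd (upd V i W') j W).
Proof.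
move=> fa ij; have := fa.2 (upd (upd V i (W + W')) j (W + W')) i j ij.
rewrite upd_neq // !updE => /(_ erefl).
rewrite formD // !(updC _ _ _ ij) !formD // -!(updC _ _ _ ij).
rewrite [a (upd (upd V i W) j W)](fa.2 _ i j) ?add0r //; last first.
  by rewrite upd_neq // !updE.
rewrite [a (upd (upd V i W') j W')](fa.2 _ i j) ?addr0 //; last first.
  by rewrite upd_neq // !updE.
by move=> /eqP; rewrite addr_eq0 => /eqP ->; rewrite opprK.
Qed.

Definition slotwise k (a : ('I_k -> T) -> C) (A : T -> T) (V : 'I_k -> T) : C :=
  \sum_(i < k) a (upd V i (A (V i))).

Lemma slotwise_alt k (a : ('I_k -> T) -> C) (A : T -> T) V i j :
  is_form a -> i != j -> V i = V j -> slotwise a A V = 0.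
Proof.
move=> fa ij Vij; rewrite /slotwise (bigD1 i) //= (bigD1 j) 1?eq_sym //= addrA.
rewrite big1 ?addr0; last first.
  move=> l /andP[li lj]; apply: (fa.2 _ i j ij).
  by rewrite !upd_neq // eq_sym.
have := form_antisym V (A (V i)) (V j) fa ij.
have -> : upd (upd V i (A (V i))) j (V j) = upd V i (A (V i)).
  by rewrite updC // upd_id.
have -> : upd V i (V j) = V by rewrite -Vij upd_id.
by rewrite Vij => ->; rewrite addNr.
Qed.

Lemma slotwise_linear k (a : ('I_k -> T) -> C) (A : T -> T) (D : C -> C)
    V i f W W' : is_form a ->
  A (f *: W + W') = f *: A W + D f *: W + A W' ->
  slotwise a A (upd V i (f *: W + W')) =
  f * slotwise a A (upd V i W) + D f * a (upd V i W) + slotwise a A (upd V i W').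
Proof.
move=> fa AE; rewrite /slotwise.
rewrite (bigD1 i) // [in X in f * X](bigD1 i) //.
rewrite [in X in _ = _ + X](bigD1 i) // !updK !updE AE !formD // !formZ //.
set S := bigop _ _ _; set S1 := bigop _ _ _; set S2 := bigop _ _ _.
have -> : S = f * S1 + S2.
  rewrite /S /S1 /S2 mulr_sumr -big_split /=; apply: eq_bigr => l li.
  rewrite !upd_neq // ![upd (upd V i _) l _]updC 1?eq_sym //.
  by rewrite formD // formZ.
have K (Z : nmodType) (p q r s t : Z) : p + q + r + (s + t) = p + s + q + (r + t).
  by rewrite addrACA [p + q + s]addrAC.
by rewrite mulrDr; exact: K.
Qed.

End Alternating.

Section ExteriorDerivative.
Context {R : realType} {n : nat} {X : smooth_manifold R n}.
Local Notation C := (smoothfun X).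
Local Notation T := (vfield X).

                   
                                                             
                                                                       
                                                                                
                                                                              
                                             
Definition ext_deriv (k : nat) (a : ('I_k -> T) -> C) (V : 'I_k.+1 -> T) : C :=
  \sum_(i < k.+1) (-1) ^+ i *
    (V i (a (V \o lift i)) -
     \sum_(j < k | (i <= j)%N)
        a (upd (V \o lift i) j (bracket (V i) (V (lift i j))))).

Definition consv (k : nat) (W : T) (U : 'I_k -> T) : 'I_k.+1 -> T :=
  fun i => oapp U W (unlift ord0 i).

Lemma consv0 k W (U : 'I_k -> T) : consv W U ord0 = W.
Proof. by rewrite /consv unlift_none. Qed.

Lemma consv_lift k W (U : 'I_k -> T) i : consv W U (lift ord0 i) = U i.
Proof. by rewrite /consv liftK. Qed.

Lemma consvE k (V : 'I_k.+1 -> T) : V = consv (V ord0) (V \o lift ord0).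
Proof. by apply/funext => i; rewrite /consv; case: unliftP => [j|] ->. Qed.

Lemma consv_liftK k W (U : 'I_k -> T) : consv W U \o lift ord0 = U.
Proof. by apply/funext => i /=; rewrite consv_lift. Qed.

Lemma upd_consv0 k W W' (U : 'I_k -> T) : upd (consv W U) ord0 W' = consv W' U.
Proof.
apply/funext => i; rewrite /upd.
case: (unliftP ord0 i) => [j|] ->; last by rewrite eqxx consv0.
by rewrite !consv_lift.
Qed.

Lemma upd_consv k W W' (U : 'I_k -> T) j :
  upd (consv W U) (lift ord0 j) W' = consv W (upd U j W').
Proof.
apply/funext => i; rewrite /upd.
case: (unliftP ord0 i) => [l|] ->; last by rewrite !consv0.
by rewrite (inj_eq lift_inj) !consv_lift.
Qed.

Definition iprod k (W : T) (a : ('I_k.+1 -> T) -> C) : ('I_k -> T) -> C :=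
  fun U => a (consv W U).

Definition lie k (W : T) (a : ('I_k -> T) -> C) : ('I_k -> T) -> C :=
  fun U => W (a U) - slotwise a (bracket W) U.

Lemma lift_lift0 k (i : 'I_k.+1) (j : 'I_k) :
  lift (lift ord0 i) (lift ord0 j) = lift ord0 (lift i j).
Proof.
apply: val_inj; rewrite /= /bump /=.
by rewrite !add1n ltnS addnS.
Qed.

Lemma cartan k (a : ('I_k.+1 -> T) -> C) (V : 'I_k.+2 -> T) :
  ext_deriv a V =
  lie (V ord0) a (V \o lift ord0) -
  ext_deriv (iprod (V ord0) a) (V \o lift ord0).
Proof.
rewrite {1}/ext_deriv big_ord_recl expr0 mul1r; congr (_ + _).
rewrite /ext_deriv -sumrN; apply: eq_bigr => i _.
rewrite /= exprS mulN1r mulNr; congr (- (_ * _)).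
have VE : V \o lift (lift ord0 i) = consv (V ord0) ((V \o lift ord0) \o lift i).
  rewrite [LHS]consvE; congr consv.
    by congr V; apply: val_inj.
  by apply/funext => j /=; rewrite lift_lift0.
rewrite VE; congr (_ - _).
rewrite big_mkcond big_ord_recl /= add0r [RHS]big_mkcond /=.
apply: eq_bigr => j _; rewrite /bump /= !add1n ltnS; case: ifP => // _.
by rewrite /iprod upd_consv lift_lift0.
Qed.

Lemma ext_deriv0 (a : ('I_0 -> T) -> C) (V : 'I_1 -> T) :
  ext_deriv a V = V ord0 (a (V \o lift ord0)).
Proof. by rewrite /ext_deriv big_ord1 expr0 mul1r big_ord0 subr0. Qed.

Lemma bracket_linear (W : T) (f : C) (Y Z : T) :
  bracket W (f *: Y + Z) = f *: bracket W Y + W f *: Y + bracket W Z.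
Proof.
apply: eq_vfield => h.
have -> : (f *: bracket W Y + W f *: Y + bracket W Z) h =
  f * (W (Y h) - Y (W h)) + W f * Y h + (W (Z h) - Z (W h)) by [].
have -> : bracket W (f *: Y + Z) h =
  W (f * Y h + Z h) - (f * Y (W h) + Z (W h)) by [].
rewrite vfieldD vfieldM; ring.
Qed.

Lemma bracketxx (W : T) : bracket W W = 0.
Proof. by apply: eq_vfield => h; exact: subrr. Qed.

Lemma bracketDl (W W' Z : T) : bracket (W + W') Z = bracket W Z + bracket W' Z.
Proof.
apply: eq_vfield => h.
have -> : bracket (W + W') Z h = W (Z h) + W' (Z h) - Z (W h + W' h) by [].
have -> : (bracket W Z + bracket W' Z) h =
  W (Z h) - Z (W h) + (W' (Z h) - Z (W' h)) by [].
rewrite vfieldD; ring.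
Qed.

Lemma is_form_lie k W (a : ('I_k -> T) -> C) : is_form a -> is_form (lie W a).
Proof.
move=> fa; split=> [V i f Y Z|V i j ij Vij]; last first.
  by rewrite /lie (fa.2 _ _ _ ij Vij) (slotwise_alt _ fa ij Vij) vfield0 subr0.
rewrite /lie (slotwise_linear V i fa (bracket_linear W f Y Z)) fa.1.
rewrite vfieldD vfieldM.
set p := slotwise _ _ _; set q := slotwise _ _ _; set u := a _; set v := a _.
ring.
Qed.

Lemma is_form_iprod k W (a : ('I_k.+1 -> T) -> C) :
  is_form a -> is_form (iprod W a).
Proof.
move=> [aL aA]; split=> [V i f Y Z|V i j ij Vij].
  by rewrite /iprod -!upd_consv aL.
apply: (aA _ (lift ord0 i) (lift ord0 j)); last by rewrite !consv_lift.
by rewrite (inj_eq lift_inj).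
Qed.

Lemma lieD k W W' (a : ('I_k -> T) -> C) U : is_form a ->
  lie (W + W') a U = lie W a U + lie W' a U.
Proof.
move=> fa; rewrite /lie vfield_addE.
have -> : slotwise a (bracket (W + W')) U =
    slotwise a (bracket W) U + slotwise a (bracket W') U.
  rewrite /slotwise -big_split; apply: eq_bigr => i _ /=.
  by rewrite bracketDl formD.
by rewrite opprD addrACA.
Qed.

Lemma ext_derivD k (a b : ('I_k -> T) -> C) V :
  ext_deriv (fun U => a U + b U) V = ext_deriv a V + ext_deriv b V.
Proof.
rewrite /ext_deriv -big_split; apply: eq_bigr => i _ /=.
by rewrite vfieldD big_split opprD addrACA mulrDr.
Qed.

Lemma ext_deriv_0 k (V : 'I_k.+1 -> T) : ext_deriv (fun=> 0) V = 0.
Proof.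
rewrite /ext_deriv big1 // => i _.
by rewrite vfield0 big1 // subr0 mulr0.
Qed.

Lemma is_form_ext_deriv k (a : ('I_k -> T) -> C) :
  is_form a -> is_form (ext_deriv a).
Proof.
elim: k a => [|k IHk] a fa.
  split=> [V i f Y Z|V i j]; last by rewrite !ord1.
  have [c aE] : exists c, forall U, a U = c.
    by exists (a (V \o lift ord0)) => U; congr a; apply/funext => -[].
  by rewrite !ext_deriv0 ord1 !updE !aE.
have fE W : is_form (fun U => ext_deriv a (consv W U)).
  have fl := is_form_lie W fa; have fi := IHk _ (is_form_iprod W fa).
  have E U : ext_deriv a (consv W U) = lie W a U - ext_deriv (iprod W a) U.
    by rewrite cartan consv0 consv_liftK.
  split=> [V i f Y Z|V i j ij Vij]; rewrite !E.
    rewrite fl.1 fi.1; ring.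
  by rewrite (fl.2 _ _ _ ij Vij) (fi.2 _ _ _ ij Vij) subrr.
have ED W W' U : ext_deriv a (consv (W + W') U) =
    ext_deriv a (consv W U) + ext_deriv a (consv W' U).
  rewrite !cartan !consv0 !consv_liftK lieD //.
  have -> : iprod (W + W') a = fun U => iprod W a U + iprod W' a U.
    apply/funext => U'; rewrite /iprod.
    by have := formD (consv W U') ord0 W W' fa; rewrite !upd_consv0.
  by rewrite ext_derivD opprD addrACA.
have E01 W U : ext_deriv a (consv W (consv W U)) = 0.
  have fD : is_form (iprod W a) := is_form_iprod W fa.
  have -> : ext_deriv a (consv W (consv W U)) =
      lie W a (consv W U) - lie W (iprod W a) U.
    rewrite cartan consv0 consv_liftK; congr (_ - _).
    case: k a U fa fD {IHk fE ED} => [|k] a U fa fD.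
      by rewrite ext_deriv0 consv0 consv_liftK /lie /slotwise big_ord0 subr0.
    rewrite cartan consv0 consv_liftK.
    have -> : iprod W (iprod W a) = fun=> 0.
      apply/funext => U'; apply: (fa.2 _ ord0 (lift ord0 ord0)) => //.
      by rewrite consv_lift !consv0.
    by rewrite ext_deriv_0 subr0.
  rewrite /lie /iprod /slotwise big_ord_recl consv0 upd_consv0 bracketxx.
  have -> : a (consv 0 U) = 0.
    by rewrite -(upd_consv0 0) -[X in upd _ _ X](scale0r 0) formZ // mul0r.
  rewrite add0r; apply/eqP; rewrite subr_eq0; apply/eqP; congr (_ - _).
  by apply: eq_bigr => j _; rewrite upd_consv consv_lift.
have ED2 W Y Z U : ext_deriv a (consv W (consv (Y + Z) U)) =
    ext_deriv a (consv W (consv Y U)) + ext_deriv a (consv W (consv Z U)).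
  by have := formD (consv Y U) ord0 Y Z (fE W); rewrite !upd_consv0.
have anti W W' U : ext_deriv a (consv W (consv W' U)) =
    - ext_deriv a (consv W' (consv W U)).
  have := E01 (W + W') U; rewrite ED !ED2 !E01 add0r addr0.
  by move/eqP; rewrite addr_eq0 => /eqP.
have alt0 j W U : U j = W -> ext_deriv a (consv W U) = 0.
  move=> UW; have [j0|j0] := eqVneq ord0 j.
    by rewrite [U]consvE j0 UW E01.
  have UE : upd (upd U ord0 (U ord0)) j W = U by rewrite -UW (upd_id U) (upd_id U).
  have := form_antisym U (U ord0) W (fE W) j0; rewrite UE => ->.
  have -> : upd (upd U ord0 W) j (U ord0) =
      consv W (upd (upd U ord0 W) j (U ord0) \o lift ord0).
    by rewrite [LHS]consvE upd_neq // updE.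
  by rewrite E01 oppr0.
split=> [V i f Y Z|V i j ij].
  case: (unliftP ord0 i) => [i'|] -> {i}.
    by rewrite [V]consvE !upd_consv (fE _).1.
  rewrite [V]consvE !upd_consv0 ED; congr (_ + _).
  set U := V \o lift ord0; rewrite [U]consvE !(anti _ (U ord0)).
  have := formZ (consv Y (U \o lift ord0)) ord0 f Y (fE (U ord0)).
  by rewrite !upd_consv0 => ->; rewrite mulrN.
case: (unliftP ord0 i) ij => [i'|] -> ; case: (unliftP ord0 j) => [j'|] -> //.
- rewrite (inj_eq lift_inj) => ij Vij; rewrite [V]consvE.
  exact: (fE _).2 _ _ _ ij Vij.
- by move=> _ Vij; rewrite [V]consvE; apply: (alt0 i').
- by move=> _ Vij; rewrite [V]consvE; apply: (alt0 j').
Qed.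

End ExteriorDerivative.

Section Forms.
Context {R : realType} {n : nat} (X : smooth_manifold R n) (k : nat).
Local Notation C := (smoothfun X).
Local Notation T := (vfield X).

Definition form_pred : {pred ('I_k -> T) -> C} := fun a => `[< is_form a >].

Record kform := Form {
  form_val :> ('I_k -> T) -> C ; _ : form_val \in form_pred }.

HB.instance Definition _ := [isSub for form_val].
HB.instance Definition _ := [Choice of kform by <:].

Lemma form_is_form (a : kform) : is_form a.
Proof. by case: a => a /= /asboolP. Qed.

Lemma form_submod_closed : GRing.subsemimod_closed form_pred.
Proof.
split; first split.
- apply/asboolP; split=> // V i f W W'.
  have E U : (0 : ('I_k -> T) -> C) U = 0 by [].
  by rewrite !E mulr0 addr0.
- move=> a b /asboolP[aL aA] /asboolP[bL bA]; apply/asboolP.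
  have E U : (a + b) U = a U + b U by [].
  split=> [V i f W W'|V i j ij Vij]; rewrite !E.
    by rewrite aL bL mulrDr addrACA.
  by rewrite (aA _ _ _ ij Vij) (bA _ _ _ ij Vij) addr0.
- move=> c a /asboolP[aL aA]; apply/asboolP.
  have E U : (c *: a) U = c *: a U by [].
  split=> [V i f W W'|V i j ij Vij]; rewrite !E.
    by rewrite aL scalerDr smoothfun_scaleAr.
  by rewrite (aA _ _ _ ij Vij) scaler0.
Qed.

HB.instance Definition _ := GRing.isSubmodClosed.Build R (('I_k -> T) -> C)
  form_pred form_submod_closed.
HB.instance Definition _ := [SubChoice_isSubLmodule of kform by <:].

                                                            
                                                                                
                                                                              
Definition jets (a : kform) :
    prod_topology (fun _ : seq T * ('I_k -> T) => {family compact, X -> R}) :=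
  fun WV => smoothfun_val (foldr (@vfield_val R n X) (a WV.2) WV.1).

HB.instance Definition _ := Topological.copy kform (initial_topology jets).

End Forms.
Arguments kform {R n} X k.

Section ExteriorD.
Context {R : realType} {n : nat} {X : smooth_manifold R n} {k : nat}.

Lemma ext_deriv_subproof (a : kform X k) : ext_deriv a \in @form_pred R n X k.+1.
Proof. by apply/asboolP; apply: is_form_ext_deriv; exact: form_is_form. Qed.

Definition exterior_d (a : kform X k) : kform X k.+1 := Form (ext_deriv_subproof a).

End ExteriorD.

                                                                              
Record riemannian_metric {R : realType} {n : nat} (X : smooth_manifold R n) :=
    RiemannianMetric {
  riemannian_val :> vfield X -> vfield X -> smoothfun X ;
  riemannian_linear : forall (f : smoothfun X) (V V' W : vfield X),
    riemannian_val (f *: V + V') W =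
    f * riemannian_val V W + riemannian_val V' W ;
  riemannian_sym : forall V W : vfield X, riemannian_val V W = riemannian_val W V ;
  riemannian_pos : forall (V : vfield X) (x : X),
    (exists f : smoothfun X, V f x != 0) -> 0 < riemannian_val V V x }.

                                                                              
                                                              
Record levi_civita {R : realType} {n : nat} {X : smooth_manifold R n}
    (g : riemannian_metric X) := LeviCivita {
  nabla :> vfield X -> vfield X -> vfield X ;
  nabla_linear : forall (f : smoothfun X) (V V' W : vfield X),
    nabla (f *: V + V') W = f *: nabla V W + nabla V' W ;
  nablaD : forall V W W' : vfield X, nabla V (W + W') = nabla V W + nabla V W' ;
  nabla_leibniz : forall (V : vfield X) (f : smoothfun X) (W : vfield X),
    nabla V (f *: W) = V f *: W + f *: nabla V W ;
  nabla_torsion_free : forall V W : vfield X, nabla V W - nabla W V = bracket V W ;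
  nabla_metric : forall U V W : vfield X,
    U (g V W) = g (nabla U V) W + g V (nabla U W) }.

Definition convex_hull {R : realType} {E : lmodType R} (A : set E) : set E :=
  [set v | exists m (t : 'I_m -> R) (w : 'I_m -> E),
    [/\ forall i, 0 <= t i, \sum_i t i = 1, forall i, A (w i) &
        v = \sum_i t i *: w i]].

Section CalibratedGeometry.
Context {R : realType} {n : nat} {X : smooth_manifold R n}.
Context (g : riemannian_metric X) {p : nat}.
Local Notation vfield := (vfield X).
                                                                            
                                                                            
                                                                     
Local Notation pvector := (kform X p -> R^o).

                             
Definition simple_pvector (x : X) (V : 'I_p -> vfield) : pvector :=
  fun b => b V x.

                                               
Definition unit_simple (x : X) : set pvector :=
  [set simple_pvector x V | V in
    [set V : 'I_p -> vfield | \det (\matrix_(i, j) g (V i) (V j) x) = 1]].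

Definition phi_planes (phi : kform X p) (x : X) : set pvector :=
  unit_simple x `&` [set xi | xi phi = 1].

Definition calibration (phi : kform X p) : Prop :=
  [/\ connected [set: X], exterior_d phi = 0 &
      forall x xi, unit_simple x xi -> xi phi <= 1].

Definition Lambda_positive (phi b : kform X p) : Prop :=
  forall x xi, phi_planes phi x xi -> 0 <= xi b.

                                                                          
                                                                              
                                                                                
                                                                             
                                     
Definition positive_current (phi : kform X p) (T : kform X p -> R) : Prop :=
  exists (mu : {measure set (g_sigma_algebraType (@open X)) -> \bar R})
         (Tv : g_sigma_algebraType (@open X) -> pvector),
  [/\ forall K : set X, compact K -> (mu K < +oo)%E,
      forall b, measurable_fun [set: g_sigma_algebraType (@open X)]
        (fun x => Tv x b : R),
      {ae mu, forall x, convex_hull (phi_planes phi x) (Tv x)} &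
      forall b, (T b)%:E = (\int[mu]_x (Tv x b)%:E)%E].

Definition is_gradient (f : smoothfun X) (W : vfield) : Prop :=
  forall V : vfield, g W V = V f.

Context (nabla : levi_civita g).

Lemma hessian_subproof (phi : kform X p) (W : vfield) :
  slotwise phi (fun V => nabla V W) \in @form_pred R n X p.
Proof.
apply/asboolP; have fphi := form_is_form phi.
split=> [V i f Y Z|V i j ij Vij]; last exact: slotwise_alt fphi ij Vij.
rewrite (slotwise_linear (D := fun=> 0) V i fphi) ?mul0r ?addr0 //.
by rewrite nabla_linear scale0r addr0.
Qed.

                                                           
Definition phi_hessian (phi : kform X p) (gradf : vfield) : kform X p :=
  Form (hessian_subproof phi gradf).

                                             
Definition strictly_psh (phi : kform X p) (f : smoothfun X) : Prop :=
  exists2 gradf, is_gradient f gradf &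
    forall x xi, phi_planes phi x xi -> 0 < xi (phi_hessian phi gradf).

Definition strictly_convex (phi : kform X p) : Prop :=
  exists2 f : smoothfun X, strictly_psh phi f &
    forall c : R, compact [set x : X | f x <= c].

End CalibratedGeometry.

Definition exact_form {R : realType} {n : nat} {X : smooth_manifold R n}
  {k : nat} (phi : kform X k.+1) : Prop := exists eta, phi = exterior_d eta.

                                                                                
                                             
Record current {R : realType} {n : nat} (X : smooth_manifold R n) (k : nat) :=
  Current { current_val :> {linear kform X k -> R^o} ;
            current_continuous : continuous current_val }.

Definition current_boundary {R : realType} {n : nat} {X : smooth_manifold R n} {k}
  (T : current X k.+1) : kform X k -> R := fun a => T (exterior_d a).

(* Main.v *)
From HB Require Import structures.
Require Import Defs.
From mathcomp Require Import all_boot all_order all_algebra fingroup perm.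
From mathcomp Require Import all_classical all_reals all_analysis.
From mathcomp Require Import measurable_realfun.
From mathcomp Require Import ring lra.

Set Implicit Arguments.
Unset Strict Implicit.
Unset Printing Implicit Defensive.

Import Order.TTheory GRing.Theory Num.Theory.
Import numFieldNormedType.Exports.

Local Open Scope classical_set_scope.
Local Open Scope ring_scope.

(** Say that a tuple V of vector fields is a plane at x when it is orthonormal at x
    and phi takes the value 1 on it there [ONplane]; Lambda-positivity of a form can
    be tested on such tuples [Lambda_positiveP].

    If S is the boundary of a positive current T, then S(a) = T(da) is the integral
    of the values of da on convex combinations of phi-planes, hence nonnegative when
    da is Lambda-positive [positive_current_ge0].

    For the converse, consider functions u(x, V) of a point and a plane at that point
    that are bounded over every sublevel set of the exhaustion function f, and put
    p(u) = inf S(a), the infimum being over the forms a with da >= u on all planes.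
    There are such a: if W is the gradient of f and chi a positive nondecreasing
    function, then on planes
        d(chi(f) i_W phi) >= chi(f) H(f),
    H(f) being the phi-Hessian [ext_deriv_grad], and chi(f) H(f) exceeds any given
    locally bounded function once chi grows fast enough [psh_domination]. The
    inequality rests on the first cousin principle: at a plane V, the derivative of
    phi in the direction of Y in slot i is the inner product of Y with V_i.
    The hypothesis on S says that p is bounded below, so p is finite and sublinear,
    and the Hahn-Banach theorem provides a linear L <= p. Then L is positive, and
    L(da) = S(a). A positive functional on all locally bounded functions is carried
    by the planes over a compact sublevel set K [compact_extension].

    It remains to write L on forms as a positive current. Restricted to functions of x
    alone, L is integration against a measure mu on K [riesz_measure, riesz_integral].
    Over K a form is a combination, with continuous coefficients, of finitely many
    functions F_i(x, V), products of the coordinates of the V_l in local frames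
    [scaled_expand]; each functional u |-> L(u F_i) has a density d_i with respect to mu
    [density]. For almost every x the vector d(x) lies in the convex hull of the vectors
    F(x, V), V a plane at x. Indeed this hull is compact by Caratheodory's theorem, so
    that otherwise a half-space with rational coefficients separates it from d(x)
    [rational_separation]; there are countably many of these, and for each of them
    positivity of L makes the exceptional set null [half_density_null]. The numbers
    d_i(x) therefore define an element of the convex hull of the phi-planes at x, and
    integrating it gives L back [positive_functional_current].

    Vector fields are derivations of the algebra of smooth functions. What makes
    tensor calculus possible with them is that near any point they are combinations
    of finitely many global derivations [exists_frame], by Hadamard's lemma. *)

(** * Functions of class C^k on open sets *)

Section CkCalculus.
Context {R : realType} {V : normedModType R}.
Implicit Types (U : set V).

Lemma Ck_onS {W : normedModType R} k U U' (f : V -> W) : U' `<=` U ->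
  Ck_on k U f -> Ck_on k U' f.
Proof.
move=> UU; elim: k f => [|k IHk] f /=; first by move=> cf x /UU; exact: cf.
by move=> [df Cf]; split=> [x /UU/df //|v]; exact: IHk.
Qed.

Lemma Ck_on_local {W : normedModType R} k U (f : V -> W) :
  (forall x, U x -> exists2 U', U' x & Ck_on k U' f) -> Ck_on k U f.
Proof.
elim: k f => [|k IHk] f /= H; first by move=> x /H[U' U'x]; exact.
split=> [x /H[U' U'x [df _]]|v]; first exact: df.
by apply: IHk => x /H[U' U'x [_ Cf]]; exists U'.
Qed.

Lemma Ck_on_sum k U (I : Type) (r : seq I) (P : pred I) (f : I -> V -> R) : open U ->
  (forall i, P i -> Ck_on k U (f i)) -> Ck_on k U (fun x => \sum_(i <- r | P i) f i x).
Proof.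
move=> oU Cf; rewrite (_ : (fun x => _) = \sum_(i <- r | P i) f i); last first.
  by apply/funext => x; rewrite fct_sumE.
elim/big_ind : _ => //; first exact: Ck_on_cst.
by move=> g h; exact: Ck_onD.
Qed.

Lemma Ck_on_prod k U (I : Type) (r : seq I) (P : pred I) (f : I -> V -> R) : open U ->
  (forall i, P i -> Ck_on k U (f i)) -> Ck_on k U (fun x => \prod_(i <- r | P i) f i x).
Proof.
move=> oU Cf; elim: r => [|i r IHr].
  rewrite (_ : (fun x => _) = cst 1); first exact: Ck_on_cst.
  by apply/funext => x; rewrite big_nil.
rewrite (_ : (fun x => _) =
    if P i then f i * (fun x => \prod_(i <- r | P i) f i x) else
    (fun x => \prod_(i <- r | P i) f i x)); last first.
  by apply/funext => x; rewrite big_cons; case: ifP.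
by case: ifPn => // Pi; apply: Ck_onM => //; exact: Cf.
Qed.

(** The inner map is a combination of fixed vectors with scalar coefficients: the
    derivative is then a sum of products in which h only enters through another
    composite of the same shape, and the induction of Ck_on_comp goes through. *)
Lemma derive_frame_comp {W : normedModType R} m (e : 'I_m -> W)
    (c : 'I_m -> V -> R) (h : W -> R) x v :
  (forall j, differentiable (c j) x) ->
  differentiable h (\sum_j c j x *: e j) ->
  differentiable (fun x => h (\sum_j c j x *: e j)) x /\
  'D_v (fun x => h (\sum_j c j x *: e j)) x =
  \sum_j 'D_v (c j) x * 'D_(e j) h (\sum_j c j x *: e j).
Proof.
move=> dc dh; set F := fun x => \sum_j c j x *: e j.
have FE : F = \sum_j (fun x => c j x *: e j) by apply/funext => y; rewrite fct_sumE.
have dF : differentiable F x.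
  by rewrite FE; apply: differentiable_sum => j; exact: differentiableZl.
have dhF : differentiable (h \o F) x by exact: differentiable_comp.
split=> //; rewrite -[LHS]/('D_v (h \o F) x) deriveE // diff_comp //=.
have -> : 'd F x v = \sum_j 'D_v (c j) x *: e j.
  rewrite -deriveE // FE derive_sum; last first.
    by move=> j; apply: diff_derivable; exact: differentiableZl.
  apply: eq_bigr => j _.
  rewrite deriveE; last exact: differentiableZl.
  by rewrite (diffZl (e j) (dc j)) /= -deriveE.
rewrite linear_sum /=; apply: eq_bigr => j _.
by rewrite linearZ /= -deriveE.
Qed.

Lemma Ck_on_comp {W : normedModType R} k m (e : 'I_m -> W)
    (c : 'I_m -> V -> R) (U : set V) (U' : set W) (h : W -> R) : open U ->
  (forall x, U x -> U' (\sum_j c j x *: e j)) ->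
  (forall j, Ck_on k U (c j)) -> Ck_on k U' h ->
  Ck_on k U (fun x => h (\sum_j c j x *: e j)).
Proof.
move=> oU cU; elim: k h => [|k IHk] h Cc.
  move=> Ch x Ux; apply: (@continuous_comp _ _ _ (fun x => \sum_j c j x *: e j) h).
    have -> : (fun x => \sum_j c j x *: e j) = \sum_j (fun x => c j x *: e j).
      by apply/funext => y; rewrite fct_sumE.
    elim/big_ind : _ => [||j _]; first exact: cst_continuous.
      by move=> f g; exact: continuousD.
    by apply: continuousZl; exact: Cc.
  by apply: Ch; exact: cU.
move=> [dh Ch]; split=> [x Ux|v].
  have [] // := @derive_frame_comp _ _ e c h x 0 => [j|]; first by have [+ _] := Cc j; exact.
  by apply: dh; exact: cU.
apply: (@eq_Ck_on _ _ _ _ _ (fun x => \sum_j 'D_v (c j) x * 'D_(e j) h (\sum_j c j x *: e j))) => //.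
  move=> x Ux; have [j||_ ->//] := @derive_frame_comp _ _ e c h x v.
    by have [+ _] := Cc j; exact.
  by apply: dh; exact: cU.
apply: Ck_on_sum => // j _; apply: Ck_onM => //; first by have [_] := Cc j; exact.
apply: (IHk ('D_(e j) h)) => [i|]; last exact: Ch.
exact: Ck_onW (Cc i).
Qed.

Lemma Ck_on_coord k U n (f : V -> 'rV[R]_n) j : open U -> Ck_on k U f ->
  Ck_on k U (fun x => f x 0 j).
Proof.
move=> oU; elim: k f => [|k IHk] f.
  move=> Cf x Ux; apply: (@continuous_comp _ _ _ f (fun M : 'rV_n => M 0 j)) (Cf x Ux) _.
  exact: coord_continuous.
move=> [df Cf]; split=> [x Ux|v].
  apply: (@differentiable_comp _ _ _ _ f (fun M : 'rV_n => M 0 j)); first exact: df.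
  exact: differentiable_coord.
apply: eq_Ck_on (IHk _ (Cf v)) => // x Ux.
by rewrite derive_mx ?mxE //; apply: diff_derivable; exact: df.
Qed.

End CkCalculus.

(** * Flat functions *)

Section FlatFunction.
Context {R : realType}.

(** flat 0 is the function exp(-1/t), extended by 0; the powers of 1/t make the family
    stable under differentiation. *)
Definition flat (m : nat) (t : R) : R :=
  if 0 < t then t^-1 ^+ m * expR (- t^-1) else 0.

Lemma flat_gt0 m t : (0 < flat m t) = (0 < t).
Proof.
rewrite /flat; case: ifPn => [t0|]; last by rewrite ltxx.
by rewrite mulr_gt0 ?expR_gt0// exprn_gt0// invr_gt0.
Qed.

Lemma flat_ge0 m t : 0 <= flat m t.
Proof.
rewrite /flat; case: ifPn => // t0.
by rewrite mulr_ge0 ?expR_ge0// exprn_ge0// invr_ge0 ltW.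
Qed.

(** exp(s) >= s^(m+2) / (m+2)! at s = 1/t. The factor t^2 is what makes the difference
    quotient at 0 tend to 0. *)
Lemma flat_le m t : flat m t <= (m.+2)`!%:R * t ^+ 2.
Proof.
rewrite /flat; case: ifPn => [t0|_]; last by rewrite mulr_ge0// sqr_ge0.
have tV0 : 0 <= t^-1 by rewrite invr_ge0 ltW.
have /(le_trans _) := expR_ge1Dxn m.+1 tV0.
move=> /(_ (t^-1 ^+ m.+2 / (m.+2)`!%:R)); rewrite lerDr ler01 => /(_ isT) H.
rewrite expRN ler_pdivrMr ?expR_gt0// -ler_pdivrMl; last first.
  by rewrite mulr_gt0 ?exprn_gt0// ltr0n fact_gt0.
apply: le_trans H; rewrite invfM -exprVn [leRHS]mulrC -mulrA -exprD.
by rewrite [X in _ ^+ X]addnC addn2.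
Qed.

Lemma is_derive_flat (m : nat) (t : R) :
  is_derive t 1 (flat m : R -> R) (flat m.+2 t - m%:R * flat m.+1 t).
Proof.
have [t0|t0|->] := ltgtP t 0.
- have F0 : \near t, cst 0 t = flat m t.
    by near=> s; rewrite /flat ltNge ltW//=; near: s; exact: lt_nbhsl.
  apply: near_eq_is_derive F0 _ => //.
  rewrite /flat !ltNge !(ltW t0)/= mulr0 subr0; exact: is_derive_cst.
- have F0 : \near t, (fun s : R => s^-1 ^+ m * expR (- s^-1)) t = flat m t.
    by near=> s; rewrite /flat ifT//; near: s; exact: lt_nbhsr.
  apply: near_eq_is_derive F0 _ => //.
  have tN : t != 0 by rewrite gt_eqF.
  have dV : is_derive t 1 (fun s : R => s^-1) (- t ^- 2).
    have := @is_deriveV R id t 1 1 tN (is_derive_id _ _).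
    by rewrite /GRing.scale /= mulr1.
  have dE : is_derive t 1 (fun s : R => expR (- s^-1)) (expR (- t^-1) * t ^- 2).
    have := @is_derive1_comp _ expR (fun s : R => - s^-1) t _ _ (is_derive_expR _) (is_deriveN dV).
    by rewrite opprK.
  have dX := @is_deriveX _ _ _ m _ _ _ dV.
  have := is_deriveM dX dE; rewrite /flat t0.
  rewrite (_ : _ * _ = fun s : R => s^-1 ^+ m * expR (- s^-1)); last first.
    by apply/funext => s; rewrite -[LHS]/((_ ^+ m) s * _) exprfctE.
  move=> /is_derive_eq; apply; rewrite exprfctE /GRing.scale/=.
  case: m {dX} => [|m]; first by rewrite !mul0r mulr0 addr0 subr0 -exprVn mul1r mulrC.
  rewrite /= -exprVn (exprS _ m.+2) (exprS _ m.+1) (exprS _ m) -mulr_natl; ring.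
- have -> : flat m.+2 0 - m%:R * flat m.+1 0 = 0 by rewrite /flat ltxx mulr0 subr0.
  have H : h^-1 *: (flat m (h *: 1 + 0) - flat m 0) @[h --> (0:R)^'] --> (0 : R).
    apply/cvgrPdist_le => e e0; near=> h.
    rewrite sub0r normrN /GRing.scale /= mulr1 addr0 {2}/flat ltxx subr0 normrM.
    rewrite (ger0_norm (flat_ge0 m h)) normfV ler_pdivrMl ?normr_gt0; last first.
      by near: h; exact: nbhs_dnbhs_neq.
    apply: le_trans (flat_le m h) _.
    rewrite -real_normK ?num_real// expr2 mulrA [leRHS]mulrC ler_wpM2r//.
    rewrite -ler_pdivlMl ?ltr0n ?fact_gt0//.
    by near: h; apply: dnbhs0_le; rewrite mulr_gt0 ?invr_gt0 ?ltr0n ?fact_gt0.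
  by apply: DeriveDef; [apply/cvg_ex; exists 0 | apply: cvg_lim].
Unshelve. all: by end_near. Qed.

Lemma differentiable_flat m t : differentiable (flat m) t.
Proof. by apply/derivable1_diffP; have [] := is_derive_flat m t. Qed.

Lemma smooth_flat m : smooth_on [set: R] (flat m).
Proof.
move=> k; elim: k m => [|k IHk] m.
  by move=> x _; exact: differentiable_continuous (differentiable_flat m x).
split=> [x _|v]; first exact: differentiable_flat.
have -> : 'D_v (flat m) = cst v * (flat m.+2 + cst (- m%:R) * flat m.+1).
  apply/funext => t; rewrite deriveE; last exact: differentiable_flat.
  have -> : v = v *: (1 : R) by rewrite /GRing.scale /= mulr1.
  rewrite linearZ /= -deriveE; last exact: differentiable_flat.
  rewrite (@derive_val _ _ _ _ _ _ _ (is_derive_flat m t)) !fctE /= /GRing.scale /= mulr1; congr (_ * _).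
  by rewrite mulNr.
apply: Ck_onM; [exact: openT|exact: Ck_on_cst|].
apply: Ck_onD; [exact: openT|exact: IHk|].
apply: Ck_onM; [exact: openT|exact: Ck_on_cst|exact: IHk].
Qed.

Lemma flat_nd : {homo flat 0 : s t / s <= t}.
Proof.
move=> s t st; rewrite {1}/flat; case: ifPn => [s0|_]; last exact: flat_ge0.
have t0 : 0 < t := lt_le_trans s0 st.
by rewrite /flat t0 !expr0 !mul1r ler_expR lerN2 lef_pV2.
Qed.

End FlatFunction.

(** * Hadamard's lemma *)

Lemma differentiable_linear_approx {R : realType} {V W : normedModType R}
    (f : V -> W) (d : {linear V -> W}) x : continuous d ->
  (forall e : R, 0 < e -> \forall w \near x, `|f w - f x - d (w - x)| <= e * `|w - x|) ->
  differentiable f x /\ 'd f x = d :> (V -> W).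
Proof.
move=> dC H.
have dE : f \o shift x = cst (f x) + d +o_ 0 id.
  apply/eqaddoP => e /H; rewrite (near_shift 0 x) /= => {}H.
  apply: filterS H => w /=; rewrite !fctE /= subr0 addrK opprD addrA; exact.
have D := diff_unique dC dE.
by split=> //; apply/diff_locallyP; split; rewrite D.
Qed.

Section Hadamard.
Context {R : realType} {n : nat}.
Local Notation V := 'rV[R]_n.
Implicit Types (F A : V -> R) (z w p v : V).

Lemma is_derive_line F p v (s : R) : differentiable F (p + s *: v) ->
  is_derive s 1 (fun s : R => F (p + s *: v)) ('D_v F (p + s *: v)).
Proof.
move=> dF.
pose e (i : 'I_2) := if i == ord0 then p else v.
pose c (i : 'I_2) : R -> R := if i == ord0 then cst 1 else id.
have E t : \sum_i c i t *: e i = p + t *: v.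
  by rewrite !big_ord_recl big_ord0 /c /e /= scale1r addr0.
have [i||d D] := @derive_frame_comp R R V 2 e c F s 1.
- rewrite /c; case: ifP => _; first exact: differentiable_cst.
  by apply/derivable1_diffP; exact: derivable_id.
- by rewrite E.
have FE : (fun x => F (\sum_j c j x *: e j)) = (fun s : R => F (p + s *: v)).
  by apply/funext => t; rewrite E.
rewrite FE in d D; apply: DeriveDef; first exact/derivable1_diffP.
by rewrite D E !big_ord_recl big_ord0 /c /e /= derive_cst derive_id mul0r mul1r add0r addr0.
Qed.

Lemma derive_gradient F z v : differentiable F z ->
  'D_v F z = \sum_j v 0 j * 'D_(delta_mx 0 j) F z.
Proof.
move=> dF; rewrite deriveE // {1}[v]row_sum_delta linear_sum; apply: eq_bigr => j _.
by rewrite linearZ deriveE.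
Qed.

Lemma differentiable_gradient F z (c : 'I_n -> R) :
  (forall e : R, 0 < e -> \forall w \near z,
    `|F w - F z - \sum_j (w - z) 0 j * c j| <= e * `|w - z|) ->
  differentiable F z /\ forall v, 'D_v F z = \sum_j v 0 j * c j.
Proof.
move=> H; pose d (v : V) := \sum_j v 0 j * c j.
have dlin : linear d.
  move=> a u v; rewrite /d scaler_sumr -big_split; apply: eq_bigr => j _.
  by rewrite !mxE mulrDl -mulrA.
pose dM := GRing.isLinear.Build _ _ _ _ _ dlin.
pose dL : {linear V -> R} := HB.pack d dM.
have dC : continuous dL.
  rewrite (_ : (dL : V -> R) = \sum_j (fun v : V => v 0 j * c j)); last first.
    by apply/funext => v; rewrite fct_sumE.
  elim/big_ind : _ => [||j _ x]; first exact: cst_continuous.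
    by move=> f g cf cg x; apply: continuousD; [exact: cf|exact: cg].
  by apply: continuousM; [exact: coord_continuous|exact: cst_continuous].
have [dF D] := @differentiable_linear_approx R V R F dL z dC H.
by split=> // v; rewrite deriveE // D.
Qed.

Variables (U : set V) (z0 : V).
Hypothesis oU : open U.

Definition segm w (t : R) : V := z0 + t *: (w - z0).

Hypothesis starU : forall w t, U w -> 0 <= t <= 1 -> U (segm w t).

Lemma segm_continuous (q : R * V) : {for q, continuous (fun q : R * V => segm q.2 q.1)}.
Proof.
apply: continuousD; first exact: cst_continuous.
apply: continuousZ; first exact: cvg_fst.
by apply: continuousB; [exact: cvg_snd | exact: cst_continuous].
Qed.

(** Uniformity in t comes from the compactness of [0, 1]; it is what allows
    differentiation under the integral sign in mean_differentiable. *)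
Lemma segm_uniform A z (e : R) : (forall w, U w -> {for w, continuous A}) -> U z -> 0 < e ->
  \forall w \near z, forall t, 0 <= t <= 1 -> `|A (segm w t) - A (segm z t)| <= e.
Proof.
move=> cA Uz e0.
have /compact_near_coveringP K := @segment_compact R 0 1.
have e2 : 0 < e / 2 by rewrite divr_gt0.
have := K _ (nbhs z) (fun w t => `|A (segm w t) - A (segm z t)| <= e) _.
suff H : forall t0 : R, `[0, 1]%classic t0 ->
    \forall t \near t0 & w \near nbhs z, `|A (segm w t) - A (segm z t)| <= e.
  move=> /(_ _ H); apply: filterS => w + t t01; apply.
  by rewrite /= in_itv.
move=> t0; rewrite /= in_itv /= => t01.
have c1 : \forall q \near ((t0, z) : R * V), `|A (segm z t0) - A (segm q.2 q.1)| <= e / 2.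
  have /cvgrPdist_le := @continuous_comp _ _ _ (fun q : R * V => segm q.2 q.1) A (t0, z)
    (@segm_continuous _) (cA _ (starU Uz t01)).
  exact.
have c2 : \forall q \near ((t0, z) : R * V), `|A (segm z t0) - A (segm z q.1)| <= e / 2.
  case: c1 => -[P Q] /= [P0 Q0] PQ; exists (P, setT) => /=; first by split=> //; exact: filterT.
  move=> [t w] /= [Pt _]; apply: (PQ (t, z)); split=> //=; exact: nbhs_singleton.
near=> q.
have q1 : `|A (segm z t0) - A (segm q.2 q.1)| <= e / 2 by near: q.
have q2 : `|A (segm z t0) - A (segm z q.1)| <= e / 2 by near: q.
rewrite (splitr e) -[X in `|X|](subrKA (A (segm z t0))).
by rewrite (le_trans (ler_normD _ _))// lerD// distrC.
Unshelve. all: by end_near. Qed.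

(** Differentiating A along the segment produces a factor t, hence the weight t^m: the
    family of these averages is stable under differentiation. *)
Definition mean (m : nat) A w : R :=
  \int[lebesgue_measure]_(t in `[0, 1]) (t ^+ m * A (segm w t)).

Lemma mean_continuous A w (p : R -> R) : (forall w, U w -> {for w, continuous A}) -> U w ->
  continuous p ->
  forall t : R, 0 <= t <= 1 -> {for t, continuous (fun t => p t * A (segm w t))}.
Proof.
move=> cA Uw cp t t01.
apply: continuousM; first exact: cp.
apply: (@continuous_comp _ _ _ (segm w) A); last by apply: cA; exact: starU.
apply: continuousD; first exact: cst_continuous.
by apply: continuousZr_tmp; exact: cvg_id.
Qed.

Lemma continuous_lincomb m (c : 'I_m -> R) (f : 'I_m -> R -> R) (t : R) :
  (forall i, {for t, continuous (f i)}) -> {for t, continuous (fun t : R => \sum_i c i * f i t)}.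
Proof.
move=> cf; rewrite (_ : (fun t => _) = \sum_i (fun t : R => c i * f i t)).
  elim/big_ind : _ => [|g h cg ch|i _]; [exact: cst_continuous|exact: continuousD|].
  by apply: continuousM; [exact: cst_continuous|exact: cf].
by apply/funext => y; rewrite fct_sumE.
Qed.

Lemma unit_itv_integrable (f : R -> R) : (forall t : R, 0 <= t <= 1 -> {for t, continuous f}) ->
  lebesgue_measure.-integrable `[0, 1] (EFin \o f).
Proof.
move=> cf; apply: continuous_compact_integrable; first exact: segment_compact.
by apply: continuous_in_subspaceT => t; rewrite inE /= in_itv /=; exact: cf.
Qed.

Lemma unit_itv_integral_sum m (c : 'I_m -> R) (f : 'I_m -> R -> R) :
  (forall i t, 0 <= t <= 1 -> {for t, continuous (f i)}) ->
  \int[lebesgue_measure]_(t in `[0, 1]) (\sum_i c i * f i t) =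
  \sum_i c i * \int[lebesgue_measure]_(t in `[0, 1]) f i t.
Proof.
elim: m c f => [|m IHm] c f cf.
  rewrite big_ord0; under eq_Rintegral do rewrite big_ord0.
  by rewrite Rintegral_cst ?mul0r//; exact: measurable_itv.
rewrite big_ord_recl; under eq_Rintegral do rewrite big_ord_recl.
have cM i t : 0 <= t <= 1 -> {for t, continuous (fun t => c i * f i t)}.
  by move=> t01; apply: continuousM; [exact: cst_continuous|exact: cf].
rewrite RintegralD ?IHm ?RintegralZl//; try exact: measurable_itv.
- by apply: unit_itv_integrable => t; exact: cf.
- by move=> i t; exact: cf.
- by apply: unit_itv_integrable => t; exact: cM.
- apply: unit_itv_integrable => t t01.
  by apply: continuous_lincomb => i; exact: cf.
Qed.

Lemma unit_itv_integral_cst (c : R) : \int[lebesgue_measure]_(t in `[0%R, 1%R]) cst c t = c.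
Proof.
rewrite Rintegral_cst; last exact: measurable_itv.
have := @lebesgue_measure_itv R `[0%R, 1%R].
by rewrite /= lte_fin ltr01 oppr0 adde0 => ->; rewrite mulr1.
Qed.

Lemma mean_bound (f : R -> R) (e : R) :
  lebesgue_measure.-integrable `[0, 1] (EFin \o f) ->
  (forall t, 0 <= t <= 1 -> `|f t| <= e) ->
  `|\int[lebesgue_measure]_(t in `[0, 1]) f t| <= e.
Proof.
move=> fi fe; apply: (le_trans (le_normr_Rintegral _ fi)); first exact: measurable_itv.
have ei : lebesgue_measure.-integrable `[0%R, 1%R] (EFin \o cst e).
  by apply: continuous_compact_integrable; [exact: segment_compact|apply: continuous_subspaceT; exact: cst_continuous].
rewrite -[leRHS]unit_itv_integral_cst.
by apply: le_Rintegral => //; exact: integrable_norm fi.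
Qed.

Let dd A (j : 'I_n) : V -> R := 'D_(delta_mx 0 j) A.

(** The error of the first order expansion is the average of the errors along the
    segments from z0; each of these is bounded by the mean value theorem and the
    uniform continuity of the partial derivatives of A. *)
Lemma mean_differentiable m A z : Ck_on 1 U A -> U z ->
  differentiable (mean m A) z /\
  forall v, 'D_v (mean m A) z = \sum_j v 0 j * mean m.+1 (dd A j) z.
Proof.
move=> [dA cA] Uz; apply: differentiable_gradient => e e0.
have AC w : U w -> {for w, continuous A} by move=> /dA /differentiable_continuous.
have en : 0 < e / n.+1%:R by rewrite divr_gt0.
have H1 : \forall w \near z, forall j t, 0 <= t <= 1 ->
    `|dd A j (segm w t) - dd A j (segm z t)| <= e / n.+1%:R.
  apply: (@filter_forall _ _ (fun (j : 'I_n) w => forall t, 0 <= t <= 1 ->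
    `|dd A j (segm w t) - dd A j (segm z t)| <= e / n.+1%:R) (nbhs z)) => j.
  by apply: segm_uniform => // w; exact: cA.
have [r /= r0 zr] : exists2 r : R, 0 < r & ball z r `<=` U `&` [set w | forall j t, 0 <= t <= 1 ->
    `|dd A j (segm w t) - dd A j (segm z t)| <= e / n.+1%:R].
  have : nbhs z (U `&` [set w | forall j t, 0 <= t <= 1 ->
    `|dd A j (segm w t) - dd A j (segm z t)| <= e / n.+1%:R]).
    by apply: filterI => //; exact: open_nbhs_nbhs.
  by move=> /nbhs_ballP[r r0 zr]; exists r.
near=> w.
have wr : ball z r w by near: w; exact: nbhsx_ballx.
have Uw : U w by have [] := zr _ wr.
pose D t := A (segm w t) - A (segm z t) - \sum_j (w - z) 0 j * (t * dd A j (segm z t)).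
have cA1 u : U u -> forall t : R, 0 <= t <= 1 -> {for t, continuous (fun t : R => t ^+ m * A (segm u t))}.
  by move=> Uu; apply: mean_continuous => //; exact: exprn_continuous.
have cA2 j : forall t : R, 0 <= t <= 1 -> {for t, continuous (fun t : R => t ^+ m.+1 * dd A j (segm z t))}.
  by apply: mean_continuous => //; [exact: cA|exact: exprn_continuous].
have cA3 (t : R) : 0 <= t <= 1 ->
    {for t, continuous (fun t : R => \sum_j (w - z) 0 j * (t ^+ m.+1 * dd A j (segm z t)))}.
  by move=> t01; apply: continuous_lincomb => j; exact: cA2.
have DtE : (fun t : R => t ^+ m * D t) = (fun t => (t ^+ m * A (segm w t) - t ^+ m * A (segm z t)) -
    \sum_j (w - z) 0 j * (t ^+ m.+1 * dd A j (segm z t))).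
  apply/funext => t; rewrite /D 2!mulrBr mulr_sumr; congr (_ - _).
  by apply: eq_bigr => j _; rewrite exprSr; ring.
have DI : lebesgue_measure.-integrable `[0, 1] (EFin \o (fun t : R => t ^+ m * D t)).
  rewrite DtE; apply: unit_itv_integrable => t t01.
  by apply: continuousB; [apply: continuousB; exact: cA1|exact: cA3].
have -> : mean m A w - mean m A z - \sum_j (w - z) 0 j * mean m.+1 (dd A j) z =
    \int[lebesgue_measure]_(t in `[0, 1]) (t ^+ m * D t).
  rewrite DtE !RintegralB ?unit_itv_integral_sum//; try exact: measurable_itv; try exact: cA2.
  - by apply: unit_itv_integrable => t; exact: cA1.
  - by apply: unit_itv_integrable => t; exact: cA1.
  - by apply: unit_itv_integrable => t t01; apply: continuousB; exact: cA1.
  - by apply: unit_itv_integrable => t; exact: cA3.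
apply: mean_bound => // t t01; rewrite normrM.
have tm : `|t ^+ m| <= 1.
  by rewrite normrX; apply: exprn_ile1 => //; case/andP: t01 => *; rewrite ger0_norm.
rewrite -[leRHS]mul1r; apply: ler_pM => //.
have line s : segm z t + s *: (t *: (w - z)) = segm (z + s *: (w - z)) t.
  rewrite /segm -addrA; congr (_ + _).
  by rewrite scalerA mulrC -scalerA -scalerDr addrAC.
have bs s : 0 <= s <= 1 -> ball z r (z + s *: (w - z)).
  move=> /andP[s0 s1]; move: wr; rewrite -!ball_normE /= opprD addrA subrr sub0r normrN.
  rewrite distrC; apply: le_lt_trans; rewrite normrZ ger0_norm//.
  by rewrite ler_piMl.
have dU s : 0 <= s <= 1 -> U (segm (z + s *: (w - z)) t).
  by move=> s01; apply: starU => //; have [] := zr _ (bs _ s01).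
have /(_ ler01) := @MVT_segment R (fun s => A (segm z t + s *: (t *: (w - z))))
  (fun s => 'D_(t *: (w - z)) A (segm z t + s *: (t *: (w - z)))) 0 1.
case.
- move=> s /andP[s0 s1]; apply: is_derive_line; rewrite line; apply/dA/dU.
  by rewrite !ltW.
- apply: continuous_in_subspaceT => s; rewrite inE /= in_itv /= => s01.
  apply: differentiable_continuous; apply/derivable1_diffP.
  by have [] := @is_derive_line A (segm z t) (t *: (w - z)) s (ltac:(rewrite line; exact/dA/dU)).
move=> s; rewrite in_itv /= => s01.
rewrite !line scale0r scale1r addr0 subr0 mulr1 subrKC => AE.
have DE : D t = \sum_j (w - z) 0 j * t * (dd A j (segm (z + s *: (w - z)) t) - dd A j (segm z t)).
  rewrite /D AE derive_gradient; last exact/dA/dU.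
  rewrite -sumrB; apply: eq_bigr => j _; rewrite !mxE /dd; ring.
rewrite DE; apply: le_trans (ler_norm_sum _ _ _) _.
apply: (@le_trans _ _ (\sum_(j < n) (e / n.+1%:R * `|w - z|))).
  apply: ler_sum => j _; rewrite normrM mulrC; apply: ler_pM => //.
    by have [_ +] := zr _ (bs _ s01); exact.
  rewrite normrM -[leRHS]mulr1; apply: ler_pM => //.
    by rewrite [leRHS]/Num.Def.normr/= mx_normrE; apply: le_trans; last exact: (le_bigmax _ _ (0, j)).
  by case/andP: t01 => *; rewrite ger0_norm.
rewrite sumr_const card_ord -[leLHS]mulr_natr mulrAC ler_wpM2r// -mulrA ler_piMr// ?ltW//.
by rewrite mulrC ltr_pdivrMr ?ltr0n// mul1r ltr_nat.
Unshelve. all: by end_near. Qed.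

Lemma mean_smooth m A : smooth_on U A -> smooth_on U (mean m A).
Proof.
move=> sA k; elim: k m A sA => [|k IHk] m A sA.
  by move=> z /(mean_differentiable m (sA 1%N))[/differentiable_continuous].
split=> [z Uz|v]; first by have [] := mean_differentiable m (sA 1%N) Uz.
apply: (@eq_Ck_on _ _ _ _ _ (fun z => \sum_j v 0 j * mean m.+1 (dd A j) z)) => //.
  by move=> z Uz; have [_ ->] := mean_differentiable m (sA 1%N) Uz.
apply: Ck_on_sum => // j _; apply: Ck_onM => //; first exact: Ck_on_cst.
exact/IHk/derive_smooth_on.
Qed.

(** F w - F z0 is the integral of the derivative of F along the segment from z0 to w, so
    the averages of the partial derivatives over the segment serve as coefficients. *)
Lemma hadamard F : smooth_on U F -> U z0 -> exists G : 'I_n -> V -> R,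
  [/\ forall j, smooth_on U (G j),
      forall w, U w -> F w = F z0 + \sum_j (w - z0) 0 j * G j w &
      forall j, G j z0 = 'D_(delta_mx 0 j) F z0].
Proof.
move=> sF Uz0; exists (fun j => mean 0 (dd F j)); split=> [j|w Uw|j].
- by apply: mean_smooth; exact: derive_smooth_on.
- have dF (t : R) : 0 <= t <= 1 -> differentiable F (segm w t).
    by move=> t01; apply: (sF 1%N).1; exact: starU.
  have cdF j : forall t : R, 0 <= t <= 1 -> {for t, continuous (fun t : R => 1 * dd F j (segm w t))}.
    apply: mean_continuous => // [u Uu|x]; last exact: cst_continuous.
    exact: (derive_smooth_on _ sF 0%N).
  have dl (t : R) : 0 <= t <= 1 -> is_derive t 1 (fun t : R => F (segm w t)) ('D_(w - z0) F (segm w t)).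
    by move=> t01; apply: is_derive_line; exact: dF.
  have H : (\int[lebesgue_measure]_(t in `[0%R, 1%R]) ((\sum_j (w - z0) 0 j * (1 * dd F j (segm w t))) )%:E =
     (F (segm w 1%R))%:E - (F (segm w 0%R))%:E)%E.
    have cl (t : R) : 0 <= t <= 1 -> {for t, continuous (fun t : R => F (segm w t))}.
      by move=> t01; apply/differentiable_continuous/derivable1_diffP; have [] := dl _ t01.
    apply: (@continuous_FTC2 R (fun t : R => \sum_j (w - z0) 0 j * (1 * dd F j (segm w t)))
      (fun t : R => F (segm w t)) 0 1 ltr01).
    + apply: continuous_in_subspaceT => t; rewrite inE /= in_itv /= => t01.
      by apply: continuous_lincomb => j; exact: cdF.
    + split.
      * by move=> t; rewrite in_itv /= => /andP[t0 t1]; have [] := dl t (ltac:(by rewrite !ltW)).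
      * by apply: cvg_at_right_filter; apply: cl; rewrite lexx ler01.
      * by apply: cvg_at_left_filter; apply: cl; rewrite lexx ler01.
    + move=> t; rewrite in_itv /= => /andP[t0 t1].
      have t01 : 0 <= t <= 1 by rewrite !ltW.
      rewrite derive1E (@derive_val _ _ _ _ _ _ _ (dl t t01)) derive_gradient; last exact: dF.
      by apply: eq_bigr => j _; rewrite mul1r.
  have -> : \sum_j (w - z0) 0 j * mean 0 (dd F j) w = F (segm w 1) - F (segm w 0).
    by rewrite -unit_itv_integral_sum// /Rintegral H.
  by rewrite /segm scale0r scale1r addr0 !subrKC.
- rewrite /mean /segm; under eq_Rintegral do rewrite expr0 mul1r subrr scaler0 addr0.
  exact: unit_itv_integral_cst.
Qed.

End Hadamard.

(** * Evaluating smooth functions, and bumps on row vectors *)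

Section SmoothFunEval.
Context {R : realType} {n : nat} {X : smooth_manifold R n}.
Local Notation C := (smoothfun X).
Implicit Types (f g : C) (x : X).

Lemma sfDE f g x : (f + g) x = f x + g x. Proof. by []. Qed.
Lemma sfNE f x : (- f) x = - f x. Proof. by []. Qed.
Lemma sfBE f g x : (f - g) x = f x - g x. Proof. by []. Qed.
Lemma sfME f g x : (f * g) x = f x * g x. Proof. by []. Qed.
Lemma sfZE (a : R) f x : (a *: f) x = a * f x. Proof. by []. Qed.
Lemma sf0E x : (0 : C) x = 0. Proof. by []. Qed.
Lemma sf1E x : (1 : C) x = 1. Proof. by []. Qed.
Lemma sfXE f k x : (f ^+ k) x = f x ^+ k.
Proof. by elim: k => [|k IHk]; rewrite ?expr0 ?sf1E// !exprS sfME IHk. Qed.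
Lemma sf_sumE (I : Type) (r : seq I) (P : pred I) (F : I -> C) x :
  (\sum_(i <- r | P i) F i) x = \sum_(i <- r | P i) F i x.
Proof. by elim/big_rec2 : _ => // i f g _ <-. Qed.
Lemma sf_prodE (I : Type) (r : seq I) (P : pred I) (F : I -> C) x :
  (\prod_(i <- r | P i) F i) x = \prod_(i <- r | P i) F i x.
Proof. by elim/big_rec2 : _ => // i f g _ <-. Qed.

Lemma smoothfun_ext f g : (forall x, f x = g x) -> f = g.
Proof. by move=> fg; apply/val_inj/funext. Qed.

Lemma vfield_sumE (I : Type) (r : seq I) (P : pred I) (F : I -> vfield X) f :
  (\sum_(i <- r | P i) F i) f = \sum_(i <- r | P i) F i f.
Proof. by elim/big_rec2 : _ => // i V g _ <-. Qed.

Lemma vfield_f_sum (V : vfield X) (I : Type) (r : seq I) (P : pred I) (F : I -> C) :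
  V (\sum_(i <- r | P i) F i) = \sum_(i <- r | P i) V (F i).
Proof. by elim/big_rec2 : _ => [|i f g _ <-]; [exact: vfield0|exact: vfieldD]. Qed.

Lemma vfield1 (V : vfield X) : V 1 = 0.
Proof.
have := vfieldM V 1 1; rewrite !mulr1 mul1r => /eqP.
by rewrite -[X in X == _]addr0 eq_sym (inj_eq (addrI _)) => /eqP.
Qed.

End SmoothFunEval.

Section Bumps.
Context {R : realType} {n : nat}.
Local Notation V := 'rV[R]_n.

Lemma smooth_on_id (W : normedModType R) (U : set W) : smooth_on U (id : W -> W).
Proof.
case=> [|k]; first by move=> x _; exact: cvg_id.
split=> [x _|v]; first by have [] := is_diff_id x.
rewrite (_ : 'D_v _ = cst v); first exact: Ck_on_cst.
by apply/funext => x; rewrite derive_id.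
Qed.

Lemma smooth_on_coord_fun (U : set V) j : open U -> smooth_on U (fun u : V => u 0 j).
Proof. by move=> oU k; apply: (@Ck_on_coord _ _ k U n id j) => //; exact: smooth_on_id. Qed.

Lemma smooth_on_comp1 (W : normedModType R) (U : set W) (c : W -> R) (h : R -> R) : open U ->
  smooth_on U c -> smooth_on [set: R] h -> smooth_on U (h \o c).
Proof.
move=> oU sc sh k.
have := @Ck_on_comp R W R k 1 (fun=> 1) (fun=> c) U setT h oU _ (fun=> sc k) (sh k).
rewrite (_ : (fun x => _) = h \o c); first exact.
by apply/funext => x; rewrite big_ord1 /GRing.scale /= mulr1.
Qed.

Lemma smooth_onS (W Z : normedModType R) (U U' : set W) (f : W -> Z) : U' `<=` U ->
  smooth_on U f -> smooth_on U' f.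
Proof. by move=> UU sf k; exact: Ck_onS (sf k). Qed.

(** A product over the coordinates, because the norm of row vectors is the supremum norm:
    the function is positive exactly on the ball of radius r. *)
Definition bump (c : V) (r : R) (u : V) : R :=
  \prod_j (flat 0 (r - (u 0 j - c 0 j)) * flat 0 (r + (u 0 j - c 0 j))).

Lemma bump_ge0 c r u : 0 <= bump c r u.
Proof. by apply: prodr_ge0 => j _; rewrite mulr_ge0// flat_ge0. Qed.

Lemma norm_rV_lt (u : V) (r : R) : 0 < r -> (`|u| < r) = [forall j, `|u 0 j| < r].
Proof.
move=> r0; rewrite [in LHS]/Num.Def.normr/= mx_normrE.
apply/idP/forallP => [H j|H].
  by apply: le_lt_trans H; exact: (le_bigmax _ _ (0, j)).
by apply/bigmax_ltP; split=> // -[i j] _; rewrite ord1; exact: H.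
Qed.

Lemma bump_gt0 c r u : 0 < r -> (0 < bump c r u) = (`|u - c| < r).
Proof.
move=> r0; rewrite norm_rV_lt//; apply/idP/forallP => [b0 j|H].
  have : bump c r u != 0 by rewrite gt_eqF.
  move/prodf_neq0 => /(_ j isT); rewrite mulf_eq0 negb_or !mxE.
  have flat_neq0 t : (flat 0 t != 0) = (0 < t).
    by rewrite -(flat_gt0 0) lt_def flat_ge0 andbT.
  rewrite !flat_neq0 => /andP[h1 h2].
  by rewrite ltr_norml; lra.
apply: prodr_gt0 => j _; have := H j; rewrite !mxE ltr_norml => /andP[h1 h2].
by rewrite mulr_gt0// flat_gt0; lra.
Qed.

Lemma bump_eq0 c r u : 0 < r -> r <= `|u - c| -> bump c r u = 0.
Proof.
by move=> r0 ru; apply/eqP; rewrite eq_le bump_ge0 andbT leNgt bump_gt0// -leNgt.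
Qed.

Lemma smooth_bump U c r : open U -> smooth_on U (bump c r).
Proof.
move=> oU k; apply: Ck_on_prod => // j _; apply: Ck_onM => //.
  apply: (@smooth_on_comp1 _ U (fun u : V => r - (u 0 j - c 0 j)) (flat 0)) => //; last exact: smooth_flat.
  move=> k'; apply: (Ck_onD (f := cst r)) => //; first exact: Ck_on_cst.
  rewrite (_ : (fun _ => _) = (cst (-1) * ((fun u : V => u 0 j) + cst (- c 0 j)))).
    apply: Ck_onM => //; first exact: Ck_on_cst.
    apply: Ck_onD => //; [exact: smooth_on_coord_fun|exact: Ck_on_cst].
  by apply/funext => u; rewrite !fctE /= mulN1r.
apply: (@smooth_on_comp1 _ U (fun u : V => r + (u 0 j - c 0 j)) (flat 0)) => //; last exact: smooth_flat.
move=> k'; apply: (Ck_onD (f := cst r)) => //; first exact: Ck_on_cst.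
apply: (Ck_onD (g := cst (- c 0 j))) => //; [exact: smooth_on_coord_fun|exact: Ck_on_cst].
Qed.

End Bumps.

(** * Extending functions from a chart *)

Section ChartExtension.
Context {R : realType} {n : nat} (X : smooth_manifold R n).
Local Notation V := 'rV[R]_n.
Local Notation C := (smoothfun X).
Implicit Types (i j : chart X) (x : X).

Lemma chart_image_open i (O : set X) : open O -> O `<=` chart_dom i ->
  open (chart_coord i @` O).
Proof.
move=> oO Oi; rewrite openE => _ [x Ox <-].
have cx : (chart_coord i @` chart_dom i) (chart_coord i x) by exists x => //; exact: Oi.
have H1 : nbhs (chart_coord i x) (chart_coord i @` chart_dom i).
  by apply: open_nbhs_nbhs; split=> //; exact: chart_cod_open.
have H2 : nbhs (chart_coord i x) (chart_param i @^-1` O).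
  apply: (param_continuous cx); rewrite coordK; last exact: Oi.
  exact: open_nbhs_nbhs.
rewrite /interior; apply: filterS (filterI H1 H2) => _ [[y iy <-]] /=.
by rewrite coordK// => Oy; exists y.
Qed.

Lemma chart_preimage_open i (U : set V) : open U ->
  open (chart_dom i `&` chart_coord i @^-1` U).
Proof.
move=> oU; rewrite openE => x [ix Ux]; apply: filterI.
  by apply: open_nbhs_nbhs; split=> //; exact: chart_dom_open.
by apply: Defs.coord_continuous => //; exact: open_nbhs_nbhs.
Qed.

(** Around each point one chart suffices, since the transition maps carry smoothness to
    all the others. *)
Lemma smoothfun_local (f : X -> R) :
  (forall x, exists i (O : set X), [/\ open O, O x, O `<=` chart_dom i &
    smooth_on (chart_coord i @` O) (f \o chart_param i)]) ->
  f \in @smoothfun_pred R n X.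
Proof.
move=> H; apply/asboolP => j k; apply: Ck_on_local => u [x jx <-{u}].
have [i [Q [oO Ox Oi sf]]] := H x.
pose U := chart_coord j @` (Q `&` chart_dom j).
have oU : open U.
  by apply: chart_image_open; [apply: openI => //; exact: chart_dom_open|exact: subIsetr].
exists U; first by exists x.
pose tau := chart_coord i \o chart_param j.
have tau_sum u : \sum_l (tau u) 0 l *: (delta_mx 0 l : V) = tau u by rewrite -row_sum_delta.
have := @Ck_on_comp R V V k n (fun l => delta_mx 0 l) (fun l u => (tau u) 0 l) U
  (chart_coord i @` Q) (f \o chart_param i) oU _ _ (sf k).
move=> /(_ _ _)/eq_Ck_on; apply => //.
- by move=> _ [y [Oy jy] <-]; rewrite tau_sum /tau /= coordK// coordK//; exact: Oi.
- by move=> _ [y [Oy jy] <-]; rewrite tau_sum /tau /= coordK//; exists y.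
- move=> l; apply: Ck_on_coord => //.
  apply: Ck_onS (transition_smooth j i k) => _ [y [Oy jy] <-].
  by exists y => //; split=> //; exact: Oi.
Qed.

Lemma smoothfun_smooth (f : C) i : smooth_on (chart_coord i @` chart_dom i) (f \o chart_param i).
Proof. by case: f => f /= /asboolP. Qed.

Lemma smoothfun_continuous (f : C) : continuous f.
Proof.
move=> x; have [i ix] := chart_cover x.
have cx : (chart_coord i @` chart_dom i) (chart_coord i x) by exists x.
have c1 := smoothfun_smooth f i 0%N _ cx.
have c2 : {for x, continuous ((f \o chart_param i) \o chart_coord i)}.
  by apply: continuous_comp c1; exact: Defs.coord_continuous.
have E : {near x, ((f \o chart_param i) \o chart_coord i) =1 f}.
  have /open_nbhs_nbhs : open_nbhs x (chart_dom i) by split=> //; exact: chart_dom_open.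
  by apply: filterS => y iy /=; rewrite coordK.
move: c2; rewrite /prop_for /continuous_at /= coordK// => c2.
exact: cvg_trans (near_eq_cvg E) c2.
Qed.

Variables (i : chart X) (c : V) (r : R).
Hypothesis r0 : 0 < r.
Hypothesis ball_cod : ball c (r + r) `<=` chart_coord i @` chart_dom i.

(** The bump has half the radius of the ball on which F is smooth, so its closed support
    stays inside the chart and the extension by 0 is smooth. *)
Definition chart_extend (F : V -> R) (x : X) : R :=
  if pselect (chart_dom i x) then bump c r (chart_coord i x) * F (chart_coord i x) else 0.

Lemma chart_extend_in F x : chart_dom i x ->
  chart_extend F x = bump c r (chart_coord i x) * F (chart_coord i x).
Proof. by rewrite /chart_extend; case: pselect. Qed.

Lemma chart_extend_out F x : ~ chart_dom i x -> chart_extend F x = 0.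
Proof. by rewrite /chart_extend; case: pselect. Qed.

Lemma chart_closed_ball : closed (chart_param i @` [set u | `|u - c| <= r]).
Proof.
apply: compact_closed; first exact: carrier_hausdorff.
apply: continuous_compact; last first.
  apply: bounded_closed_compact.
    exists (`|c| + r); split; first exact: num_real.
    move=> M HM u /= ur; rewrite -(subrK c u).
    by rewrite (le_trans (ler_normD _ _))// addrC (le_trans _ (ltW HM))// lerD.
  have -> : [set u | `|u - c| <= r] = (fun u : V => `|u - c|) @^-1` [set t | t <= r] by [].
  apply: closed_comp; last exact: closed_le.
  move=> u _; apply: (@continuous_comp _ _ _ (fun u : V => u - c)); last exact: norm_continuous.
  by apply: continuousB; [exact: cvg_id|exact: cst_continuous].
apply: continuous_in_subspaceT => u; rewrite inE /= => ur.
apply: param_continuous; apply: ball_cod.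
by rewrite -ball_normE /= distrC (le_lt_trans ur)// ltrDl.
Qed.

Lemma chart_extend_smooth F : smooth_on (ball c (r + r)) F ->
  chart_extend F \in @smoothfun_pred R n X.
Proof.
move=> sF; apply: smoothfun_local => x.
have [[ix xr]|nx] := pselect (chart_dom i x /\ ball c (r + r) (chart_coord i x)).
  exists i, (chart_dom i `&` chart_coord i @^-1` ball c (r + r)); split=> //.
  - by apply: chart_preimage_open; exact: ball_open.
  - have oi : open (chart_coord i @` (chart_dom i `&` chart_coord i @^-1` ball c (r + r))).
      by apply: chart_image_open; [apply: chart_preimage_open; exact: ball_open|exact: subIsetl].
    move=> k; apply: (@eq_Ck_on _ _ _ _ _ (bump c r * F)) => //; last first.
      apply: Ck_onM => //; first exact: smooth_bump.
      by apply: Ck_onS (sF k) => _ [y [_ yr] <-].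
    by move=> _ [y [iy yr] <-] /=; rewrite coordK// chart_extend_in.
have [j jx] := chart_cover x.
exists j, (chart_dom j `&` ~` (chart_param i @` [set u | `|u - c| <= r])).
have oO : open (chart_dom j `&` ~` (chart_param i @` [set u | `|u - c| <= r])).
  by apply: openI; [exact: chart_dom_open|apply: closed_openC; exact: chart_closed_ball].
split=> //.
  split=> // -[u ur xu]; apply: nx.
  have cu : ball c (r + r) u by rewrite -ball_normE /= distrC (le_lt_trans ur)// ltrDl.
  have [y iy yu] := ball_cod cu.
  by rewrite -xu -yu coordK//; split=> //; rewrite yu.
move=> k; apply: (@eq_Ck_on _ _ _ _ _ (cst 0)).
- by apply: chart_image_open => //; exact: subIsetl.
- move=> _ [y [jy ny] <-] /=; rewrite coordK//.
  have [iy|/chart_extend_out->//] := pselect (chart_dom i y).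
  rewrite chart_extend_in// bump_eq0 ?mul0r//.
  rewrite leNgt; apply/negP => yr; apply: ny; exists (chart_coord i y); first exact: ltW.
  by rewrite coordK.
- exact: Ck_on_cst.
Qed.

Definition chart_ext F (sF : smooth_on (ball c (r + r)) F) : C := SmoothFun (chart_extend_smooth sF).

End ChartExtension.

(** * Local frames *)

Lemma local_min_derive {R : realType} {n : nat} (F : 'rV[R]_n -> R) (w v : 'rV[R]_n) :
  differentiable F w -> (\forall u \near w, differentiable F u) ->
  (\forall u \near w, F w <= F u) -> 'D_v F w = 0.
Proof.
move=> dw dF mF.
have lc : {for (0 : R), continuous (fun s : R => w + s *: v)}.
  apply: continuousD; first exact: cst_continuous.
  by apply: continuousZr_tmp; exact: cvg_id.
have [e e0 He] : exists2 e : R, 0 < e & forall s : R, `|s| < e ->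
    differentiable F (w + s *: v) /\ F w <= F (w + s *: v).
  have : nbhs (w + 0 *: v) [set u | differentiable F u /\ F w <= F u].
    by rewrite scale0r addr0; exact: filterI.
  move/lc => /nbhs_ballP[e /= e0 He]; exists e => // s se; apply: He.
  by rewrite -ball_normE /= sub0r normrN.
have := @derive1_at_min R (fun s => F (w + s *: v)) (- e) e 0 _ _ _ _.
have D := @is_derive_line R n F w v 0.
rewrite scale0r addr0 in D; have {}D := D dw.
have E : (- e <= e) by rewrite (le_trans _ (ltW e0))// oppr_le0 ltW.
move=> /(_ E) H; have : is_derive (0 : R) 1 (fun s : R => F (w + s *: v)) 0.
  apply: H.
  - move=> t; rewrite in_itv /= => te; have [|dt _] := He t; first by rewrite ltr_norml.
    by have [] := is_derive_line dt.
  - by rewrite in_itv /= oppr_lt0 e0.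
  - move=> t; rewrite in_itv /= => te; rewrite scale0r addr0.
    by have [|] := He t; first by rewrite ltr_norml.
move=> D'; rewrite -(@derive_val _ _ _ _ _ _ _ D).
by rewrite (@derive_val _ _ _ _ _ _ _ D').
Qed.

Section LocalFrame.
Context {R : realType} {n : nat} (X : smooth_manifold R n).
Local Notation V := 'rV[R]_n.
Local Notation C := (smoothfun X).
Variables (i : chart X) (c : V) (r : R).
Hypothesis r0 : 0 < r.
Hypothesis ball_cod : ball c (r + r) `<=` chart_coord i @` chart_dom i.

Let U := ball c (r + r).
Let oU : open U. Proof. exact: ball_open. Qed.

Let s1 : smooth_on U (cst 1 : V -> R). Proof. by move=> k; exact: Ck_on_cst. Qed.
Let sX j : smooth_on U (fun u : V => u 0 j). Proof. exact: smooth_on_coord_fun. Qed.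
Let sD (f : C) j : smooth_on U ('D_(delta_mx 0 j) (f \o chart_param i)).
Proof. apply: derive_smooth_on; apply: smooth_onS (smoothfun_smooth f i); exact: ball_cod. Qed.

(** The global substitutes for the coordinates of a chart: a bump b, the products y_j of
    b with the coordinates, and the derivations E_j = b d/dx_j. *)
Definition fr_b : C := chart_ext r0 ball_cod s1.
Definition fr_y (j : 'I_n) : C := chart_ext r0 ball_cod (sX j).
Definition fr_D (j : 'I_n) (f : C) : C := chart_ext r0 ball_cod (sD f j).

Let supp x : [\/ chart_dom i x /\ `|chart_coord i x - c| < r |
  fr_b x = 0 /\ forall F, chart_extend i c r F x = 0].
Proof.
have [ix|nx] := pselect (chart_dom i x); last first.
  by right; split=> [|F]; exact: chart_extend_out.
have [xr|xr] := ltP `|chart_coord i x - c| r; first by left.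
by right; split=> [|F]; rewrite /= chart_extend_in// bump_eq0 ?mul0r.
Qed.

Let inU x : `|chart_coord i x - c| < r -> U (chart_coord i x).
Proof. by move=> xr; rewrite /U -ball_normE /= distrC (lt_trans xr)// ltrDl. Qed.

Let diffU (f : C) u : U u -> differentiable (f \o chart_param i) u.
Proof. by move=> /ball_cod; exact: (smoothfun_smooth f i 1%N).1. Qed.

Let b_in x : chart_dom i x -> fr_b x = bump c r (chart_coord i x).
Proof. by move=> ix; rewrite /= chart_extend_in// mulr1. Qed.

Let D_in j f x : chart_dom i x -> fr_D j f x =
   bump c r (chart_coord i x) * 'D_(delta_mx 0 j) (f \o chart_param i) (chart_coord i x).
Proof. by move=> ix; rewrite /= chart_extend_in. Qed.

Lemma fr_D_vfield j : fr_D j \in @vfield_pred R n X.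
Proof.
apply/asboolP; split=> [a f g|f g]; apply: smoothfun_ext => x.
  have [[ix xr]|[_ H]] := supp x; last by rewrite sfDE sfZE /= !H mulr0 addr0.
  rewrite sfDE sfZE !D_in//.
  have -> : (a *: f + g) \o chart_param i = a *: (f \o chart_param i) + (g \o chart_param i) by [].
  have df := diff_derivable (diffU f (inU xr)); have dg := diff_derivable (diffU g (inU xr)).
  rewrite deriveD//; last exact: derivableZ.
  by rewrite deriveZ// /GRing.scale /=; ring.
have [[ix xr]|[_ H]] := supp x; last by rewrite sfDE !sfME /= !H mulr0 mul0r addr0.
rewrite sfDE !sfME !D_in//.
have -> : (f * g) \o chart_param i = (f \o chart_param i) * (g \o chart_param i) by [].
have df := diff_derivable (diffU f (inU xr)); have dg := diff_derivable (diffU g (inU xr)).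
by rewrite deriveM// /GRing.scale /= coordK//; ring.
Qed.

Definition fr_E (j : 'I_n) : vfield X := VField (fr_D_vfield j).

Let E_in j (f : C) x : chart_dom i x -> fr_E j f x =
   bump c r (chart_coord i x) * 'D_(delta_mx 0 j) (f \o chart_param i) (chart_coord i x).
Proof. exact: D_in. Qed.

Lemma fr_b_ge0 x : 0 <= fr_b x.
Proof.
have [[ix _]|[-> _]//] := supp x; by rewrite b_in// bump_ge0.
Qed.

Lemma fr_b_gt0 x : chart_dom i x -> `|chart_coord i x - c| < r -> 0 < fr_b x.
Proof. by move=> ix xr; rewrite b_in// bump_gt0. Qed.

Lemma fr_b_supp x : fr_b x != 0 -> chart_dom i x /\ `|chart_coord i x - c| < r.
Proof. by have [//|[-> _]] := supp x; rewrite eqxx. Qed.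

Lemma fr_E_local_min j (f : C) (x : X) : (\forall z \near x, f x <= f z) -> fr_E j f x = 0.
Proof.
move=> mf; have [[ix xr]|[_ H]] := supp x; last exact: H.
rewrite D_in// local_min_derive ?mulr0//; first exact/diffU/inU.
  have : open_nbhs (chart_coord i x) U by split=> //; exact: inU.
  by move/open_nbhs_nbhs; apply: filterS => u; exact: diffU.
have cx : (chart_coord i @` chart_dom i) (chart_coord i x) by exists x.
have H := param_continuous cx; rewrite /prop_for /continuous_at coordK// in H.
by rewrite [(f \o chart_param i) (chart_coord i x)]/= coordK//; exact: H _ mf.
Qed.

Lemma fr_E_chain j (f u : C) (h : R -> R) x : (forall z, u z = h (f z)) ->
  (forall t, differentiable h t) -> fr_E j u x = 'D_1 h (f x) * fr_E j f x.
Proof.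
move=> uE dh; have [[ix xr]|[_ H]] := supp x; last by rewrite /= !H mulr0.
rewrite !E_in// mulrCA; congr (_ * _).
have E1 t : \sum_(l < 1) t *: (1 : R) = t by rewrite big_ord1 /GRing.scale /= mulr1.
have [_||_] := @derive_frame_comp R V R 1 (fun=> 1) (fun=> f \o chart_param i) h
  (chart_coord i x) (delta_mx 0 j).
- exact/diffU/inU.
- exact: dh.
have -> : (fun w : V => h (\sum_(l < 1) (f \o chart_param i) w *: (1 : R))) = u \o chart_param i.
  by apply/funext => w; rewrite E1 /= uE.
by rewrite big_ord1 E1 /= coordK// mulrC.
Qed.

(** Where b is nonzero y_k / b is the k-th coordinate, and the left-hand side is b^2 times
    its image under E_j = b d/dx_j. *)
Lemma fr_E_y j k : fr_b * fr_E j (fr_y k) - fr_y k * fr_E j fr_b = fr_b ^+ 3 *+ (j == k).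
Proof.
apply: smoothfun_ext => x; rewrite sfBE !sfME.
have -> : (fr_b ^+ 3 *+ (j == k)) x = fr_b x ^+ 3 *+ (j == k).
  by case: eqP => _; rewrite ?mulr1n ?mulr0n ?sfXE.
have [[ix xr]|[b0 H]] := supp x; last first.
  by rewrite b0 /= !H !mul0r subr0 expr0n /= mul0rn.
have Ux := inU xr; set u := chart_coord i x.
have yE : fr_y k x = bump c r u * u 0 k by rewrite /= chart_extend_in.
rewrite yE b_in// !E_in// -/u.
have db : derivable (fr_b \o chart_param i) u (delta_mx 0 j) by apply: diff_derivable; exact: diffU.
have dX : derivable (fun w : V => w 0 k) u (delta_mx 0 j).
  exact/diff_derivable/differentiable_coord.
have E : {near u, (fr_b \o chart_param i) * (fun w : V => w 0 k) =1 fr_y k \o chart_param i}.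
  have : open_nbhs u U by [].
  move/open_nbhs_nbhs; apply: filterS => w /ball_cod[z iz <-].
  by rewrite fctE /= coordK// !chart_extend_in// mulr1.
have <- := near_eq_derive (delta_mx 0 j) E; rewrite deriveM//.
have -> : 'D_(delta_mx 0 j) (fun w : V => w 0 k) u = (j == k)%:R.
  have dI : derivable (id : V -> V) u (delta_mx 0 j) by exact: derivable_id.
  have /matrixP/(_ 0 k) := derive_mx dI.
  by rewrite derive_id !mxE eqxx eq_sym => <-.
have -> : (fr_b \o chart_param i) u = bump c r u.
  by rewrite -b_in//; congr (fr_b _); rewrite /u coordK.
set d := 'D_ _ (fr_b \o _) u; rewrite /GRing.scale /=.
case: (j == k) => /=; rewrite ?mulr1n ?mulr0n; ring.
Qed.

(** A derivation W is evaluated at x by applying it to b^2 (f - f(x)), which Hadamard's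
    lemma writes as the sum of (y_j - x_j b) times b G_j: the first factors vanish at x,
    so only W(y_j - x_j b) contributes, with coefficient the partial derivative of f. *)
Lemma frame_expansion (W : vfield X) :
  fr_b ^+ 3 *: W = \sum_j (fr_b * W (fr_y j) - fr_y j * W fr_b) *: fr_E j.
Proof.
apply: eq_vfield => f; apply: smoothfun_ext => x.
rewrite vfield_sumE sf_sumE vfield_scaleE sfME sfXE.
have [[ix xr]|[b0 H]] := supp x; last first.
  rewrite b0 expr0n mul0r big1// => j _.
  by rewrite vfield_scaleE sfME /= H mulr0.
have Ux := inU xr; set w := chart_coord i x.
have starU u t : U u -> 0 <= t <= 1 -> U (segm w u t).
  move=> Uu /andP[t0 t1]; move: Ux Uu; rewrite /U -!ball_normE /= -/w => h1 h2.
  have -> : c - segm w u t = (1 - t) *: (c - w) + t *: (c - u).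
    by apply/rowP => j; rewrite /segm !mxE; ring.
  rewrite (le_lt_trans (ler_normD _ _))// !normrZ !ger0_norm ?subr_ge0//.
  have [->|t0'] := eqVneq t 0; first by rewrite subr0 mul1r mul0r addr0.
  have tp : 0 < t by rewrite lt_def t0'.
  have : (1 - t) * `|c - w| <= (1 - t) * (r + r) by rewrite ler_wpM2l ?subr_ge0// ltW.
  have : t * `|c - u| < t * (r + r) by rewrite ltr_pM2l.
  move=> h3 h4; have -> : r + r = (1 - t) * (r + r) + t * (r + r) by ring.
  exact: ler_ltD.
have sF : smooth_on U (f \o chart_param i) by apply: smooth_onS (smoothfun_smooth f i); exact: ball_cod.
have [G [sG FG G0]] := hadamard oU starU sF Ux.
pose bG j : C := chart_ext r0 ball_cod (sG j).
have key : fr_b * fr_b * (f - f x *: (1 : C)) = \sum_j (fr_y j - w 0 j *: fr_b) * bG j.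
  apply: smoothfun_ext => z; rewrite sf_sumE !sfME sfBE sfZE sf1E mulr1.
  have [[iz zr]|[b0 H]] := supp z; last first.
    by rewrite b0 !mul0r big1// => j _; rewrite sfME /= H mulr0.
  have FGz := FG _ (inU zr); rewrite /= !coordK// in FGz; rewrite FGz.
  rewrite [X in _ * X]addrC addrA addNr add0r mulr_sumr; apply: eq_bigr => j _.
  rewrite sfME sfBE sfZE.
  have -> : fr_y j z = bump c r (chart_coord i z) * chart_coord i z 0 j by rewrite /= chart_extend_in.
  have -> : bG j z = bump c r (chart_coord i z) * G j (chart_coord i z) by rewrite /= chart_extend_in.
  rewrite !b_in// !mxE; ring.
have := congr1 (fun h => W h x) key.
rewrite vfield_f_sum sf_sumE !vfieldM vfieldD vfieldN vfieldZ vfield1 scaler0 subr0.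
rewrite sfDE !sfME sfBE sfZE sf1E mulr1 subrr mulr0 add0r => E.
rewrite exprS -mulrA exprS expr1 E mulr_sumr; apply: eq_bigr => j _.
have yE : fr_y j x = w 0 j * fr_b x by rewrite b_in// /= chart_extend_in// mulrC.
rewrite vfieldM vfieldD vfieldN vfieldZ sfDE !sfME !sfBE !sfZE yE subrr mul0r addr0.
have -> : bG j x = bump c r w * G j w by rewrite /= chart_extend_in.
rewrite !sfME yE E_in// -G0 -/w b_in// -/w; ring.
Qed.

End LocalFrame.

(** The frame E spans the vector fields where b is nonzero, and y_j / b are the
    coordinates dual to it; the denominators are cleared so that everything is global.
    The last two fields retain that E_j is a multiple of a partial derivative. *)
Record local_frame {R : realType} {n : nat} (X : smooth_manifold R n) := LocalFrame {
  frame_b : smoothfun X ;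
  frame_y : 'I_n -> smoothfun X ;
  frame_E : 'I_n -> vfield X ;
  frame_b_ge0 : forall x, 0 <= frame_b x ;
  frame_span : forall W : vfield X, frame_b ^+ 3 *: W =
    \sum_j (frame_b * W (frame_y j) - frame_y j * W frame_b) *: frame_E j ;
  frame_dual : forall j k, frame_b * frame_E j (frame_y k) - frame_y k * frame_E j frame_b =
    frame_b ^+ 3 *+ (j == k) ;
  frame_min : forall j (f : smoothfun X) (x : X), (\forall z \near x, f x <= f z) ->
    frame_E j f x = 0 ;
  frame_chain : forall j (f u : smoothfun X) (h : R -> R) x, (forall z, u z = h (f z)) ->
    (forall t, differentiable h t) -> frame_E j u x = 'D_1 h (f x) * frame_E j f x }.

Lemma exists_frame {R : realType} {n : nat} (X : smooth_manifold R n) (x : X) (Q : set X) :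
  open Q -> Q x -> exists F : local_frame X, 0 < frame_b F x /\
    forall z, frame_b F z != 0 -> Q z.
Proof.
move=> oQ Qx; have [i ix] := chart_cover x.
have oW : open (chart_coord i @` (Q `&` chart_dom i)).
  by apply: chart_image_open; [apply: openI => //; exact: chart_dom_open|exact: subIsetr].
have : nbhs (chart_coord i x) (chart_coord i @` (Q `&` chart_dom i)).
  by apply: open_nbhs_nbhs; split=> //; exists x.
move=> /nbhs_ballP[e /= e0 He].
pose r := e / 2; have r0 : 0 < r by rewrite divr_gt0.
have eE : e = r + r by rewrite -splitr.
have ball_cod : ball (chart_coord i x) (r + r) `<=` chart_coord i @` chart_dom i.
  by rewrite -eE => u /He[z [_ iz] <-]; exists z.
exists (LocalFrame (fr_b_ge0 r0 ball_cod) (frame_expansion r0 ball_cod) (fr_E_y r0 ball_cod)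
  (fr_E_local_min r0 ball_cod) (fr_E_chain r0 ball_cod)); split=> [|z /fr_b_supp[iz zr]] /=.
  by apply: fr_b_gt0; rewrite ?subrr ?normr0.
have /He[y [Qy iy] yz] : ball (chart_coord i x) e (chart_coord i z).
  by rewrite -ball_normE /= distrC eE (lt_trans zr)// ltrDl.
by rewrite -(coordK iz) -yz coordK.
Qed.

(** * Multilinear maps over the smooth functions *)

Section Multilinear.
Context {R : realType} {n : nat} {X : smooth_manifold R n}.
Local Notation C := (smoothfun X).
Local Notation T := (vfield X).

(** Alternation is left out: products of frame coefficients, which are not alternating,
    are treated on the same footing as forms. *)
Definition multilinear k (F : ('I_k -> T) -> C) : Prop := forall V i (f : C) W W',
  F (upd V i (f *: W + W')) = f * F (upd V i W) + F (upd V i W').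

Lemma multilinearD0 k (F : ('I_k -> T) -> C) V i W W' : multilinear F ->
  F (upd V i (W + W')) = F (upd V i W) + F (upd V i W').
Proof. by move=> FL; have := FL V i 1 W W'; rewrite scale1r mul1r. Qed.

Lemma multilinear0 k (F : ('I_k -> T) -> C) V i : multilinear F -> F (upd V i 0) = 0.
Proof. by move=> FL; apply: (addrI (F (upd V i 0))); rewrite -multilinearD0// !addr0. Qed.

Lemma multilinearZ k (F : ('I_k -> T) -> C) V i f W : multilinear F ->
  F (upd V i (f *: W)) = f * F (upd V i W).
Proof. by move=> FL; have := FL V i f W 0; rewrite multilinear0// !addr0. Qed.

Lemma multilinear_sum k (F : ('I_k -> T) -> C) V i m (c : 'I_m -> C) (E : 'I_m -> T) :
  multilinear F -> F (upd V i (\sum_j c j *: E j)) = \sum_j c j * F (upd V i (E j)).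
Proof.
move=> FL; elim: m c E => [|m IHm] c E; first by rewrite !big_ord0 multilinear0.
by rewrite !big_ord_recl FL IHm.
Qed.

Lemma multilinear_consv k (F : ('I_k.+1 -> T) -> C) W : multilinear F ->
  multilinear (fun U => F (consv W U)).
Proof. by move=> FL V i f Y Z; rewrite -!upd_consv FL. Qed.

Lemma sum_ffun_ordS k m (G : {ffun 'I_k.+1 -> 'I_m} -> C) :
  \sum_J G J = \sum_j \sum_(J : {ffun 'I_k -> 'I_m}) G [ffun i => oapp J j (unlift ord0 i)].
Proof.
rewrite pair_big /=.
rewrite (reindex (fun p : 'I_m * {ffun 'I_k -> 'I_m} => [ffun i => oapp p.2 p.1 (unlift ord0 i)]))//.
exists (fun J : {ffun 'I_k.+1 -> 'I_m} => (J ord0, [ffun i => J (lift ord0 i)])).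
  move=> [j J] _ /=; rewrite ffunE unlift_none /=; congr pair.
  by apply/ffunP => i; rewrite !ffunE liftK.
by move=> J _; apply/ffunP => i; rewrite ffunE; case: unliftP => [l|] ->; rewrite /= ?ffunE.
Qed.

Lemma multilinear_expand k (F : ('I_k -> T) -> C) (V : 'I_k -> T) (f : C) m
    (c : 'I_k -> 'I_m -> C) (E : 'I_m -> T) : multilinear F ->
  (forall i, f *: V i = \sum_j c i j *: E j) ->
  f ^+ k * F V = \sum_(J : {ffun 'I_k -> 'I_m}) (\prod_i c i (J i)) * F (E \o J).
Proof.
elim: k F V c => [|k IHk] F V c FL Vc.
  rewrite expr0 mul1r (eq_bigr (fun=> F V)) => [|J _]; last first.
    by rewrite big_ord0 mul1r; congr F; apply/funext => -[].
  by rewrite sumr_const card_ffun !card_ord expn0 mulr1n.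
rewrite sum_ffun_ordS [V in LHS]consvE.
set W := V ord0; set U := V \o lift ord0.
have -> : f ^+ k.+1 * F (consv W U) = f ^+ k * F (consv (f *: W) U).
  by rewrite -[consv (f *: W) U](upd_consv0 W) multilinearZ// upd_consv0 exprS mulrA; ring.
rewrite /W Vc -[consv _ U](upd_consv0 0) multilinear_sum// mulr_sumr; apply: eq_bigr => j _.
rewrite upd_consv0 mulrCA.
rewrite (IHk (fun U => F (consv (E j) U)) U (fun i => c (lift ord0 i))); last 2 first.
- exact: multilinear_consv.
- by move=> i; exact: Vc.
rewrite mulr_sumr; apply: eq_bigr => J _; rewrite big_ord_recl ffunE unlift_none /= -mulrA.
congr (_ * (_ * _)).
  by apply: eq_bigr => i _; rewrite ffunE liftK.
congr F; apply/funext => i; rewrite /consv /= ffunE; by case: unlift.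
Qed.

Definition comb m (a : 'I_m -> R) (E : 'I_m -> T) : T := \sum_j (a j *: (1 : C)) *: E j.

Lemma multilinear_comb k (F : ('I_k -> T) -> C) m (a : 'I_k -> 'I_m -> R) (E : 'I_m -> T) x :
  multilinear F -> F (fun i => comb (a i) E) x =
    \sum_(J : {ffun 'I_k -> 'I_m}) (\prod_i a i (J i)) * F (E \o J) x.
Proof.
move=> FL; have := @multilinear_expand k F (fun i => comb (a i) E) 1 m (fun i j => a i j *: (1 : C)) E FL.
rewrite expr1n mul1r => ->; last by move=> i; rewrite scale1r.
rewrite sf_sumE; apply: eq_bigr => J _; rewrite sfME sf_prodE; congr (_ * _).
by apply: eq_bigr => i _; rewrite sfZE mulr1.
Qed.

Definition frame_A (Fr : local_frame X) (W : T) (j : 'I_n) : C :=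
  frame_b Fr * W (frame_y Fr j) - frame_y Fr j * W (frame_b Fr).

Definition frame_coef (Fr : local_frame X) (x : X) (W : T) (j : 'I_n) : R :=
  frame_A Fr W j x / frame_b Fr x ^+ 3.

Lemma multilinear_frame k (F : ('I_k -> T) -> C) (Fr : local_frame X) V x : multilinear F ->
  (frame_b Fr ^+ 3) x ^+ k * F V x =
  \sum_(J : {ffun 'I_k -> 'I_n}) (\prod_i frame_A Fr (V i) (J i) x) * F (frame_E Fr \o J) x.
Proof.
move=> FL; have := @multilinear_expand k F V (frame_b Fr ^+ 3) n
  (fun i => frame_A Fr (V i)) (frame_E Fr) FL (fun i => frame_span Fr (V i)).
move=> /(congr1 (fun h : C => h x)); rewrite sfME sfXE => ->.
by rewrite sf_sumE; apply: eq_bigr => J _; rewrite sfME sf_prodE.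
Qed.

(** Tensoriality: the value at x only depends on the coefficients of the V_i at x, which
    are numbers, so the vector fields can be replaced by constant combinations of the
    frame. *)
Lemma multilinear_coef k (F : ('I_k -> T) -> C) (Fr : local_frame X) V x : multilinear F ->
  frame_b Fr x != 0 ->
  F V x = F (fun i => comb (frame_coef Fr x (V i)) (frame_E Fr)) x.
Proof.
move=> FL b0; have b3 : (frame_b Fr ^+ 3) x ^+ k != 0 by rewrite sfXE !expf_neq0.
apply: (mulfI b3); rewrite multilinear_frame// multilinear_comb// mulr_sumr.
apply: eq_bigr => J _; rewrite mulrA; congr (_ * _).
rewrite -[X in _ ^+ X]card_ord -prodr_const -big_split; apply: eq_bigr => i _.
by rewrite -[RHS]/(_ * _) sfXE /frame_coef mulrCA divff ?mulr1// expf_neq0.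
Qed.

Lemma vfield_combE m (a : 'I_m -> R) (E : 'I_m -> T) (f : C) x :
  comb a E f x = \sum_j a j * E j f x.
Proof.
rewrite /comb vfield_sumE sf_sumE; apply: eq_bigr => j _.
by rewrite vfield_scaleE sfME sfZE mulr1.
Qed.

Lemma frame_A_comb (Fr : local_frame X) (a : 'I_n -> R) k x :
  frame_A Fr (comb a (frame_E Fr)) k x = a k * frame_b Fr x ^+ 3.
Proof.
rewrite /frame_A sfBE !sfME !vfield_combE !mulr_sumr -sumrB.
rewrite (bigD1 k)//= big1 ?addr0 => [|j jk].
  have := congr1 (fun h : C => h x) (frame_dual Fr k k); rewrite eqxx mulr1n sfXE sfBE !sfME => <-.
  ring.
have := congr1 (fun h : C => h x) (frame_dual Fr j k); rewrite (negPf jk) mulr0n sfBE !sfME sf0E.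
by move=> H; rewrite mulrCA [X in _ - X]mulrCA -mulrBr H mulr0.
Qed.

Lemma comb_neq0 (Fr : local_frame X) (a : 'I_n -> R) k x :
  frame_b Fr x != 0 -> a k != 0 -> exists f : C, comb a (frame_E Fr) f x != 0.
Proof.
move=> b0 ak; apply: contrapT => H.
have H0 f : comb a (frame_E Fr) f x = 0.
  by apply/eqP/negPn/negP => h; apply: H; exists f.
have := frame_A_comb Fr a k x; rewrite /frame_A sfBE !sfME !H0 !mulr0 subr0 => /esym/eqP.
by rewrite mulf_eq0 (negPf ak) expf_eq0 (negPf b0).
Qed.

(** Up to a nonzero factor W is at x a combination of partial derivatives. *)
Lemma vfield_local_min (W : T) (f : C) (x : X) : (\forall z \near x, f x <= f z) -> W f x = 0.
Proof.
move=> mf; have [Fr [b0 _]] := exists_frame (@openT X) (I : setT x).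
have := congr1 (fun V : T => V f x) (frame_span Fr W).
rewrite vfield_sumE sf_sumE vfield_scaleE sfME sfXE big1 => [/eqP|j _]; last first.
  by rewrite vfield_scaleE sfME frame_min// mulr0.
by rewrite mulf_eq0 expf_eq0 gt_eqF//= => /eqP.
Qed.

End Multilinear.

(** * Positive definite matrices and alternating forms *)

Section PosDef.
Context {R : realType}.

Definition posdef p (G : 'M[R]_p) : Prop :=
  G^T = G /\ forall v : 'rV_p, v != 0 -> 0 < (v *m G *m v^T) 0 0.

Lemma posdef_congr p (G P : 'M[R]_p) : posdef G -> P \in unitmx -> posdef (P *m G *m P^T).
Proof.
move=> [Gs Gp] Pu; split; first by rewrite !trmx_mul trmxK Gs mulmxA.
move=> v v0; have -> : v *m (P *m G *m P^T) *m v^T = (v *m P) *m G *m (v *m P)^T.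
  by rewrite trmx_mul !mulmxA.
by apply: Gp; apply: contra_neq v0 => vP; rewrite -(mulmxK Pu v) vP mul0mx.
Qed.

Lemma posdef_diag p (G : 'M[R]_p) i : posdef G -> 0 < G i i.
Proof.
move=> [_ Gp]; have := Gp (delta_mx 0 i); rewrite -rowE trmx_delta -colE !mxE; apply.
by apply/eqP => /matrixP/(_ 0 i); rewrite !mxE !eqxx => /eqP; rewrite oner_eq0.
Qed.

(** Symmetric elimination: the Schur complement K of the first entry is positive definite
    and its diagonal is dominated by that of G. The factorization is Cholesky's, and the
    same induction gives Hadamard's determinant inequality. *)
Lemma posdef_factor p (G : 'M[R]_p) : posdef G ->
  exists P, [/\ P \in unitmx, P *m G *m P^T = 1%:M & \det G <= \prod_i G i i].
Proof.
elim: p G => [|p IHp] G.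
  exists 1%:M; split; first exact: unitmx1.
    by apply/matrixP => -[].
  by rewrite det_mx00 big_ord0.
change 'M[R]_(1 + p)%N in G; change (posdef (G : 'M[R]_(1 + p)) ->
  exists P : 'M[R]_(1 + p), [/\ P \in unitmx, P *m G *m P^T = 1%:M & \det G <= \prod_i G i i]).
move=> GP; pose a := G 0 0; pose u := ursubmx G; pose H := drsubmx G.
have a0 : 0 < a := posdef_diag 0 GP.
have [Gs Gp] := GP.
have aN : a != 0 by rewrite gt_eqF.
have ulE : ulsubmx G = a%:M.
  by rewrite [LHS]mx11_scalar !mxE; congr (G _ _)%:M; apply/val_inj.
have dlE : dlsubmx G = u^T.
  apply/matrixP => i j; rewrite !mxE; have /matrixP/(_ (lshift p j) (rshift 1 i)) := Gs.
  by rewrite mxE.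
have GE : G = block_mx a%:M u u^T H by rewrite -ulE -dlE submxK.
pose P1 : 'M[R]_(1 + p) := block_mx 1%:M 0 (- a^-1 *: u^T) 1%:M.
have d1 : \det P1 = 1 by rewrite det_lblock !det1 mulr1.
have P1u : P1 \in unitmx by rewrite unitmxE d1 unitr1.
pose K := H - a^-1 *: (u^T *m u).
have P1G : P1 *m G *m P1^T = block_mx a%:M 0 0 K.
  have -> : P1 *m G = block_mx a%:M u 0 K.
    rewrite GE mulmx_block !mul1mx !mul0mx !addr0; congr block_mx.
      by rewrite mul_mx_scalar scalerA mulrN divff// scaleN1r addNr.
    by rewrite -scalemxAl addrC scaleNr.
  rewrite tr_block_mx trmx0 !trmx1 linearZ /= trmxK mulmx_block.
  rewrite !mulmx1 !mulmx0 !mul0mx !addr0 !add0r; congr block_mx.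
  by rewrite mul_scalar_mx scalerA mulrN divff// scaleN1r addNr.
have KP : posdef K.
  have [s' p'] := posdef_congr GP P1u; rewrite P1G in s' p'; split.
    by move: s'; rewrite tr_block_mx => /eq_block_mx[].
  move=> v v0; have := p' (row_mx 0 v); rewrite mul_row_block !mul0mx add0r !mulmx0 !add0r.
  rewrite tr_row_mx trmx0 mul_row_col mulmx0 add0r; apply.
  by rewrite -row_mx0 (inj_eq (can_inj (@row_mxKr _ _ _ _ _)))//.
have [P2 [P2u P2K dK]] := IHp _ KP.
pose D : 'M[R]_(1 + p) := block_mx (Num.sqrt a)^-1%:M 0 0 P2.
have sa : Num.sqrt a != 0 by rewrite sqrtr_eq0 -ltNge.
exists (D *m P1); split.
- rewrite unitmx_mul P1u andbT unitmxE det_ublock det_scalar1 unitrM -unitmxE P2u andbT.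
  by rewrite unitfE invr_eq0.
- have -> : D *m P1 *m G *m (D *m P1)^T = D *m (P1 *m G *m P1^T) *m D^T.
    by rewrite trmx_mul !mulmxA.
  rewrite P1G.
  rewrite tr_block_mx !trmx0 !mulmx_block !mul0mx !mulmx0 !addr0 !add0r P2K.
  rewrite tr_scalar_mx -!scalar_mxM -mulrA mulrC -mulrA -invfM -expr2 sqr_sqrtr ?ltW// divff//.
  by rewrite !mul0mx -scalar_mx_block.
- have -> : \det G = a * \det K.
    have := congr1 (@determinant R _) P1G.
    by rewrite !det_mulmx det_tr d1 mul1r mulr1 det_ublock det_scalar1.
  rewrite big_ord_recl; apply: ler_pM; first exact: ltW.
    have := congr1 (@determinant R _) P2K; rewrite !det_mulmx det_tr det1 => dd.
    have d20 : \det P2 != 0 by rewrite -unitfE -unitmxE.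
    have -> : \det K = \det P2 ^- 2.
      apply: (mulfI (expf_neq0 2 d20)); rewrite divff ?expf_neq0// -dd; ring.
    by rewrite invr_ge0 sqr_ge0.
  by [].
  apply: le_trans dK _; apply: ler_prod => i _; rewrite ltW ?posdef_diag//=.
  rewrite !mxE big_ord1 !mxE; have -> : rshift 1 i = lift ord0 i by exact: val_inj.
  by rewrite gerBl -expr2 mulr_ge0 ?sqr_ge0// invr_ge0 ltW.
Qed.
End PosDef.

Section FormDet.
Context {R : realType} {n : nat} {X : smooth_manifold R n}.
Local Notation C := (smoothfun X).
Local Notation T := (vfield X).

Lemma form_perm k (a : ('I_k -> T) -> C) (V : 'I_k -> T) (s : {perm 'I_k}) (x : X) : is_form a ->
  a (V \o s) x = (-1) ^+ s * a V x.
Proof.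
move=> fa; case: (prod_tpermP s) => ts -> {s}.
elim: ts => [|[i j] ts IHts] /=.
  by rewrite big_nil odd_perm1 expr0 mul1r => _; congr (a _ x); apply/funext => l /=; rewrite perm1.
move=> /andP[ij /IHts {}IHts]; rewrite /dpair /= in ij.
set s := (\prod_(t <- ts) tperm t.1 t.2)%g in IHts *.
rewrite big_cons -/s odd_mul_tperm ij signr_addb expr1 -mulrA -IHts mulN1r.
have := form_antisym (V \o s) ((V \o s) j) ((V \o s) i) fa ij.
rewrite (upd_id (V \o s) i) (upd_id (V \o s) j) => /(congr1 (fun h : C => h x)).
rewrite sfNE => <-; congr (a _ x); apply/funext => l /=; rewrite permM /upd.
by case: tpermP => [->|->|/eqP/negPf-> /eqP/negPf->//]; rewrite ?eqxx// (negPf ij).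
Qed.

(** The expansion over all maps reduces to the Leibniz formula, since a vanishes on the
    tuples with a repeated entry. *)
Lemma form_comb k (a : ('I_k -> T) -> C) (V : 'I_k -> T) (P : 'M[R]_k) (x : X) : is_form a ->
  a (fun i => comb (P i) V) x = \det P * a V x.
Proof.
move=> fa; rewrite multilinear_comb; last by case: fa.
rewrite (bigID (fun f : {ffun 'I_k -> 'I_k} => injectiveb f)) /= addrC big1 ?add0r => [|f Uf].
  rewrite (reindex (@pval _)) /=; last first.
    pose in_Sn := insubd (1%g : {perm 'I_k}).
    by exists in_Sn => /= f Uf; first apply: val_inj; apply: insubdK.
  rewrite mulr_suml; apply: eq_big => /= [s | s _]; rewrite ?(valP s)//.
  rewrite -[RHS]mulrA [RHS]mulrCA; congr (_ * _).
    by apply: eq_bigr => i _; rewrite pvalE.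
  rewrite -form_perm//; congr (a _ x); apply/funext => i /=.
  by rewrite pvalE.
case/injectivePn: Uf => i1 [i2 Di12 Ef12].
have -> : a (V \o f) = 0 by apply: (fa.2 _ i1 i2) => //=; rewrite Ef12.
by rewrite sf0E mulr0.
Qed.

End FormDet.

(** * Tensoriality and Gram matrices *)

Section Tensorial.
Context {R : realType} {n : nat} {X : smooth_manifold R n}.
Local Notation C := (smoothfun X).
Local Notation T := (vfield X).

Definition vanishes_at (W : T) (x : X) : Prop := forall f : C, W f x = 0.

Lemma frame_at (x : X) : exists Fr : local_frame X, 0 < frame_b Fr x.
Proof. by have [Fr [b0 _]] := exists_frame (@openT X) (I : setT x); exists Fr. Qed.

Lemma frame_A_vanish (Fr : local_frame X) W j x : vanishes_at W x -> frame_A Fr W j x = 0.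
Proof. by move=> W0; rewrite /frame_A sfBE !sfME !W0 !mulr0 subrr. Qed.

(** In a frame at x the coefficients of W vanish at x. *)
Lemma multilinear_vanish k (F : ('I_k -> T) -> C) V i W x : multilinear F ->
  vanishes_at W x -> F (upd V i W) x = 0.
Proof.
move=> FL W0; have [Fr b0] := frame_at x.
have := multilinearZ V i (frame_b Fr ^+ 3) W FL; rewrite frame_span multilinear_sum//.
move=> /(congr1 (fun h : C => h x)); rewrite sf_sumE sfME sfXE big1 => [/esym/eqP|j _].
  by rewrite mulf_eq0 expf_eq0 gt_eqF//= => /eqP.
by rewrite sfME -/(frame_A Fr W j) frame_A_vanish// mul0r.
Qed.

Lemma form_multilinear k (a : ('I_k -> T) -> C) : is_form a -> multilinear a.
Proof. by case. Qed.

End Tensorial.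

Section Riemannian.
Context {R : realType} {n : nat} {X : smooth_manifold R n} (g : riemannian_metric X).
Local Notation C := (smoothfun X).
Local Notation T := (vfield X).
Implicit Types (W Y : T) (x : X).

Lemma riemDl W W' Y : g (W + W') Y = g W Y + g W' Y.
Proof. by have := riemannian_linear g 1 W W' Y; rewrite scale1r mul1r. Qed.

Lemma riem0l Y : g 0 Y = 0.
Proof. by apply: (addrI (g 0 Y)); rewrite -riemDl !addr0. Qed.

Lemma riemZl f W Y : g (f *: W) Y = f * g W Y.
Proof. by have := riemannian_linear g f W 0 Y; rewrite riem0l !addr0. Qed.

Lemma riem_combl m (a : 'I_m -> R) (E : 'I_m -> T) Y x :
  g (comb a E) Y x = \sum_j a j * g (E j) Y x.
Proof.
rewrite /comb; elim: m a E => [|m IHm] a E; first by rewrite !big_ord0 riem0l.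
by rewrite !big_ord_recl riemDl sfDE IHm riemZl sfME sfZE mulr1.
Qed.

Lemma riem_combr m (a : 'I_m -> R) (E : 'I_m -> T) Y x :
  g Y (comb a E) x = \sum_j a j * g Y (E j) x.
Proof.
by rewrite riemannian_sym riem_combl; apply: eq_bigr => j _; rewrite riemannian_sym.
Qed.

Lemma riem_vanish W Y x : vanishes_at W x -> g W Y x = 0.
Proof.
move=> W0; pose F (V : 'I_1 -> T) := g (V ord0) Y.
have FL : multilinear F.
  by move=> V i f Z Z'; rewrite /F !ord1 !updE riemannian_linear.
by have := multilinear_vanish (fun=> W) ord0 FL W0; rewrite /F updE.
Qed.

Lemma riem_pos W x : ~ vanishes_at W x -> 0 < g W W x.
Proof.
by move/existsNP => [f Wf]; apply: riemannian_pos; exists f; apply/eqP.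
Qed.

Lemma riem_ge0 W x : 0 <= g W W x.
Proof.
have [/riem_vanish->//|/riem_pos/ltW//] := pselect (vanishes_at W x).
Qed.

Lemma riem_eq0 W x : g W W x = 0 -> vanishes_at W x.
Proof. by move=> g0; apply: contrapT => /riem_pos; rewrite g0 ltxx. Qed.

Definition gram k (V : 'I_k -> T) x : 'M[R]_k := \matrix_(i, j) g (V i) (V j) x.

Lemma gram_comb k m (P : 'M[R]_(k, m)) (V : 'I_m -> T) x :
  gram (fun i => comb (P i) V) x = P *m gram V x *m P^T.
Proof.
apply/matrixP => i j; rewrite !mxE riem_combl.
under [RHS]eq_bigr do rewrite mxE mulr_suml.
rewrite exchange_big /=; apply: eq_bigr => l _; rewrite riem_combr mulr_sumr.
by apply: eq_bigr => l' _; rewrite !mxE -mulrA; congr (_ * _); rewrite mulrC.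
Qed.

Lemma gram_sym k (V : 'I_k -> T) x : (gram V x)^T = gram V x.
Proof. by apply/matrixP => i j; rewrite !mxE riemannian_sym. Qed.

Lemma gram_quad k (V : 'I_k -> T) x (v : 'rV[R]_k) :
  (v *m gram V x *m v^T) 0 0 = g (comb (v 0) V) (comb (v 0) V) x.
Proof. by have /matrixP/(_ 0 0) := gram_comb v V x; rewrite mxE => <-. Qed.

Lemma gram_row k (V : 'I_k -> T) x (v : 'rV[R]_k) j :
  (v *m gram V x) 0 j = g (comb (v 0) V) (V j) x.
Proof. by rewrite mxE riem_combl; apply: eq_bigr => l _; rewrite mxE. Qed.

(** A combination of the V_i of length 0 at x vanishes at x, so it is orthogonal to all of
    them and its coefficients are in the kernel of the Gram matrix. *)
Lemma gram_posdef k (V : 'I_k -> T) x : \det (gram V x) != 0 -> posdef (gram V x).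
Proof.
move=> d0; split=> [|v v0]; first exact: gram_sym.
have Gu : gram V x \in unitmx by rewrite unitmxE unitfE.
rewrite gram_quad lt_def riem_ge0 andbT; apply: contra_neq v0 => /riem_eq0 W0.
suff vG : v *m gram V x = 0 by rewrite -(mulmxK Gu v) vG mul0mx.
by apply/rowP => j; rewrite gram_row riem_vanish// mxE.
Qed.

Definition orthonormal k (V : 'I_k -> T) x := gram V x = 1%:M.

Lemma orthonormalE k (V : 'I_k -> T) x i j : orthonormal V x -> g (V i) (V j) x = (i == j)%:R.
Proof. by move/matrixP/(_ i j); rewrite !mxE. Qed.

(** Cholesky's factor has determinant 1 or -1; a reflection corrects the sign, and a change
    of basis of determinant 1 preserves the values of forms. *)
Lemma orthonormalize k (V : 'I_k.+1 -> T) x : \det (gram V x) = 1 ->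
  exists2 V' : 'I_k.+1 -> T, orthonormal V' x & forall a, is_form a -> a V' x = a V x.
Proof.
move=> d1; have GP : posdef (gram V x) by apply: gram_posdef; rewrite d1 oner_neq0.
have [P [Pu PG _]] := posdef_factor GP.
have dP2 : \det P ^+ 2 = 1.
  by have := congr1 (@determinant R _) PG; rewrite !det_mulmx det_tr d1 det1 mulr1 expr2.
have [Q [QG dQ]] : exists Q : 'M[R]_k.+1, Q *m gram V x *m Q^T = 1%:M /\ \det Q = 1.
  have /orP[/eqP dP|/eqP dP] : (\det P == 1) || (\det P == -1) by rewrite -sqrf_eq1 dP2.
    by exists P.
  pose D : 'M[R]_k.+1 := diag_mx (\row_j (if j == ord0 then -1 else 1)).
  have DD : D *m D^T = 1%:M.
    apply/matrixP => i j; rewrite tr_diag_mx mul_diag_mx !mxE.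
    case: (i == j); rewrite ?mulr0n ?mulr0// mulr1n.
    by case: ifP => _; rewrite ?mulrNN mulr1.
  exists (D *m P); split.
    have -> : D *m P *m gram V x *m (D *m P)^T = D *m (P *m gram V x *m P^T) *m D^T.
      by rewrite trmx_mul !mulmxA.
    by rewrite PG mulmx1.
  rewrite det_mulmx dP det_diag big_ord_recl mxE eqxx big1 ?mulr1 ?mulrNN ?mulr1// => i _.
  by rewrite mxE.
exists (fun i => comb (Q i) V); first by rewrite /orthonormal gram_comb.
by move=> a fa; rewrite form_comb// dQ mul1r.
Qed.

End Riemannian.

(** * Calibrated planes *)

Section Calibration.
Context {R : realType} {n q : nat} {X : smooth_manifold R n} (g : riemannian_metric X).
Local Notation C := (smoothfun X).
Local Notation T := (vfield X).
Variable phi : kform X q.+1.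
Hypothesis phi_le1 : forall x xi, unit_simple g x xi -> xi phi <= 1.
Implicit Types (V : 'I_q.+1 -> T) (x : X).

Let fphi : is_form phi := form_is_form phi.
Let mphi : multilinear phi := form_multilinear fphi.

Lemma orthonormal_unit_simple V x : orthonormal g V x ->
  unit_simple g x (simple_pvector x V).
Proof. by move=> oV; exists V => //=; rewrite -/(gram g V x) oV det1. Qed.

(** Reversing the first vector changes the sign of phi, so its upper bound is also a bound
    of the absolute value. *)
Lemma calibration_orthonormal V x : orthonormal g V x -> phi V x ^+ 2 <= 1.
Proof.
move=> oV; have h1 : phi V x <= 1 by exact: phi_le1 (orthonormal_unit_simple oV).
pose D : 'M[R]_q.+1 := diag_mx (\row_j (if j == ord0 then -1 else 1)).
have DD : D *m D^T = 1%:M.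
  apply/matrixP => i j; rewrite tr_diag_mx mul_diag_mx !mxE.
  case: (i == j); rewrite ?mulr0n ?mulr0// mulr1n.
  by case: ifP => _; rewrite ?mulrNN mulr1.
have dD : \det D = -1.
  by rewrite det_diag big_ord_recl mxE eqxx big1 ?mulr1// => i _; rewrite mxE.
have oD : orthonormal g (fun i => comb (D i) V) x.
  by rewrite /orthonormal gram_comb oV mulmx1.
have h2 : phi (fun i => comb (D i) V) x <= 1 by exact: phi_le1 (orthonormal_unit_simple oD).
rewrite form_comb// dD mulN1r in h2.
by rewrite -real_normK ?num_real// expr_le1// ler_norml h1 andbT lerNl.
Qed.

Lemma upd_upd_diff k (a : ('I_k -> T) -> C) (V : 'I_k -> T) i j : is_form a -> i != j ->
  a (upd V i (V j)) = 0.
Proof.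
by move=> fa ij; apply: (fa.2 _ i j ij); rewrite updE upd_neq// eq_sym.
Qed.

Lemma form_upd_comb k (a : ('I_k -> T) -> C) (V : 'I_k -> T) i (c : 'I_k -> R) x : is_form a ->
  a (upd V i (comb c V)) x = c i * a V x.
Proof.
move=> fa; rewrite multilinear_sum; last exact: form_multilinear.
rewrite sf_sumE (bigD1 i)// big1 ?addr0 => [|j ji]; rewrite sfME sfZE mulr1.
  by rewrite -[LHS]/(_ + 0) addr0 upd_id.
by rewrite upd_upd_diff 1?eq_sym// sf0E mulr0.
Qed.

Lemma riem_sqD (Y Z : T) x : g (Y + Z) (Y + Z) x = g Y Y x + 2 * g Z Y x + g Z Z x.
Proof.
rewrite riemDl sfDE (riemannian_sym g Y) (riemannian_sym g Z) !riemDl !sfDE.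
by rewrite (riemannian_sym g Y Z); ring.
Qed.

(** The inequality phi^2 <= det Gram is weakened by Hadamard's inequality to a product of
    squared lengths. It is still an equality at planes, and the product is easier to
    differentiate than the determinant. *)
Lemma calibration_hadamard V x : phi V x ^+ 2 <= \prod_i g (V i) (V i) x.
Proof.
have prodE : \prod_i g (V i) (V i) x = \prod_i (gram g V x) i i.
  by apply: eq_bigr => i _; rewrite mxE.
have [/eqP/det0P[v v0 vG]|d0] := eqVneq (\det (gram g V x)) 0.
  have W0 : vanishes_at (comb (v 0) V) x.
    by apply: (riem_eq0 (g := g)); rewrite -gram_quad vG mul0mx mxE.
  have [k vk] : exists k, v 0 k != 0.
    apply: contrapT => /forallNP H; move/eqP: v0; apply; apply/rowP => k.
    by rewrite mxE; apply/eqP/negPn/negP; exact: H.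
  have := multilinear_vanish V k mphi W0; rewrite form_upd_comb// => /eqP.
  rewrite mulf_eq0 (negPf vk) => /eqP ->.
  by rewrite expr0n; apply: prodr_ge0 => i _; exact: riem_ge0.
have [P [Pu PG dG]] := posdef_factor (gram_posdef d0).
have := calibration_orthonormal (_ : orthonormal g (fun i => comb (P i) V) x).
rewrite /orthonormal gram_comb => /(_ PG); rewrite form_comb// exprMn prodE => H.
apply: le_trans dG.
have dP : \det P != 0 by rewrite -unitfE -unitmxE.
have := congr1 (@determinant R _) PG; rewrite !det_mulmx det_tr det1 => dd.
have dP2 : 0 < \det P ^+ 2 by rewrite exprn_even_gt0.
have E : \det P ^+ 2 * \det (gram g V x) = 1 by rewrite -dd; ring.
by rewrite -(ler_pM2l dP2) E.
Qed.

Lemma quadratic_flat (s m : R) : 0 <= m ->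
  (forall t : R, (1 + t * s) ^+ 2 <= 1 + t ^+ 2 * m) -> s = 0.
Proof.
move=> m0 H; apply/eqP/negPn/negP => s0.
have m1 : 0 < m + 1 by lra.
have := H (s / (m + 1)); rewrite -subr_ge0.
have s2 : 0 < s ^+ 2 by rewrite exprn_even_gt0.
have -> : 1 + (s / (m + 1)) ^+ 2 * m - (1 + s / (m + 1) * s) ^+ 2 =
    - (s ^+ 2 / (m + 1) ^+ 2) * (m + 2 + s ^+ 2).
  by field; rewrite gt_eqF.
have h1 : 0 < s ^+ 2 / (m + 1) ^+ 2 by apply: divr_gt0 => //; exact: exprn_gt0.
have h2 : 0 < m + 2 + s ^+ 2 by lra.
by rewrite mulNr oppr_ge0 leNgt mulr_gt0.
Qed.

Definition ONplane x V := orthonormal g V x /\ phi V x = 1.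

(** Add t N to V_i, where N is the component of Y orthogonal to the plane: the product of
    the squared lengths is 1 + t^2 |N|^2 while phi changes by t phi(.., N, ..), so
    calibration_hadamard forces the latter to be 0. *)
Lemma first_cousin V x i Y : ONplane x V -> phi (upd V i Y) x = g Y (V i) x.
Proof.
move=> [oV phi1].
pose c j := - g Y (V j) x; pose N := Y + comb c V.
have gN j : g N (V j) x = 0.
  rewrite /N riemDl sfDE riem_combl (bigD1 j)//= big1 => [|l lj].
    by rewrite (orthonormalE _ _ oV) eqxx mulr1 addr0 subrr.
  by rewrite (orthonormalE _ _ oV) (negPf lj) mulr0.
suff : phi (upd V i N) x = 0.
  rewrite /N multilinearD0// sfDE form_upd_comb// phi1 mulr1 => /eqP.
  by rewrite subr_eq0 => /eqP.
apply: (@quadratic_flat _ (g N N x)); first exact: riem_ge0.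
move=> t; pose tN := (t *: (1 : C)) *: N.
have -> : 1 + t * phi (upd V i N) x = phi (upd V i (V i + tN)) x.
  by rewrite multilinearD0// upd_id sfDE phi1 multilinearZ// sfME sfZE mulr1.
apply: le_trans (calibration_hadamard _ _) _.
rewrite (bigD1 i)//= big1 ?mulr1 => [|j ji].
  have gtN Z : g tN Z x = t * g N Z x by rewrite riemZl sfME sfZE mulr1.
  rewrite updE riem_sqD (orthonormalE _ _ oV) eqxx !gtN gN mulr0 mulr0 addr0.
  by rewrite [g N tN]riemannian_sym gtN mulrA -expr2.
by rewrite upd_neq// (orthonormalE _ _ oV) eqxx.
Qed.

Variable nabla : levi_civita g.

Lemma vfield_prod (W : T) k (h : 'I_k -> C) x : (forall i, h i x = 1) ->
  W (\prod_i h i) x = \sum_i W (h i) x.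
Proof.
elim: k h => [|k IHk] h h1; first by rewrite !big_ord0 vfield1.
rewrite !big_ord_recl vfieldM sfDE !sfME IHk// h1 mul1r.
by rewrite sf_prodE big1 ?mulr1// => i _.
Qed.

(** The function prod |V_i|^2 - phi(V)^2 is nonnegative and vanishes at x, hence so does
    its derivative: the covariant derivative of phi vanishes on planes. *)
Lemma nabla_phi V x (Y : T) : ONplane x V ->
  Y (phi V) x = \sum_i phi (upd V i (nabla Y (V i))) x.
Proof.
move=> pV; have [oV phi1] := pV.
pose h : C := \prod_i g (V i) (V i) - phi V * phi V.
have h0 z : 0 <= h z.
  by rewrite /h sfBE subr_ge0 sf_prodE sfME -expr2 calibration_hadamard.
have hx : h x = 0.
  rewrite /h sfBE sf_prodE sfME phi1 mulr1 big1 ?subrr// => i _.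
  by rewrite (orthonormalE _ _ oV) eqxx.
have := @vfield_local_min _ _ _ Y h x; rewrite hx => /(_ (nearW _ h0)).
rewrite /h vfieldD vfieldN sfBE vfieldM sfDE !sfME phi1 mul1r mulr1 vfield_prod => [|i]; last first.
  by rewrite (orthonormalE _ _ oV) eqxx.
move/eqP; rewrite subr_eq0 => /eqP H.
have {H} : Y (phi V) x *+ 2 = (\sum_i phi (upd V i (nabla Y (V i))) x) *+ 2.
  rewrite mulr2n -H -sumrMnl; apply: eq_bigr => i _.
  by rewrite (nabla_metric nabla) sfDE (riemannian_sym g (V i)) first_cousin// -mulr2n.
by move/eqP; rewrite eqrMn2r => /eqP.
Qed.

Hypothesis dphi : exterior_d phi = 0.

(** Cartan's formula with d phi = 0 reduces the left-hand side to a Lie derivative; the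
    terms nabla_Y V_i cancel by nabla_phi, those with nabla_{V_i} Y remain. *)
Lemma ext_deriv_iprod V x (Y : T) : ONplane x V ->
  ext_deriv (iprod Y phi) V x = \sum_i phi (upd V i (nabla (V i) Y)) x.
Proof.
move=> pV.
have d0 : ext_deriv phi (consv Y V) = 0.
  by have := congr1 (fun b : kform X q.+2 => b (consv Y V)) dphi.
rewrite cartan consv0 consv_liftK in d0.
have {d0} -> : ext_deriv (iprod Y phi) V = lie Y phi V.
  by apply/esym/eqP; rewrite -subr_eq0; apply/eqP.
rewrite /lie sfBE (nabla_phi _ pV) /slotwise sf_sumE -sumrB; apply: eq_bigr => i _.
have -> : nabla (V i) Y = nabla Y (V i) - bracket Y (V i).
  by rewrite -(nabla_torsion_free nabla) opprB addrC subrK.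
rewrite -sfBE; congr (smoothfun_val _ x).
by rewrite multilinearD0// -(scaleN1r (bracket Y (V i))) multilinearZ// mulN1r.
Qed.

(** By the Leibniz rule the derivatives of u contribute the sum of the m (V_i f) phi(.., W, ..),
    which by first_cousin is m times the sum of the squares of the V_i f. *)
Lemma ext_deriv_grad V x (W : T) (f u : C) (m : R) : ONplane x V -> is_gradient g f W ->
  0 <= m -> (forall Y : T, Y u x = m * Y f x) ->
  u x * slotwise phi (fun Z => nabla Z W) V x <= ext_deriv (iprod (u *: W) phi) V x.
Proof.
move=> pV gW m0 um; rewrite ext_deriv_iprod// /slotwise sf_sumE mulr_sumr; apply: ler_sum => i _.
rewrite nabla_leibniz multilinearD0// sfDE !multilinearZ// !sfME lerDr first_cousin//.
by rewrite um gW -mulrA -expr2 mulr_ge0// sqr_ge0.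
Qed.

Lemma iprod_formP Y : iprod Y phi \in @form_pred R n X q.
Proof. by apply/asboolP; apply: is_form_iprod. Qed.

Lemma Lambda_positiveP (b : kform X q.+1) :
  Lambda_positive g phi b <-> forall x V, ONplane x V -> 0 <= b V x.
Proof.
split=> [H x V [oV phi1]|H x xi [[V /= dV <-] phi1]].
  exact: (H x (simple_pvector x V) (conj (orthonormal_unit_simple oV) phi1)).
have [V' oV' E] := orthonormalize (dV : \det (gram g V x) = 1).
rewrite /simple_pvector -E; last exact: form_is_form.
by apply: H; split=> //; rewrite E.
Qed.

End Calibration.

(** * Smooth functions of prescribed growth *)

Section Growth.
Context {R : realType}.
Variable c : nat -> R.

Let w (k : nat) : R := `|c k.+1| / flat 0 1.
Let term (k : nat) (t : R) : R := w k * flat 0 (t + (1 - k%:R)).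
Let part (N : nat) (t : R) : R := `|c 0%N| + \sum_(k < N) term k t.

(** A locally finite sum of shifted flat functions: the k-th term vanishes for t <= k - 1
    and exceeds |c_{k+1}| for t >= k, so only the terms up to t + 1 count. *)
Definition growth (t : R) : R := part (Num.truncn t).+2 t.

Let w_ge0 k : 0 <= w k. Proof. by rewrite divr_ge0// flat_ge0. Qed.

Let term_ge0 k t : 0 <= term k t. Proof. by rewrite mulr_ge0 ?flat_ge0. Qed.

Let part_stable N t : t + 1 <= N%:R -> part N t = growth t.
Proof.
move=> tN; have vanish k : t + 1 <= k%:R -> term k t = 0.
  by move=> tk; rewrite /term /flat ifF ?mulr0//; apply/negbTE; rewrite -leNgt; lra.
have stable M M' : (M <= M')%N -> t + 1 <= M%:R -> part M' t = part M t.
  move=> MM tM; rewrite /part -!(big_mkord xpredT (term^~ t)) (big_cat_nat (n := M))//=.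
  rewrite [X in _ + (_ + X)]big_nat_cond [X in _ + (_ + X)]big1 ?addr0// => k; rewrite andbT => /andP[Mk _].
  by apply: vanish; rewrite (le_trans tM)// ler_nat.
have tT : t + 1 <= (Num.truncn t).+2%:R.
  by rewrite -[X in _ <= X]natr1 lerD2r ltW// truncnS_gt.
by case: (leqP N (Num.truncn t).+2) => [NT|/ltnW NT]; [rewrite /growth (stable N)|rewrite /growth -(stable _ N)].
Qed.

Let term_derive k (t : R) : is_derive t 1 (term k) (w k * flat 2 (t + (1 - k%:R))).
Proof.
have d1 : is_derive t (1 : R) (fun s : R => s + (1 - k%:R)) (1 + 0) by apply: is_deriveD.
have := @is_derive1_comp _ (flat 0) _ t _ _ (is_derive_flat 0 _) d1.
rewrite mul0r subr0 addr0 mulr1 => d2.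
exact: (@is_deriveZ _ _ _ _ (w k) _ _ _ d2).
Qed.

Let near_growth (t : R) : exists2 N, t + 1 < N%:R &
  {near t, part N =1 growth}.
Proof.
pose N := (Num.truncn t).+3; have tN : t + 1 < N%:R - 1.
  by rewrite /N -[X in _ < X - _]natr1 addrK -[X in _ < X]natr1 ltrD2r truncnS_gt.
exists N; first by lra.
near=> s; apply: part_stable.
have : s < N%:R - 1 by near: s; apply: lt_nbhsl; lra.
lra.
Unshelve. all: by end_near. Qed.

Lemma growth_derive (t : R) : differentiable growth t /\ 0 <= 'D_1 growth t.
Proof.
have [N _ E] := near_growth t.
have dk k : differentiable (term k) t by apply/derivable1_diffP; have [] := term_derive k t.
have PE : part N = cst `|c 0%N| + \sum_(k < N) (term k : R -> R).
  by apply/funext => s; rewrite /part fctE fct_sumE.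
have dp : differentiable (part N) t.
  rewrite PE; apply: differentiableD; first exact: differentiable_cst.
  exact: differentiable_sum.
split; first exact: near_eq_differentiable E dp.
rewrite -(near_eq_derive _ E) PE deriveD; last 2 first.
- exact: derivable_cst.
- by apply: derivable_sum => k; exact: diff_derivable.
rewrite derive_cst add0r derive_sum => [|k]; last exact: diff_derivable.
apply: sumr_ge0 => k _; rewrite (@derive_val _ _ _ _ _ _ _ (term_derive k t)).
by rewrite mulr_ge0 ?flat_ge0.
Qed.

Lemma growth_smooth : smooth_on [set: R] growth.
Proof.
move=> m; apply: Ck_on_local => t _; have [N tN _] := near_growth t.
exists [set s : R | s < N%:R - 1]; first by rewrite /=; lra.
apply: (@eq_Ck_on _ _ _ _ _ (part N)); first exact: open_lt.
  by move=> s /= sN; apply: part_stable; lra.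
have oS : open [set s : R | s < N%:R - 1] by exact: open_lt.
apply: (Ck_onD (f := cst `|c 0%N|)) => //; first exact: Ck_on_cst.
apply: Ck_on_sum => // k _; apply: (Ck_onM (f := cst (w k))) => //; first exact: Ck_on_cst.
apply: (@smooth_on_comp1 _ R _ (fun s => s + (1 - k%:R)) (flat 0)) => //; last exact: smooth_flat.
move=> m'; exact: (@Ck_onD R R R m' _ id (cst (1 - k%:R)) oS
  (@smooth_on_id R R _ m') (Ck_on_cst _ _ _)).
Qed.

Lemma growth_ge0 (t : R) : `|c 0%N| <= growth t.
Proof. by rewrite /growth /part lerDl; apply: sumr_ge0. Qed.

Lemma growth_ge k (t : R) : k%:R <= t -> `|c k.+1| <= growth t.
Proof.
move=> kt; have [N tN E] := near_growth t.
have -> : growth t = part N t by rewrite part_stable// ltW.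
have kN : (k < N)%N by rewrite -(ltr_nat R); lra.
rewrite /part (bigD1 (Ordinal kN))//= addrCA -[leLHS]addr0; apply: lerD; last first.
  by rewrite addr_ge0//; apply: sumr_ge0.
have f1 : 0 < flat 0 (1 : R) by rewrite flat_gt0.
rewrite /term /w mulrAC ler_pdivlMr// ler_wpM2l//; apply: flat_nd; lra.
Qed.

End Growth.

(** * Compactness of the planes of a calibration *)

(** The tube lemma, with a constant M to be chosen large: over a compact set finitely many
    neighborhoods and constants suffice. *)
Lemma near_covering_le {R : realType} {T S : topologicalType} (K : set S) (x0 : T)
    (P : S -> T -> R -> Prop) : compact K ->
  (forall a, K a -> \forall q \near ((a, x0) : S * T) & M \near +oo, P q.1 q.2 M) ->
  exists M : R, \forall x \near x0, forall a, K a -> P a x M.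
Proof.
move=> /compact_near_coveringP cK H.
have := cK (T * R)%type (filter_prod (nbhs x0) +oo) (fun xM a => P a xM.1 xM.2) _.
case.
  move=> a /H [[A B] /= [[[A1 A2] /= [nA1 nA2] A12] nB] AB].
  exists (A1, A2 `*` B) => /=.
    by split=> //; exists (A2, B).
  move=> [a' [x M]] /= [A1a [A2x BM]].
  by apply: (AB ((a', x), M)); split=> //=; apply: (A12 (a', x)).
move=> [A B] /= [nA nB] AB.
have [M BM] := filter_ex nB.
by exists M; apply: filterS nA => x Ax a Ka; apply: (AB (x, M)) => //=.
Qed.

Lemma near_pinfty_gt {R : realType} (r : R) : nbhs +oo [set M : R | r < M].
Proof. by apply: nbhs_pinfty_gt; exact: num_real. Qed.

Lemma bounded_rV_compact {R : realType} m (r : R) : compact [set u : 'rV[R]_m | `|u| <= r].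
Proof.
apply: bounded_closed_compact.
  by exists r; split; [exact: num_real|move=> M rM u /= ur; exact: le_trans ur (ltW rM)].
have -> : [set u : 'rV[R]_m | `|u| <= r] = (fun u => `|u|) @^-1` [set t | t <= r] by [].
by apply: closed_comp; [move=> u _; exact: norm_continuous|exact: closed_le].
Qed.

Section PlaneCompactness.
Context {R : realType} {n q : nat} {X : smooth_manifold R n} (g : riemannian_metric X).
Local Notation C := (smoothfun X).
Local Notation T := (vfield X).
Local Notation p := q.+1.
Variable phi : kform X p.

Local Notation coefs := 'rV[R]_(p * n).
Definition frame_tuple (Fr : local_frame X) (a : coefs) : 'I_p -> T :=
  fun i => comb (fun j => a 0 (mxvec_index i j)) (frame_E Fr).

Lemma sf_snd_continuous (S : topologicalType) (h : C) (y : S * X) :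
  {for y, continuous (fun y : S * X => h y.2)}.
Proof. by apply: continuous_comp; [exact: cvg_snd|exact: smoothfun_continuous]. Qed.

Lemma coord_fst_continuous (S : topologicalType) m j (y : 'rV[R]_m * S) :
  {for y, continuous (fun y : 'rV[R]_m * S => y.1 0 j)}.
Proof.
apply: (@continuous_comp _ _ _ fst (fun a : 'rV[R]_m => a 0 j)); first exact: cvg_fst.
exact: coord_continuous.
Qed.

Lemma continuous_sum_for (S : topologicalType) (W : normedModType R) (I : Type) (r : seq I)
    (h : I -> S -> W) y :
  (forall i, {for y, continuous (h i)}) -> {for y, continuous (fun z => \sum_(i <- r) h i z)}.
Proof.
move=> ch; elim: r => [|i r IHr].
  by rewrite (_ : (fun z => _) = cst 0); [exact: cst_continuous|apply/funext => z; rewrite big_nil].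
rewrite (_ : (fun z => _) = h i + (fun z => \sum_(i <- r) h i z)); first exact: continuousD.
by apply/funext => z; rewrite big_cons.
Qed.

Lemma continuous_prod_for (S : topologicalType) (I : Type) (r : seq I) (h : I -> S -> R) y :
  (forall i, {for y, continuous (h i)}) -> {for y, continuous (fun z => \prod_(i <- r) h i z)}.
Proof.
move=> ch; elim: r => [|i r IHr].
  by rewrite (_ : (fun z => _) = cst 1); [exact: cst_continuous|apply/funext => z; rewrite big_nil].
rewrite (_ : (fun z => _) = h i * (fun z => \prod_(i <- r) h i z)); first exact: continuousM.
by apply/funext => z; rewrite big_cons.
Qed.

Lemma multilinear_frame_continuous (F : ('I_p -> T) -> C) (Fr : local_frame X) (y : coefs * X) :
  multilinear F -> {for y, continuous (fun y : coefs * X => F (frame_tuple Fr y.1) y.2)}.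
Proof.
move=> FL; rewrite (_ : (fun y : coefs * X => _) = (fun y : coefs * X =>
  \sum_(J : {ffun 'I_p -> 'I_n}) (\prod_i y.1 0 (mxvec_index i (J i))) * F (frame_E Fr \o J) y.2)).
  apply: continuous_sum_for => J; apply: continuousM; last exact: sf_snd_continuous.
  by apply: continuous_prod_for => i; exact: coord_fst_continuous.
by apply/funext => z; rewrite multilinear_comb.
Qed.

Lemma riem_frame_continuous (S : topologicalType) (a b : 'I_n -> S -> R) (Fr : local_frame X)
    (y : S * X) : (forall j, continuous (a j)) -> (forall j, continuous (b j)) ->
  {for y, continuous (fun y : S * X =>
     g (comb (a^~ y.1) (frame_E Fr)) (comb (b^~ y.1) (frame_E Fr)) y.2)}.
Proof.
move=> ca cb; rewrite (_ : (fun y : S * X => _) = (fun y : S * X =>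
  \sum_(j < n) a j y.1 * \sum_(k < n) b k y.1 * g (frame_E Fr j) (frame_E Fr k) y.2)).
  apply: continuous_sum_for => j; apply: continuousM.
    by apply: (@continuous_comp _ _ _ fst (a j)); [exact: cvg_fst|exact: ca].
  apply: continuous_sum_for => k; apply: continuousM; last exact: sf_snd_continuous.
  by apply: (@continuous_comp _ _ _ fst (b k)); [exact: cvg_fst|exact: cb].
apply/funext => z; rewrite riem_combl; apply: eq_bigr => j _; congr (_ * _).
by rewrite riem_combr.
Qed.

Lemma frame_coef_vanish (Fr : local_frame X) W x : frame_b Fr x != 0 ->
  vanishes_at (W - comb (frame_coef Fr x W) (frame_E Fr)) x.
Proof.
move=> b0 f; rewrite [(W - _) f]vfield_addE vfield_oppE sfBE vfield_combE.
have := congr1 (fun V : T => V f x) (frame_span Fr W).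
rewrite vfield_sumE sf_sumE vfield_scaleE sfME sfXE => E.
have b3 : frame_b Fr x ^+ 3 != 0 by rewrite expf_neq0.
apply: (mulfI b3); rewrite mulr0 mulrBr E mulr_sumr -sumrB big1// => j _.
by rewrite vfield_scaleE sfME /frame_coef mulrA mulrCA divff// mulr1 subrr.
Qed.

Lemma riem_frame_coef (Fr : local_frame X) W W' x : frame_b Fr x != 0 ->
  g W W' x = g (comb (frame_coef Fr x W) (frame_E Fr)) (comb (frame_coef Fr x W') (frame_E Fr)) x.
Proof.
move=> b0; have aux Y Z : g Y Z x = g (comb (frame_coef Fr x Y) (frame_E Fr)) Z x.
  have := riem_vanish g Z (frame_coef_vanish Y b0).
  by rewrite riemDl -scaleN1r riemZl sfDE mulN1r sfNE => /eqP; rewrite subr_eq0 => /eqP.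
by rewrite aux riemannian_sym aux riemannian_sym.
Qed.

Lemma eq_comb m (a b : 'I_m -> R) (E : 'I_m -> T) : a =1 b -> comb a E = comb b E.
Proof. by move/funext=> ->. Qed.

Lemma riem_comb_scale (E : 'I_n -> T) (t : R) (v : 'rV[R]_n) x :
  g (comb ((t *: v) 0) E) (comb ((t *: v) 0) E) x =
  t ^+ 2 * g (comb (v 0) E) (comb (v 0) E) x.
Proof.
rewrite !riem_combl mulr_sumr; apply: eq_bigr => j _.
rewrite !riem_combr mulrCA mulr_sumr !mulr_sumr; apply: eq_bigr => k _.
by rewrite !mxE; ring.
Qed.

(** On the unit sphere of the coefficients the metric is bounded below, uniformly near x0,
    by compactness; the bound of the coefficients of unit vectors follows by homogeneity. *)
Lemma frame_norm_bound (Fr : local_frame X) x0 : 0 < frame_b Fr x0 ->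
  exists2 M : R, 0 < M & \forall x \near x0, forall v : 'rV[R]_n,
    g (comb (v 0) (frame_E Fr)) (comb (v 0) (frame_E Fr)) x = 1 -> `|v| <= M.
Proof.
move=> b0.
pose Q (v : 'rV[R]_n) x := g (comb (v 0) (frame_E Fr)) (comb (v 0) (frame_E Fr)) x.
have cQ (y : 'rV[R]_n * X) : {for y, continuous (fun y : 'rV[R]_n * X => Q y.1 y.2)}.
  by apply: (@riem_frame_continuous 'rV[R]_n (fun j v => v 0 j) (fun j v => v 0 j) Fr y) => j;
    exact: coord_continuous.
have [M HM] : exists M : R, \forall x \near x0, forall v : 'rV[R]_n, `|v| = 1 ->
    0 < M /\ 1 < M * Q v x.
  apply: (@near_covering_le R X 'rV[R]_n [set v | `|v| = 1] x0 (fun v x M => 0 < M /\ 1 < M * Q v x)).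
    apply: (@subclosed_compact _ _ [set v : 'rV[R]_n | `|v| <= 1]).
    - have -> : [set v : 'rV[R]_n | `|v| = 1] = (fun u => `|u|) @^-1` [set 1 : R] by [].
      by apply: closed_comp; [move=> u _; exact: norm_continuous|exact: closed_eq].
    - exact: bounded_rV_compact.
    - by move=> v /= ->.
  move=> v /= v1.
  have [k vk] : exists k, v 0 k != 0.
    apply: contrapT => /forallNP vk; move/eqP: v1; rewrite (_ : v = 0) ?normr0; last first.
      by apply/rowP => k; rewrite mxE; apply/eqP/negPn/negP; exact: vk.
    by rewrite eq_sym oner_eq0.
  have Qp : 0 < Q v x0.
    apply: riem_pos => W0; have [|f] := @comb_neq0 _ _ _ Fr (v 0) k x0 _ vk.
      by rewrite gt_eqF.
    by rewrite W0 eqxx.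
  exists ([set y | Q v x0 / 2 < Q y.1 y.2], [set M | 2 / Q v x0 < M]) => /=.
    split; last exact: near_pinfty_gt.
    by apply: (cvgr_gt _ (cQ (v, x0))); rewrite /= ltr_pdivrMr// mulr_natr mulr2n ltrDl.
  move=> [y M] /= [Qy MQ]; have M0 : 0 < M by rewrite (lt_trans _ MQ)// divr_gt0.
  split=> //; apply: (@le_lt_trans _ _ (2 / Q v x0 * (Q v x0 / 2))).
    by rewrite mulrA divfK ?gt_eqF// divff.
  by apply: ltr_pM => //; rewrite divr_ge0// ltW.
exists (`|M| + 1); first by rewrite ltr_wpDl.
apply: filterS HM => x HM v Qv; have [->|v0] := eqVneq v 0; first by rewrite normr0 addr_ge0.
have nv : 0 < `|v| by rewrite normr_gt0.
have [|M0] := HM (`|v|^-1 *: v); first by rewrite normrZ normfV normr_id mulVf// gt_eqF.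
rewrite /Q riem_comb_scale Qv mulr1 exprVn ltr_pdivlMr ?exprn_gt0// mul1r (gtr0_norm M0).
by move=> vM; have := sqr_ge0 (`|v| - 1); rewrite sqrrB; nra.
Qed.

Lemma near_neq (S : topologicalType) (h : S -> R) (y : S) (c : R) :
  {for y, continuous h} -> h y != c -> \forall z \near y, h z != c.
Proof.
move=> ch hc; have /ch : nbhs (h y) [set t : R | t != c].
  by apply: open_nbhs_nbhs; split=> //; exact: open_neq.
exact.
Qed.

(** Planes near a point are represented by bounded coefficient matrices in a fixed frame;
    these take the place of a Grassmann bundle in compactness arguments. *)
Lemma plane_coords (Fr : local_frame X) x (r : R) V : frame_b Fr x != 0 -> 0 <= r ->
  (forall v : 'rV[R]_n,
    g (comb (v 0) (frame_E Fr)) (comb (v 0) (frame_E Fr)) x = 1 -> `|v| <= r) ->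
  ONplane g phi x V -> exists a : coefs, [/\ `|a| <= r, ONplane g phi x (frame_tuple Fr a) &
    forall B : ('I_p -> T) -> C, multilinear B -> B (frame_tuple Fr a) x = B V x].
Proof.
move=> b1 r0 nrx [oV phi1].
pose a : coefs := mxvec (\matrix_(i, j) frame_coef Fr x (V i) j).
have aE i : frame_tuple Fr a i = comb (frame_coef Fr x (V i)) (frame_E Fr).
  by apply: eq_comb => j; rewrite /a mxvecE mxE.
have BE B : multilinear B -> B (frame_tuple Fr a) x = B V x.
  move=> BL; rewrite (multilinear_coef V BL b1).
  by congr (smoothfun_val (B _) x); apply/funext.
have oa : orthonormal g (frame_tuple Fr a) x.
  apply/matrixP => i j; rewrite !mxE !aE -riem_frame_coef//.
  by rewrite (orthonormalE _ _ oV).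
exists a; split=> //; last first.
  by split=> //; rewrite BE//; apply: form_multilinear; exact: form_is_form.
rewrite [leLHS]/Num.Def.normr/= mx_normrE; apply: bigmax_le => //.
move=> [i0 l] _ /=; rewrite ord1; case/mxvec_indexP: l => i j.
pose v : 'rV[R]_n := \row_j a 0 (mxvec_index i j).
apply: (@le_trans _ _ `|v|).
  rewrite [leRHS]/Num.Def.normr/= mx_normrE; apply: le_trans; last exact: (le_bigmax _ _ (0, j)).
  by rewrite /= mxE.
have vE : comb (v 0) (frame_E Fr) = frame_tuple Fr a i.
  by apply: eq_comb => l; rewrite mxE.
by apply: nrx; rewrite vE (orthonormalE _ _ oa) eqxx.
Qed.

Lemma plane_compact (I : finType) (F : I -> ('I_p -> T) -> C) x :
  (forall i, multilinear (F i)) ->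
  compact [set v : 'rV[R]_#|I| | exists2 V, ONplane g phi x V & v = \row_i F (enum_val i) V x].
Proof.
move=> FL; have [Fr b0] := frame_at x.
have [r r0 nr] := frame_norm_bound b0; have {}nr := nbhs_singleton nr.
have b1 : frame_b Fr x != 0 by rewrite gt_eqF.
have mphi : multilinear phi by apply: form_multilinear; exact: form_is_form.
pose h (a : coefs) : 'rV[R]_#|I| := \row_i F (enum_val i) (frame_tuple Fr a) x.
have pc (a : coefs) : {for a, continuous (fun a : coefs => (a, x))}.
  move=> A [[P Q] /= [nP nQ] PQ]; apply: filterS nP => a' Pa'.
  by apply: (PQ (a', x)); split=> //; exact: nbhs_singleton.
have cont1 (B : ('I_p -> T) -> C) : multilinear B ->
    continuous (fun a : coefs => B (frame_tuple Fr a) x).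
  move=> BL a; apply: (@continuous_comp _ _ _ (fun a : coefs => (a, x))
    (fun y : coefs * X => B (frame_tuple Fr y.1) y.2)); first exact: pc.
  exact: multilinear_frame_continuous.
have cG i j : continuous (fun a : coefs => g (frame_tuple Fr a i) (frame_tuple Fr a j) x).
  move=> a; apply: (@continuous_comp _ _ _ (fun a : coefs => (a, x))
    (fun y : coefs * X => g (frame_tuple Fr y.1 i) (frame_tuple Fr y.1 j) y.2)); first exact: pc.
  by apply: (@riem_frame_continuous coefs (fun l a => a 0 (mxvec_index i l))
     (fun l a => a 0 (mxvec_index j l)) Fr (a, x)) => l; exact: coord_continuous.
pose Z := [set a : coefs | `|a| <= r /\ ONplane g phi x (frame_tuple Fr a)].
have -> : [set v : 'rV[R]_#|I| | exists2 V, ONplane g phi x V & v = \row_i F (enum_val i) V x] = h @` Z.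
  apply/seteqP; split=> [v [V pV ->]|_ [a [_ pa] <-]]; last by exists (frame_tuple Fr a).
  have [a [ar pa aE]] := plane_coords b1 (ltW r0) nr pV.
  by exists a => //; apply/rowP => i; rewrite !mxE aE.
apply: continuous_compact.
  apply: continuous_subspaceT => a.
  rewrite (_ : h = fun a => \sum_i (F (enum_val i) (frame_tuple Fr a) x *: delta_mx 0 i)).
    by apply: continuous_sum_for => i; apply: continuousZr_tmp; exact: cont1.
  apply/funext => b; rewrite [LHS]row_sum_delta; apply: eq_bigr => i _; by rewrite mxE.
apply: (@subclosed_compact _ _ [set a : coefs | `|a| <= r]).
- have -> : Z = [set a : coefs | `|a| <= r] `&`
     (\bigcap_(ij : 'I_p * 'I_p) [set a : coefs | g (frame_tuple Fr a ij.1) (frame_tuple Fr a ij.2) x = (ij.1 == ij.2)%:R])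
     `&` [set a : coefs | phi (frame_tuple Fr a) x = 1].
    apply/seteqP; split=> [a [ar [oa pa]]|a [[ar oa] pa]].
      by split=> //; split=> // -[i j] _ /=; exact: orthonormalE oa.
    split=> //; split=> //; apply/matrixP => i j; rewrite !mxE.
    exact: (oa (i, j)).
  apply: closedI; first apply: closedI.
  + by apply: compact_closed; [exact: norm_hausdorff|exact: bounded_rV_compact].
  + apply: closed_bigI => -[i j] _ /=.
    by apply: (@closed_comp _ _ _ [set t : R | t = (i == j)%:R]); [move=> a _; exact: cG|exact: closed_eq].
  + by apply: (@closed_comp _ _ _ [set t : R | t = 1]); [move=> a _; exact: cont1|exact: closed_eq].
- exact: bounded_rV_compact.
- by move=> a [].
Qed.

(** In the coefficients of plane_coords, each of the conditions (not being a plane, or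
    satisfying the inequality for a large M) holds on an open set, and the tube lemma
    applies. *)
Lemma plane_domination (F H : ('I_p -> T) -> C) x0 : multilinear F -> multilinear H ->
  (forall V, ONplane g phi x0 V -> 0 < H V x0) ->
  exists M : R, 0 < M /\ \forall x \near x0, forall V, ONplane g phi x V -> F V x < M * H V x.
Proof.
move=> FL HL Hpos; have [Fr b0] := frame_at x0.
have [r r0 nr] := frame_norm_bound b0.
have mphi : multilinear phi by apply: form_multilinear; exact: form_is_form.
pose G i j (y : coefs * X) : R := g (frame_tuple Fr y.1 i) (frame_tuple Fr y.1 j) y.2.
have cG i j y : {for y, continuous (G i j)}.
  by apply: (@riem_frame_continuous coefs (fun l a => a 0 (mxvec_index i l))
     (fun l a => a 0 (mxvec_index j l)) Fr y) => l; exact: coord_continuous.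
pose Phi (B : ('I_p -> T) -> C) (y : coefs * X) : R := B (frame_tuple Fr y.1) y.2.
have cPhi B y : multilinear B -> {for y, continuous (Phi B)}.
  exact: multilinear_frame_continuous.
have [M HM] : exists M : R, \forall x \near x0, forall a : coefs, `|a| <= r ->
    0 < M /\ ((forall i j, G i j (a, x) = (i == j)%:R) -> Phi phi (a, x) = 1 ->
    Phi F (a, x) < M * Phi H (a, x)).
  apply: (@near_covering_le R X coefs [set a | `|a| <= r] x0 (fun a x M =>
    0 < M /\ ((forall i j, G i j (a, x) = (i == j)%:R) -> Phi phi (a, x) = 1 ->
    Phi F (a, x) < M * Phi H (a, x)))); first exact: bounded_rV_compact.
  move=> a /= ar.
  have [Ga|/existsNP[i /existsNP[j Ga]]] :=
      pselect (forall i j, G i j (a, x0) = (i == j)%:R); last first.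
    exists ([set y | G i j y != (i == j)%:R], [set M | 0 < M]) => /=.
      by split; [exact: (near_neq (cG i j (a, x0)) (introN eqP Ga))|exact: near_pinfty_gt].
    by move=> [[a' x] M] /= [/eqP Gy M0]; split=> // /(_ i j).
  have [pa|pa] := eqVneq (Phi phi (a, x0)) 1; last first.
    exists ([set y | Phi phi y != 1], [set M | 0 < M]) => /=.
      by split; [exact: (near_neq (cPhi phi (a, x0) mphi) pa)|exact: near_pinfty_gt].
    by move=> [[a' x] M] /= [/eqP Gy M0]; split.
  have Hp : 0 < Phi H (a, x0).
    by apply: Hpos; split=> //; apply/matrixP => i j; rewrite !mxE; exact: Ga.
  pose h := Phi H (a, x0); pose f := `|Phi F (a, x0)| + 1.
  have f0 : 0 < f by rewrite ltr_wpDl.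
  exists ([set y | h / 2 < Phi H y /\ Phi F y < f], [set M | 2 * f / h < M]) => /=.
    split; last exact: near_pinfty_gt.
    apply: filterI.
      by apply: (cvgr_gt _ (cPhi H (a, x0) HL)); rewrite ltr_pdivrMr// mulr_natr mulr2n ltrDl.
    by apply: (cvgr_lt _ (cPhi F (a, x0) FL)); rewrite (le_lt_trans (ler_norm _))// ltrDl.
  move=> [[a' x] M] /= [[Hy Fy] MQ].
  have M0 : 0 < M by rewrite (lt_trans _ MQ)// divr_gt0// mulr_gt0.
  split=> // _ _; apply: lt_trans Fy _.
  have -> : f = 2 * f / h * (h / 2) by rewrite /h; field; rewrite gt_eqF.
  apply: ltr_pM => //; rewrite ?divr_ge0// ?mulr_ge0// ltW//.
have bx : \forall x \near x0, frame_b Fr x != 0.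
  by apply: near_neq; [exact: smoothfun_continuous|rewrite gt_eqF].
have M0 : 0 < M.
  have := nbhs_singleton HM => /(_ 0); rewrite normr0 ltW// => /(_ isT)[].
  by [].
exists M; split=> //; near=> x => V pV.
have b1 : frame_b Fr x != 0 by near: x.
have nrx : forall v : 'rV[R]_n,
  g (comb (v 0) (frame_E Fr)) (comb (v 0) (frame_E Fr)) x = 1 -> `|v| <= r by near: x.
have [a [ar [oa pa] aE]] := plane_coords b1 (ltW r0) nrx pV.
have HMx : forall a : coefs, `|a| <= r ->
    0 < M /\ ((forall i j, G i j (a, x) = (i == j)%:R) -> Phi phi (a, x) = 1 ->
    Phi F (a, x) < M * Phi H (a, x)) by near: x.
have [_ H1] := HMx a ar; rewrite -(aE F FL) -(aE H HL).
by apply: (H1 _ pa) => i j; exact: orthonormalE oa.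
Unshelve. all: by end_near. Qed.

End PlaneCompactness.

(** * Domination by exact forms *)

Section Domination.
Context {R : realType} {n q : nat} {X : smooth_manifold R n} (g : riemannian_metric X).
Local Notation C := (smoothfun X).
Local Notation T := (vfield X).
Local Notation p := q.+1.
Variable phi : kform X p.

Lemma plane_domination_compact (F H : ('I_p -> T) -> C) (K : set X) : compact K ->
  multilinear F -> multilinear H ->
  (forall x V, K x -> ONplane g phi x V -> 0 < H V x) ->
  exists2 M : R, 0 < M & forall x V, K x -> ONplane g phi x V -> F V x <= M * H V x.
Proof.
move=> /compact_near_coveringP cK FL HL Hp.
have := cK R +oo (fun M x => K x -> 0 < M /\ forall V, ONplane g phi x V -> F V x <= M * H V x) _.
case.
  move=> x0 Kx0; have [M0 [M0p HM]] := plane_domination FL HL (fun V => Hp x0 V Kx0).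
  exists ([set x | forall V, ONplane g phi x V -> F V x < M0 * H V x], [set M | M0 < M]) => /=.
    by split=> //; exact: near_pinfty_gt.
  move=> [x M] /= [Hx MM] Kx; split=> [|V pV]; first exact: lt_trans MM.
  by rewrite (le_trans (ltW (Hx V pV)))// ler_wpM2r// ltW//; exact: Hp.
move=> M [_ HM]; exists (`|M| + 1); first by rewrite ltr_wpDl.
move=> x V Kx; have MM : M < `|M| + 1 by rewrite (le_lt_trans (ler_norm _))// ltrDl.
by have [_] := HM _ MM x Kx Kx; exact.
Qed.

(** The partial derivatives obey the chain rule, and W is a combination of them. *)
Lemma vfield_chain (W : T) (f u : C) (h : R -> R) x : (forall z, u z = h (f z)) ->
  (forall t, differentiable h t) -> W u x = 'D_1 h (f x) * W f x.
Proof.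
move=> uE dh; have [Fr b0] := frame_at x.
have E (k : C) : frame_b Fr x ^+ 3 * W k x = \sum_j frame_A Fr W j x * frame_E Fr j k x.
  have := congr1 (fun V : T => V k x) (frame_span Fr W).
  rewrite vfield_sumE sf_sumE vfield_scaleE sfME sfXE => ->.
  by apply: eq_bigr => j _; rewrite vfield_scaleE sfME.
apply: (mulfI (_ : frame_b Fr x ^+ 3 != 0)); first by rewrite expf_neq0// gt_eqF.
rewrite E mulrCA E mulr_sumr; apply: eq_bigr => j _.
by rewrite (frame_chain Fr j x uE dh) mulrCA.
Qed.

Lemma growth_smoothfun (c : nat -> R) (f : C) : growth c \o f \in @smoothfun_pred R n X.
Proof.
apply/asboolP => i; apply: (smooth_on_comp1 (@chart_cod_open _ _ X i)).
  exact: smoothfun_smooth.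
exact: growth_smooth.
Qed.

Variable nabla : levi_civita g.
Hypothesis phi_le1 : forall x xi, unit_simple g x xi -> xi phi <= 1.
Hypothesis dphi : exterior_d phi = 0.
Variables (f : C) (W : T).
Hypothesis gradW : is_gradient g f W.
Hypothesis hess_gt0 : forall x V, ONplane g phi x V -> 0 < phi_hessian nabla phi W V x.
Hypothesis f_proper : forall c : R, compact [set x : X | f x <= c].

(** Take a = chi(f) i_W phi with W the gradient of f. On the compact set {f <= k} the
    phi-Hessian H of f is bounded below on planes, say 1 <= M_k H, and by ext_deriv_grad
    da >= chi(f) H on planes as soon as chi is nondecreasing; it is enough that chi
    exceeds |c_k| M_k on the values between k - 1 and k. *)
Lemma psh_domination (F : X -> ('I_p -> T) -> R) (c : nat -> R) :
  (forall k x V, f x <= k%:R -> ONplane g phi x V -> F x V <= c k) ->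
  exists a : kform X q, forall x V, ONplane g phi x V -> F x V <= exterior_d a V x.
Proof.
move=> Fc; pose H := phi_hessian nabla phi W.
have mphi : multilinear phi by apply: form_multilinear; exact: form_is_form.
have mH : multilinear H by apply: form_multilinear; exact: form_is_form.
have /choice[M HM] : forall k : nat, exists M : R, 0 < M /\
    forall x V, f x <= k%:R -> ONplane g phi x V -> 1 <= M * H V x.
  move=> k; have [M M0 HM] := plane_domination_compact (@f_proper k%:R) mphi mH
    (fun x V _ pV => hess_gt0 pV).
  by exists M; split=> // x V fx pV; have := HM x V fx pV; rewrite pV.2.
pose c' k := `|c k| * M k.
pose u : C := SmoothFun (growth_smoothfun c' f).
(* The factor M k in c' absorbs the lower bound of the Hessian on {f <= k}. *)
pose a : kform X q := Form (iprod_formP phi (u *: W)).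
have uc x k : `|c' k| <= u x -> f x <= k%:R -> forall V, ONplane g phi x V ->
    F x V <= exterior_d a V x.
  move=> cu fx V pV; have [M0 M1] := HM k.
  have [dg gp] := growth_derive c' (f x).
  have chain (Y : T) : Y u x = 'D_1 (growth c') (f x) * Y f x.
    by apply: vfield_chain => // t; exact: (growth_derive c' t).1.
  apply: le_trans (ext_deriv_grad phi_le1 nabla dphi pV gradW gp chain).
  apply: le_trans (Fc k x V fx pV) _; apply: le_trans (ler_norm _) _.
  have Hp := hess_gt0 pV; have MH := M1 x V fx pV.
  rewrite -[slotwise _ _ V x]/(H V x).
  apply: (@le_trans _ _ (`|c' k| * H V x)); last by rewrite ler_wpM2r// ltW.
  by rewrite /c' normrM normr_id (gtr0_norm M0) -mulrA ler_peMr.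
exists a => x V; have [fx|fx] := ltP (f x) 0.
  by apply: (uc x 0%N); [exact: growth_ge0|exact: ltW].
have [k1 k2] := andP (Num.Theory.truncn_itv fx).
by apply: (uc x (Num.truncn (f x)).+1); [exact: growth_ge|exact: ltW].
Qed.

End Domination.

(** * The Hahn-Banach theorem *)

Section HahnBanach.
Context {R : realType} {E : lmodType R}.
Variable p : E -> R.
Hypothesis p_sub : forall u v, p (u + v) <= p u + p v.
Hypothesis p_hom : forall (t : R) u, 0 < t -> p (t *: u) = t * p u.

Let good (G : set (E * R)) : Prop :=
  (forall (t : R) u v a b, G (u, a) -> G (v, b) -> G (t *: u + v, t * a + b)) /\
  (forall u a, G (u, a) -> a <= p u).

Let p00 : p 0 = 0.
Proof.
have := p_hom 0 (ltr0n R 2 : 0 < 2 :> R); rewrite scaler0 => /eqP.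
by rewrite -subr_eq0 -[X in X - _]mul1r -mulrBl mulf_eq0 => /orP[|/eqP//]; rewrite subr_eq0 => /eqP; lra.
Qed.

Let good_fun G u a b : good G -> G (u, a) -> G (u, b) -> a = b.
Proof.
move=> [Gl Gp] ua ub; have h a' b' : G (u, a') -> G (u, b') -> a' <= b'.
  move=> ua' ub'; have := Gl (-1) u u b' a' ub' ua'.
  by rewrite scaleN1r addNr mulN1r => /Gp; rewrite p00 addrC subr_le0.
by apply/eqP; rewrite eq_le !h.
Qed.

(** Partial functionals dominated by p are represented by their graphs, so that Zorn's
    lemma applies to sets ordered by inclusion; the usual extension by one dimension
    shows that a maximal graph is total. *)
Lemma hahn_banach : exists L : E -> R,
  (forall (t : R) u v, L (t *: u + v) = t * L u + L v) /\ forall u, L u <= p u.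
Proof.
have [] := @Zorn_bigcup (E * R)%type good.
  move=> F Fg Ftot; split=> [t u v a b [A FA Aua] [B FB Bvb]|u a [A FA Aua]]; last first.
    by have [_] := Fg A FA; exact.
  have [AB|BA] := Ftot A B FA FB.
    by exists B => //; apply: (Fg B FB).1 => //; exact: AB.
  by exists A => //; apply: (Fg A FA).1 => //; exact: BA.
move=> G [[Gl Gp] Gmax].
have G00 : G (0, 0).
  apply: contrapT => nG; apply: (Gmax (G `|` [set (0, 0)])).
    split=> [[u a]|H]; first by left.
    by apply: nG; apply: H; right.
  have Gemp u a : ~ G (u, a).
    move=> ua; apply: nG; have := Gl (-1) u u a a ua ua.
    by rewrite scaleN1r addNr mulN1r addNr.
  split=> [t u v a b [/Gemp//|[-> ->]] [/Gemp//|[-> ->]]|u a [/Gemp//|[-> ->]]].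
    by right; rewrite scaler0 mulr0 !addr0.
  by rewrite p00.
have Gs t u a : G (u, a) -> G (t *: u, t * a).
  by move=> ua; have := Gl t u 0 a 0 ua G00; rewrite !addr0.
have dom u : exists a, G (u, a).
  apply: contrapT => /forallNP nu.
  (* Any value c at u between the two families of bounds c1 and c2 below keeps the graph
     under p. *)
  pose S := [set x | exists v a, G (v, a) /\ x = a - p (v - u)].
  have Sle w b : G (w, b) -> ubound S (p (w + u) - b).
    move=> wb x [v [a [va ->]]].
    have := Gl 1 v w a b va wb; rewrite scale1r mul1r => /Gp vw.
    have : p (v + w) <= p (v - u) + p (w + u).
      have -> : v + w = (v - u) + (w + u) by rewrite addrACA addNr addr0.
      exact: p_sub.
    lra.
  pose c := sup S.
  have hS : has_sup S by split; [exists (0 - p (0 - u)); exists 0, 0|exists (p (0 + u) - 0); exact: Sle].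
  have c1 v a : G (v, a) -> a - p (v - u) <= c.
    by move=> va; apply: sup_upper_bound => //; exists v, a.
  have c2 w b : G (w, b) -> c <= p (w + u) - b.
    by move=> wb; apply: ge_sup; [by have [] := hS|exact: Sle].
  pose G' := [set z : E * R | exists v a t, G (v, a) /\ z = (v + t *: u, a + t * c)].
  apply: (Gmax G').
    split=> [[v a] va|/(_ (u, c)) H].
      by exists v, a, 0; rewrite scale0r mul0r !addr0.
    by apply: (nu c); apply: H; exists 0, 0, 1; rewrite scale1r mul1r !add0r.
  split=> [t v w a b [v' [a' [s [va [-> ->]]]]] [w' [b' [s' [wb [-> ->]]]]]|v a].
    exists (t *: v' + w'), (t * a' + b'), (t * s + s'); split; first exact: Gl.
    congr pair; last by ring.
    by rewrite scalerDr scalerA scalerDl addrACA.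
  move=> [v' [a' [t [va [-> ->]]]]].
  have [t0|t0|->] := ltgtP t 0; last by rewrite scale0r mul0r !addr0; exact: Gp.
  - have s0 : 0 < - t by rewrite oppr_gt0.
    have := c1 _ _ (Gs (- t)^-1 _ _ va).
    rewrite -(ler_pM2l s0) mulrBr mulrA divff ?gt_eqF// mul1r -p_hom//.
    by rewrite scalerBr scalerA divff ?gt_eqF// scale1r scaleNr opprK; lra.
  - have := c2 _ _ (Gs t^-1 _ _ va).
    rewrite -(ler_pM2l t0) mulrBr mulrA divff ?gt_eqF// mul1r -p_hom//.
    by rewrite scalerDr scalerA divff ?gt_eqF// scale1r; lra.
have [L LG] := choice dom.
exists L; split=> [t u v|u]; last exact: Gp.
by apply: (good_fun (conj Gl Gp) (LG _)); exact: Gl.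
Qed.

End HahnBanach.

(** * The outer measure of a positive functional *)

Section FiniteSplitting.
Context {R : realType} {X : ptopologicalType}.

Definition has_bumps := forall (x : X) (U : set X), open U -> U x ->
  exists u : X -> R, [/\ continuous u, forall z, 0 <= u z, 0 < u x & forall z, u z != 0 -> U z].

Lemma continuous_bigsum (I : Type) (r : seq I) (P : pred I) (h : I -> X -> R) :
  (forall i, P i -> continuous (h i)) -> continuous (fun z => \sum_(i <- r | P i) h i z).
Proof.
move=> ch; elim: r => [|i r IHr].
  by rewrite (_ : (fun z => _) = cst 0); [exact: cst_continuous|apply/funext => z; rewrite big_nil].
rewrite (_ : (fun z => _) = if P i then h i + (fun z => \sum_(i <- r | P i) h i z) else
  (fun z => \sum_(i <- r | P i) h i z)).
  by case: ifPn => // Pi z; apply: continuousD; [exact: ch|exact: IHr].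
by apply/funext => z; rewrite big_cons; case: ifP.
Qed.

(** Plays the role of a partition of unity subordinate to the cover: finitely many bumps
    are grouped according to the member of the cover that contains their support. *)
Lemma compact_split (C : set X) (U : nat -> set X) : has_bumps -> compact C ->
  (forall i, open (U i)) -> C `<=` \bigcup_i U i ->
  exists n (v : nat -> X -> R), [/\ forall i, continuous (v i), forall i x, 0 <= v i x,
    forall i x, v i x != 0 -> U i x & forall x, C x -> exists2 i, (i < n)%N & 1 <= v i x].
Proof.
move=> bX cC oU CU.
have /choice[f Hf] : forall x, exists iw : nat * (X -> R), C x ->
    [/\ continuous iw.2, forall z, 0 <= iw.2 z, 1 < iw.2 x & forall z, iw.2 z != 0 -> U iw.1 z].
  move=> x; have [Cx|nC] := pselect (C x); last by exists (0%N, cst 0).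
  have [i _ Ux] := CU x Cx; have [u [uc u0 ux uU]] := bX x (U i) (oU i) Ux.
  exists (i, fun z => 2 / u x * u z) => _; split=> /=.
  - by move=> z; apply: (@continuousM R X (cst (2 / u x)) u z); [exact: cst_continuous|exact: uc].
  - by move=> z; rewrite mulr_ge0// divr_ge0// ltW.
  - by rewrite mulfVK ?gt_eqF// ltr1n.
  - by move=> z; rewrite mulf_eq0 negb_or => /andP[_ /uU].
move: cC; rewrite compact_cover => /(_ X C (fun x => [set z | 1 < (f x).2 z])) [].
- move=> x /Hf[fc _ _ _]; have := open_comp (f := (f x).2) (D := [set t | 1 < t]).
  by apply; [move=> z _; exact: fc|exact: open_gt].
- by move=> x Cx; exists x => //; have [] := Hf x Cx.
move=> D' D'C CD'.
have HD x : x \in finmap.enum_fset D' -> C x.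
  by move=> xD; have := D'C x xD; move/set_mem.
exists (\sum_(x <- finmap.enum_fset D') (f x).1.+1)%N.
exists (fun i z => \sum_(x <- finmap.enum_fset D' | (x \in finmap.enum_fset D') && ((f x).1 == i)) (f x).2 z).
split=> [i|i x|i x|x].
- by apply: continuous_bigsum => x /andP[/HD /Hf[]].
- by apply: sumr_ge0 => y /andP[/HD /Hf[_ + _ _] _]; exact.
- move=> /eqP sx; apply: contrapT => nU; apply: sx; apply: big1_seq => y /andP[/andP[/HD /Hf[_ _ _ fU] /eqP fi] _].
  by apply/eqP/negPn/negP => /fU; rewrite fi.
- move=> /CD'[y /= yD xy]; exists (f y).1.
    by rewrite (big_rem y)//= leq_addr.
  rewrite big_mkcond (big_rem y)//= yD eqxx/=.
  rewrite (le_trans (ltW xy))// lerDl; apply: sumr_ge0 => z _.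
  by case: ifP => // /andP[/HD /Hf[_ + _ _] _]; exact.
Qed.

End FiniteSplitting.

Section PositiveFunctional.
Context {R : realType} {X : Type}.
Variable K : set X.
Implicit Types (u v : X -> R) (A : set X).

Definition bounded_on u := exists M : R, forall x, K x -> `|u x| <= M.

(** L is defined on all functions bounded on K, as the Hahn-Banach theorem provides it.
    In particular it has values on indicator functions, which give a finitely additive
    content. *)
Record positive_functional (L : (X -> R) -> R) := PositiveFunctional {
  functional_linear : forall (t : R) u v, bounded_on u -> bounded_on v ->
    L (fun x => t * u x + v x) = t * L u + L v ;
  functional_pos : forall u, bounded_on u -> (forall x, K x -> 0 <= u x) -> 0 <= L u }.

Lemma bounded_lin (t : R) u v : bounded_on u -> bounded_on v ->
  bounded_on (fun x => t * u x + v x).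
Proof.
move=> [M Mu] [N Nv]; exists (`|t| * M + N) => x Kx.
by rewrite (le_trans (ler_normD _ _))// lerD ?Nv// normrM ler_wpM2l// Mu.
Qed.

Lemma bounded_cst (t : R) : bounded_on (cst t).
Proof. by exists `|t|. Qed.

Lemma bounded_indic A : bounded_on (\1_A).
Proof. by exists 1 => x _; rewrite indicE ger0_norm// lern1 leq_b1. Qed.

Variable L : (X -> R) -> R.
Hypothesis LP : positive_functional L.

Lemma functional0 : L (cst 0) = 0.
Proof.
have := functional_linear LP 1 (bounded_cst 0) (bounded_cst 0).
have -> : (fun x : X => 1 * cst 0 x + cst 0 x) = (cst 0 : X -> R) by apply/funext => x /=; rewrite mulr0 addr0.
by rewrite mul1r => /eqP; rewrite -subr_eq0 opprD addrA subrr sub0r oppr_eq0 => /eqP.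
Qed.

Lemma functionalZ (t : R) u : bounded_on u -> L (fun x => t * u x) = t * L u.
Proof.
move=> bu; have := functional_linear LP t bu (bounded_cst 0).
by rewrite functional0 addr0 => <-; congr L; apply/funext => x /=; rewrite addr0.
Qed.

Lemma functionalD u v : bounded_on u -> bounded_on v -> L (fun x => u x + v x) = L u + L v.
Proof.
move=> bu bv; have := functional_linear LP 1 bu bv.
by rewrite mul1r => <-; congr L; apply/funext => x; rewrite mul1r.
Qed.

Lemma functional_le u v : bounded_on u -> bounded_on v ->
  (forall x, K x -> u x <= v x) -> L u <= L v.
Proof.
move=> bu bv uv; rewrite -subr_ge0.
have -> : L v - L u = L (fun x => (-1) * u x + v x).
  by rewrite (functional_linear LP)// mulN1r addrC.
apply: (functional_pos LP) => [|x Kx]; first exact: bounded_lin.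
by rewrite mulN1r addrC subr_ge0 uv.
Qed.

Lemma functional_eq u v : bounded_on u -> (forall x, K x -> u x = v x) -> L u = L v.
Proof.
move=> bu uv; have bv : bounded_on v by have [M Mu] := bu; exists M => x Kx; rewrite -uv// Mu.
by apply/eqP; rewrite eq_le !functional_le// => x Kx; rewrite uv.
Qed.

Lemma bounded_sum (I : Type) (r : seq I) (u : I -> X -> R) : (forall i, bounded_on (u i)) ->
  bounded_on (fun x => \sum_(i <- r) u i x).
Proof.
move=> bu; elim: r => [|i r [M HM]]; first by exists 0 => x _; rewrite big_nil normr0.
have [N HN] := bu i; exists (N + M) => x Kx.
by rewrite big_cons (le_trans (ler_normD _ _))// lerD ?HN ?HM.
Qed.

Lemma functional_sum (I : Type) (r : seq I) (u : I -> X -> R) : (forall i, bounded_on (u i)) ->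
  L (fun x => \sum_(i <- r) u i x) = \sum_(i <- r) L (u i).
Proof.
move=> bu; elim: r => [|i r IHr].
  by rewrite big_nil -[RHS]functional0; congr L; apply/funext => x; rewrite big_nil.
rewrite big_cons -IHr -functionalD//; last exact: bounded_sum.
by congr L; apply/funext => x; rewrite big_cons.
Qed.

End PositiveFunctional.

Section RieszOuterMeasure.
Context {R : realType} {X : ptopologicalType}.
Variables (K : set X) (L : (X -> R) -> R).
Hypothesis LP : positive_functional K L.
Implicit Types (u v : X -> R) (A B U E : set X).

Lemma continuous_bounded u : compact K -> continuous u -> bounded_on K u.
Proof.
move=> cK cu; have [KE|/set0P K0] := eqVneq K set0; first by exists 0 => x; rewrite KE.
have [|||c Kc Hc] := @compact_EVT_max _ R (fun x => `|u x|) K.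
- exact: K0.
- exact: cK.
- apply: continuous_subspaceT => x.
  by apply: (@continuous_comp _ _ _ u); [exact: cu|exact: norm_continuous].
exists `|u c| => x Kx; apply: Hc; exact: mem_set.
Qed.

Definition content A : R := L \1_A.

Lemma content_ge0 A : 0 <= content A.
Proof. by apply: (functional_pos LP) => [|x _]; [exact: bounded_indic|rewrite indicE]. Qed.

Lemma content_le A B : (forall x, K x -> A x -> B x) -> content A <= content B.
Proof.
move=> AB; apply: (functional_le LP) => [||x Kx]; try exact: bounded_indic.
rewrite !indicE ler_nat; case: (boolP (x \in A)) => // /set_mem /(AB x Kx) /mem_set ->//.
Qed.

(** A continuous function separates A from the complement of U; this replaces compact
    containment of A in U. *)
Definition inside A U := exists u, [/\ continuous u, forall x, 0 <= u x,
  forall x, A x -> 1 <= u x & forall x, u x != 0 -> U x].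

(** The content is only finitely additive. As in the Riesz-Markov theorem, open sets are
    measured from inside, and arbitrary sets from outside by open ones. *)
Definition inner U : \bar R := ereal_sup [set (content A)%:E | A in [set A | inside A U]].

Definition outer E : \bar R := ereal_inf [set inner U | U in [set U | open U /\ E `<=` U]].

Lemma inside0 U : inside set0 U.
Proof.
by exists (cst 0); split=> // [x|x]; [exact: cst_continuous|rewrite eqxx].
Qed.

Lemma inner_ge A U : inside A U -> ((content A)%:E <= inner U)%E.
Proof. by move=> AU; apply: ereal_sup_ubound; exists A. Qed.

Lemma inner_ge0 U : (0 <= inner U)%E.
Proof. by apply: le_trans (inner_ge (inside0 U)); rewrite lee_fin content_ge0. Qed.

Lemma inner_le U U' : U `<=` U' -> (inner U <= inner U')%E.
Proof.
move=> UU; apply: le_ereal_sup => _ [A [u [uc u0 uA uU]] <-]; exists A => //.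
by exists u; split=> // x /uU/UU.
Qed.

Lemma outer_open U : open U -> outer U = inner U.
Proof.
move=> oU; apply/eqP; rewrite eq_le; apply/andP; split.
  by apply: ereal_inf_lbound; exists U => //; split.
by apply: le_ereal_inf_tmp => _ [U' [oU' UU'] <-]; exact: inner_le.
Qed.

Lemma outer_le_open E U : open U -> E `<=` U -> (outer E <= inner U)%E.
Proof. by move=> oU EU; apply: ereal_inf_lbound; exists U. Qed.

Lemma inner_content U : (inner U <= (content U)%:E)%E.
Proof.
apply: ge_ereal_sup => _ [A [u [uc u0 uA uU]] <-]; rewrite lee_fin; apply: content_le => x _ Ax.
by apply: uU; rewrite gt_eqF// (lt_le_trans _ (uA x Ax)).
Qed.

Lemma innerT : inner setT = (content setT)%:E.
Proof.
apply/eqP; rewrite eq_le inner_content/=; apply: inner_ge.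
by exists (cst 1); split=> // x; exact: cst_continuous.
Qed.

Lemma outer_mono E E' : E `<=` E' -> (outer E <= outer E')%E.
Proof.
move=> EE; apply: le_ereal_inf => _ [U [oU EU] <-]; exists U => //; split=> //.
exact: subset_trans EU.
Qed.

Lemma outer_ge0 E : (0 <= outer E)%E.
Proof. by apply: le_ereal_inf_tmp => _ [U _ <-]; exact: inner_ge0. Qed.

Lemma outer0 : outer set0 = 0%E.
Proof.
apply/eqP; rewrite eq_le outer_ge0 andbT outer_open; last exact: open0.
apply: le_trans (inner_content _) _; rewrite lee_fin /content.
by rewrite (_ : \1_set0 = cst 0) ?(functional0 LP)//; apply/funext => x; rewrite indic0.
Qed.

Hypothesis bX : @has_bumps R X.
Hypothesis cK : compact K.

(** The part of A in K is contained in the compact set where u >= 1, so finitely many of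
    the U i cover it and finite subadditivity of the content is enough. *)
Lemma inner_sigma_subadditive (U : nat -> set X) : (forall i, open (U i)) ->
  (inner (\bigcup_i U i) <= \sum_(i <oo) inner (U i))%E.
Proof.
move=> oU; apply: ge_ereal_sup => _ [A [u [uc u0 uA uU]] <-].
pose C := K `&` [set x | 1 <= u x].
have cC : compact C.
  apply: compact_closedI => //.
  by apply: (@closed_comp _ _ u [set t : R | 1 <= t]); [move=> x _; exact: uc|exact: closed_ge].
have CU : C `<=` \bigcup_i U i.
  by move=> x [_ /= ux]; apply: uU; rewrite gt_eqF// (lt_le_trans _ ux).
have [n [v [vc v0 vU vC]]] := compact_split bX cC oU CU.
pose B i := A `&` [set x | 1 <= v i x].
apply: (@le_trans _ _ (\sum_(i < n) (content (B i))%:E)%E).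
  rewrite sumEFin lee_fin /content -(functional_sum LP); last by move=> i; exact: bounded_indic.
  apply: (functional_le LP) => [||x Kx]; first exact: bounded_indic.
    by apply: bounded_sum => i; exact: bounded_indic.
  rewrite indicE; case: (boolP (x \in A)) => [/set_mem Ax|_]; last by apply: sumr_ge0 => i _; rewrite indicE.
  have [i ilt vi] := vC x (conj Kx (uA x Ax)).
  rewrite (bigD1 (Ordinal ilt))//= {1}indicE mem_set; last by split.
  by rewrite lerDl; apply: sumr_ge0 => j _; rewrite indicE.
apply: (@le_trans _ _ (\sum_(0 <= i < n) inner (U i))%E); last first.
  by apply: nneseries_lim_ge => i _ _; exact: inner_ge0.
rewrite big_mkord; apply: lee_sum => i _; apply: inner_ge.
exists (v i); split; [exact: vc|exact: v0|by move=> x []|exact: vU].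
Qed.

Lemma outer_sigma_subadditive : sigma_subadditive outer.
Proof.
move=> E; have [[i ioo]|] := pselect (exists i, outer (E i) = +oo%E).
  rewrite (eseries_pinfty _ _ ioo) ?leey// => n _.
  by rewrite -ltNye (lt_le_trans _ (outer_ge0 _)).
rewrite -forallNE => Eoo.
suff H (e : {posnum R}) : (outer (\bigcup_n E n) <= \sum_(i <oo) outer (E i) + e%:num%:E)%E.
  by apply/lee_addgt0Pr => _/posnumP[].
rewrite (le_trans _ (epsilon_trick _ _ _))//; last by move=> n; exact: outer_ge0.
have /choice[U HU] : forall n, exists U : set X, [/\ open U, E n `<=` U &
    (inner U <= outer (E n) + (e%:num / (2 ^ n.+1)%:R)%:E)%E].
  move=> n; have fn : outer (E n) \is a fin_num.
    by rewrite ge0_fin_numE ?outer_ge0// ltey; apply/eqP; exact: Eoo.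
  have en : 0 < e%:num / (2 ^ n.+1)%:R :> R by [].
  have [_ [U [oU EU] <-] lU] := lb_ereal_inf_adherent en fn.
  by exists U; split=> //; exact: ltW.
apply: (@le_trans _ _ (inner (\bigcup_n U n))).
  apply: outer_le_open; first by apply: bigcup_open => n _; have [] := HU n.
  by move=> x [n _ Enx]; exists n => //; have [_ EU _] := HU n; exact: EU.
apply: le_trans (inner_sigma_subadditive _) _; first by move=> n; have [] := HU n.
apply: lee_nneseries => [n _ _|n _]; first exact: inner_ge0.
by have [] := HU n.
Qed.

HB.instance Definition _ := isOuterMeasure.Build R X outer outer0 outer_ge0 outer_mono
  outer_sigma_subadditive.

(** Fill the part of an open Q inside U by a set A separated from its complement by u, then
    the part of Q where u < 1 by a set D: the union of A and D is inside Q. *)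
Lemma open_caratheodory U : open U -> caratheodory_measurable outer U.
Proof.
move=> oU; apply: le_caratheodory_measurable => E.
apply: le_ereal_inf_tmp => _ [Q [oQ EQ] <-].
have oQU : open (Q `&` U) by exact: openI.
apply: (@le_trans _ _ (inner (Q `&` U) + outer (E `&` ~` U))%E).
  apply: leeD2r; apply: outer_le_open => // x [Ex Ux]; split=> //; exact: EQ.
have fE : outer (E `&` ~` U) \is a fin_num.
  rewrite ge0_fin_numE ?outer_ge0//; apply: le_lt_trans (outer_mono (@subsetT _ _)) _.
  by rewrite outer_open ?innerT ?ltry//; exact: openT.
rewrite -leeBrDr//; apply: ge_ereal_sup => _ [A [u [uc u0 uA uU]] <-].
rewrite leeBrDr//.
pose W := Q `&` [set x | u x < 1].
have oW : open W.
  apply: openI => //; apply: (@open_comp _ _ u [set t : R | t < 1]); last exact: open_lt.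
  by move=> x _; exact: uc.
have EW : E `&` ~` U `<=` W.
  move=> x [Ex nUx]; split; first exact: EQ.
  by rewrite /= ltNge; apply/negP => ux; apply: nUx; apply: (uU x _).2; rewrite gt_eqF// (lt_le_trans _ ux).
apply: le_trans (leeD2l _ (outer_le_open oW EW)) _.
have fA : (content A)%:E \is a fin_num by [].
rewrite addeC -leeBrDr//; apply: ge_ereal_sup => _ [D [v [vc v0 vD vW]] <-]; rewrite leeBrDr//.
have disj x : A x -> D x -> False.
  move=> /uA ux /vD vx; have := vW x; rewrite gt_eqF ?(lt_le_trans _ vx)// => /(_ isT)[_ /=].
  by rewrite ltNge ux.
have -> : ((content D)%:E + (content A)%:E = (content (D `|` A))%:E)%E.
  rewrite -EFinD /content -(functionalD LP); try exact: bounded_indic.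
  congr EFin; congr L; apply/funext => x; rewrite !indicE in_setU -natrD.
  case: (boolP (x \in D)) => [/set_mem Dx|_]; case: (boolP (x \in A)) => [/set_mem Ax|_] //=.
  by have := disj x Ax Dx.
apply: inner_ge; exists (fun x => u x + v x); split.
- by move=> x; apply: (@continuousD _ _ _ u v x); [exact: uc|exact: vc].
- by move=> x; rewrite addr_ge0.
- by move=> x [/vD vx|/uA ux]; [rewrite (le_trans vx)// lerDr|rewrite (le_trans ux)// lerDl].
- move=> x; have [->|vx] := eqVneq (v x) 0; last by have [] := vW x vx.
  by rewrite addr0 => /uU[].
Qed.

Local Notation borel := (g_sigma_algebraType (@open X)).

Lemma open_borel U : open U -> measurable (U : set borel).
Proof. by move=> oU; exact: sub_sigma_algebra. Qed.

Lemma borel_caratheodory (A : set borel) : measurable A -> caratheodory_measurable outer A.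
Proof.
move: A; apply: smallest_sub; last by move=> U; exact: open_caratheodory.
split=> [|A mA|F mF].
- exact: caratheodory_measurable_set0.
- by rewrite setTD; exact: caratheodory_measurable_setC.
- exact: caratheodory_measurable_bigcup.
Qed.

Definition riesz_outer (A : set borel) : \bar R := outer A.

Lemma riesz_outer_sigma_additive : semi_sigma_additive riesz_outer.
Proof.
move=> F mF tF mUF; apply: (@caratheodory_measure_sigma_additive R X outer) => //.
- by move=> i; exact: borel_caratheodory.
- exact: borel_caratheodory.
Qed.

HB.instance Definition _ := isMeasure.Build _ borel R riesz_outer outer0 outer_ge0
  riesz_outer_sigma_additive.

Lemma riesz_outer_finite : fin_num_fun riesz_outer.
Proof.
apply: lty_fin_num_fun; rewrite -[X in (X < _)%E]/(outer setT) outer_open ?innerT ?ltry//; exact: openT.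
Qed.

HB.instance Definition _ := Measure_isFinite.Build _ borel R riesz_outer riesz_outer_finite.

Lemma riesz_measure : exists mu : {finite_measure set borel -> \bar R},
  forall A, mu A = outer A.
Proof. by exists riesz_outer. Qed.

End RieszOuterMeasure.

(** * Riesz representation and densities *)

Notation borel X := (g_sigma_algebraType (@open X)).

Section LayerCake.
Context {R : realType}.

Lemma count_le n (y : R) : 0 <= y -> \sum_(i < n) ((i.+1%:R < y)%R%:R : R) <= y.
Proof.
suff H : 0 <= y -> \sum_(i < n) ((i.+1%:R < y)%R%:R : R) <= y /\ \sum_(i < n) ((i.+1%:R < y)%R%:R : R) <= n%:R.
  by move=> /H[].
move=> y0; elim: n => [|n [IH1 IH2]]; first by rewrite !big_ord0.
rewrite !big_ord_recr/=; case: ltP => [ny|_].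
  have := IH2; rewrite -(lerD2r 1) natr1 => H; split=> //; exact: le_trans H (ltW ny).
by rewrite addr0; split=> //; rewrite (le_trans IH2)// ler_nat.
Qed.

Lemma count_ge n (y : R) : y <= n.+1%:R -> y <= \sum_(i < n) ((i.+1%:R < y)%R%:R : R) + 1.
Proof.
move=> yn; suff : Num.min y n.+1%:R <= \sum_(i < n) ((i.+1%:R < y)%R%:R : R) + 1 by rewrite min_l.
move: yn => _; elim: n => [|n IHn]; first by rewrite big_ord0 add0r ge_min lexx orbT.
rewrite big_ord_recr/=; case: ltP => [ny|yn].
  have := IHn; rewrite (min_r (ltW ny)) => H.
  by rewrite ge_min -natr1 lerD2r mulr1n H orbT.
by rewrite addr0; move: IHn; rewrite !min_l// (le_trans yn)// ler_nat.
Qed.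

End LayerCake.

Section RieszRepresentation.
Context {R : realType} {X : ptopologicalType} {K : set X} {L : (X -> R) -> R}.
Hypothesis LP : positive_functional K L.
Hypothesis bX : @has_bumps R X.
Hypothesis cK : compact K.
Hypothesis closedK : closed K.
Variable mu : {finite_measure set (borel X) -> \bar R}.
Hypothesis muE : forall A, mu A = outer L A.
Implicit Types u v h : X -> R.

Lemma measurable_compact : measurable (K : set (borel X)).
Proof.
rewrite -[K]setCK; apply: (@measurableC _ (borel X)); apply: open_borel; exact: closed_openC.
Qed.
Hint Resolve measurable_compact : core.

Lemma continuous_borel (D : set (borel X)) u : continuous u -> measurable D -> measurable_fun D (u : borel X -> R).
Proof.
move=> uc mD; apply: (measurability _ (RGenOpens.measurableE R)) => _ [_ [a [b ->] <-]].
apply: measurableI => //; apply: open_borel; move/continuousP: uc; apply; exact: interval_open.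
Qed.

Lemma riesz_open U : open U -> (mu U <= (content L U)%:E)%E.
Proof. by move=> oU; rewrite muE (outer_open L)// (inner_content LP). Qed.

Lemma riesz_null : mu (~` K) = 0%E.
Proof.
apply/eqP; rewrite eq_le measure_ge0 andbT (le_trans (riesz_open (closed_openC closedK)))// lee_fin.
rewrite /content -(functional0 LP); apply: (functional_le LP) => [||x Kx].
- exact: bounded_indic.
- exact: bounded_cst.
- by rewrite indicE memNset// => /(_ Kx).
Qed.

Lemma fin_measure (A : set (borel X)) : measurable A -> (fine (mu A))%:E = mu A.
Proof. by move=> mA; rewrite fineK// fin_num_measure. Qed.

Lemma riesz_mass : fine (mu K) = L (cst 1).
Proof.
apply: EFin_inj; rewrite fin_measure//.
have -> : mu K = mu setT.
  rewrite -(setUv K) measureU//; last exact: setICr.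
    by rewrite -[LHS]adde0; congr (_ + _)%E; exact/esym/riesz_null.
  exact: (@measurableC _ (borel X)).
rewrite muE (outer_open L) ?(innerT LP); last exact: openT.
by rewrite /content indicT.
Qed.

Lemma bounded_integrable (u : borel X -> R) : measurable_fun (K : set (borel X)) u -> bounded_on K u ->
  mu.-integrable K (EFin \o u).
Proof.
move=> mu_ [M HM]; apply: measurable_bounded_integrable => //.
  by rewrite -ge0_fin_numE// fin_num_measure.
exists M; split; first exact: num_real.
by move=> N MN x Kx; apply: (le_trans (HM x Kx)); exact: ltW.
Qed.

Lemma continuous_integrable u : continuous u -> mu.-integrable K (EFin \o (u : borel X -> R)).
Proof.
move=> uc; apply: bounded_integrable; last exact: continuous_bounded.
exact: continuous_borel.
Qed.

(** Approximate u from below, within 1/(n+1), by the average of the indicators of the open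
    sets {u > i/(n+1)}; the measure of an open set is at most its content. *)
Lemma riesz_unit_le u : continuous u -> (forall x, K x -> 0 <= u x <= 1) ->
  \int[mu]_(x in K) u x <= L u.
Proof.
move=> uc u01.
suff H (n : nat) : \int[mu]_(x in K) u x <= L u + n.+1%:R^-1 * L (cst 1).
  apply/ler_addgt0Pr => e e0.
  have L1 : 0 <= L (cst 1) by apply: (functional_pos LP) => //; exact: bounded_cst.
  have [n nlt] : exists n : nat, L (cst 1) / e < n%:R by exists (Num.truncn (L (cst 1) / e)).+1; rewrite truncnS_gt.
  rewrite (le_trans (H n))// lerD2l mulrC ler_pdivrMr// mulrC -ler_pdivrMr//.
  by rewrite (le_trans (ltW nlt))// ler_nat.
pose U i := [set x | i.+1%:R / n.+1%:R < u x].
have oU i : open (U i).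
  by apply: (@open_comp _ _ u [set t : R | _ < t]); [move=> x _; exact: uc|exact: open_gt].
pose s (x : X) : R := \sum_(i < n) n.+1%:R^-1 * \1_(U i) x.
have sE x : s x = n.+1%:R^-1 * \sum_(i < n) ((i.+1%:R < n.+1%:R * u x)%R%:R : R).
  rewrite /s mulr_sumr; apply: eq_bigr => i _; rewrite indicE /U; congr (_ * (nat_of_bool _)%:R).
  by apply/idP/idP; [move/set_mem => /=|move=> H; apply/mem_set => /=; move: H];
     rewrite ltr_pdivrMr// mulrC.
have bU i : bounded_on K (fun x => n.+1%:R^-1 * \1_(U i) x : R).
  have [M HM] := bounded_lin n.+1%:R^-1 (bounded_indic (R := R) K (U i)) (bounded_cst K 0).
  by exists M => x Kx; have := HM x Kx; rewrite addr0.
have bs : bounded_on K s.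
  by apply: bounded_sum => i; exact: bU.
have su x : K x -> s x <= u x.
  move=> /u01/andP[u0 u1]; rewrite sE ler_pdivrMl//; apply: count_le; exact: mulr_ge0.
have us x : K x -> u x <= s x + n.+1%:R^-1.
  move=> /u01/andP[u0 u1]; rewrite sE -[X in _ + X]mulr1 -mulrDr ler_pdivlMl//; apply: count_ge.
  by rewrite ler_piMr.
have mU i : measurable (U i : set (borel X)) by exact: open_borel.
have iU i : mu.-integrable K (EFin \o (fun x : borel X => n.+1%:R^-1 * \1_(U i) x)).
  apply: bounded_integrable.
    apply: measurable_funM; first exact: measurable_cst.
    exact: measurable_indic.
  exact: bU.
have [is_ Is] : mu.-integrable K (EFin \o (s : borel X -> R)) /\
    \int[mu]_(x in K) s x = \sum_(i < n) n.+1%:R^-1 * fine (mu (U i `&` K)).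
  rewrite /s; clear -iU mU closedK; elim: n (n.+1%:R^-1) U mU iU => [|k IHk] t U mU iU.
    rewrite big_ord0 (_ : (fun x => _) = cst 0); last by apply/funext => x; rewrite big_ord0.
    by split; [exact: integrable0|rewrite Rintegral_cst ?mul0r].
  have [IH1 IH2] := IHk t U mU iU; rewrite big_ord_recr/=.
  rewrite (_ : (fun x => _) = (fun x => (\sum_(i < k) t * \1_(U i) x) + t * \1_(U k) x)); last first.
    by apply/funext => x; rewrite big_ord_recr.
  split; first exact: (integrableD measurable_compact IH1 (iU k)).
  rewrite (RintegralD measurable_compact IH1 (iU k)) IH2; congr (_ + _).
  rewrite RintegralZl//; last first.
    apply: bounded_integrable; first exact: measurable_indic.
    exact: bounded_indic.
  by congr (_ * _); rewrite /Rintegral integral_indic.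
have ic : mu.-integrable K (EFin \o (cst n.+1%:R^-1 : borel X -> R)).
  by apply: continuous_integrable; exact: cst_continuous.
apply: (@le_trans _ _ (\int[mu]_(x in K) (s x + cst n.+1%:R^-1 x))).
  apply: le_Rintegral => //; first exact: continuous_integrable.
  exact: (integrableD measurable_compact is_ ic).
rewrite RintegralD//.
rewrite Rintegral_cst// riesz_mass lerD2r Is.
apply: (@le_trans _ _ (L s)); last by apply: (functional_le LP) => //; exact: continuous_bounded.
rewrite /s (functional_sum LP)//.
apply: ler_sum => i _; rewrite (functionalZ LP); last exact: bounded_indic.
rewrite ler_wpM2l// -lee_fin fin_measure; last exact: measurableI.
apply: le_trans (riesz_open (oU i)).
have mUK : measurable (U i `&` K : set (borel X)) by exact: measurableI.
by apply: (@le_measure _ _ _ mu); [exact/mem_set|exact/mem_set|exact: subIsetl].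
Qed.

Lemma riesz_le u : continuous u -> \int[mu]_(x in K) u x <= L u.
Proof.
move=> uc; have [M HM] := continuous_bounded cK uc.
pose N := `|M| + 1; have N0 : 0 < N by rewrite ltr_pwDr.
pose v x := (2 * N)^-1 * u x + 2^-1.
have N2 : 0 < 2 * N by rewrite mulr_gt0.
have bu := continuous_bounded cK uc.
have vc : continuous v.
  move=> x; apply: (@continuousD _ _ _ (fun x => (2 * N)^-1 * u x) (cst 2^-1) x); last exact: cst_continuous.
  by apply: (@continuousM R X (cst (2 * N)^-1) u x); [exact: cst_continuous|exact: uc].
have v01 x : K x -> 0 <= v x <= 1.
  move=> /HM Hx; have : `|u x| <= N by rewrite (le_trans Hx)// (le_trans (ler_norm M))// lerDl.
  rewrite ler_norml => /andP[h1 h2].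
  have -> : v x = (2 * N)^-1 * (u x + N) by rewrite /v; field; rewrite gt_eqF.
  by rewrite ler_pdivlMl// ler_pdivrMl// mulr0 mulr1; apply/andP; split; lra.
have := riesz_unit_le vc v01; rewrite /v (functional_linear LP)//; last exact: bounded_cst.
have ic (t : R) : mu.-integrable K (EFin \o (cst t : borel X -> R)).
  by apply: continuous_integrable; exact: cst_continuous.
have iu : mu.-integrable K (EFin \o (fun x : borel X => (2 * N)^-1 * u x)).
  apply: continuous_integrable => x.
  by apply: (@continuousM R X (cst (2 * N)^-1) u x); [exact: cst_continuous|exact: uc].
rewrite (RintegralD measurable_compact iu (ic 2^-1)) RintegralZl//; last exact: continuous_integrable.
rewrite (Rintegral_cst _ measurable_compact) riesz_mass.
have -> : L (fun=> 2^-1) = 2^-1 * L (cst 1).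
  rewrite -(functionalZ LP); last exact: bounded_cst.
  by congr L; apply/funext => x; rewrite mulr1.
by rewrite lerD2r ler_pM2l ?invr_gt0.
Qed.

(** The inequality riesz_le, applied to -u, is the reverse inequality. *)
Lemma riesz_integral u : continuous u -> \int[mu]_(x in K) u x = L u.
Proof.
move=> uc; apply/eqP; rewrite eq_le riesz_le//=.
have := @riesz_le (fun x => (-1) * u x); rewrite RintegralZl//; last exact: continuous_integrable.
rewrite (functionalZ LP); last exact: continuous_bounded.
rewrite !mulN1r lerN2; apply => x.
by apply: (@continuousM R X (cst (-1)) u x); [exact: cst_continuous|exact: uc].
Qed.

End RieszRepresentation.

Section Comparison.
Context {R : realType} {X : ptopologicalType} {K : set X} {L M : (X -> R) -> R}.
Hypothesis MP : positive_functional K M.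
Variable c : R.
Hypothesis c0 : 0 < c.
Hypothesis ML : forall u, bounded_on K u -> (forall x, K x -> 0 <= u x) -> M u <= c * L u.

Lemma outer_null E : outer L E = 0%E -> outer M E = 0%E.
Proof.
move=> LE; apply/eqP; rewrite eq_le (outer_ge0 MP) andbT.
suff : (c^-1%:E * outer M E <= outer L E)%E.
  by rewrite LE pmule_rle0// lte_fin invr_gt0.
apply: le_ereal_inf_tmp => _ [U [oU EU] <-].
rewrite lee_pdivrMl//; apply: (le_trans (outer_le_open M oU EU)).
apply: ge_ereal_sup => _ [A AU <-].
apply: (@le_trans _ _ (c%:E * (content L A)%:E)%E).
  rewrite -EFinM lee_fin; apply: ML; first exact: bounded_indic.
  by move=> x _; rewrite indicE.
by rewrite lee_pmul2l ?lte_fin//; exact: inner_ge.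
Qed.

End Comparison.

Section Densities.
Context {R : realType} {X : ptopologicalType} {K : set X} {L : (X -> R) -> R}.
Hypothesis LP : positive_functional K L.
Hypothesis bX : @has_bumps R X.
Hypothesis cK : compact K.
Hypothesis closedK : closed K.
Variable mu : {finite_measure set (borel X) -> \bar R}.
Hypothesis muE : forall A, mu A = outer L A.
Let mK : measurable (K : set (borel X)) := measurable_compact closedK.

(** M + c L is a positive functional bounded by 2c L, so its Riesz measure is absolutely
    continuous with respect to mu; subtract c from the Radon-Nikodym derivative. *)
Lemma density (M : (X -> R) -> R) (c : R) : 0 < c ->
  (forall (t : R) u v, bounded_on K u -> bounded_on K v ->
    M (fun x => t * u x + v x) = t * M u + M v) ->
  (forall u, bounded_on K u -> (forall x, K x -> 0 <= u x) -> `|M u| <= c * L u) ->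
  exists d : borel X -> R, forall u : X -> R, continuous u -> mu.-integrable K (EFin \o (fun x => u x * d x)) /\
      \int[mu]_(x in K) (u x * d x) = M u.
Proof.
move=> c0 Ml Mc.
pose N u := M u + c * L u.
have NP : positive_functional K N.
  split=> [t u v bu bv|u bu u0]; rewrite /N.
    by rewrite Ml// (functional_linear LP)//; ring.
  by have := Mc u bu u0; rewrite ler_norml => /andP[+ _]; rewrite -lerBlDr sub0r.
have [nu nuE] := riesz_measure NP bX cK.
have NL u : bounded_on K u -> (forall x, K x -> 0 <= u x) -> N u <= (c + c) * L u.
  move=> bu u0; rewrite /N mulrDl lerD2r.
  by have := Mc u bu u0; rewrite ler_norml => /andP[].
have numu : nu `<< mu.
  apply/null_content_dominatesP => A mA muA; rewrite nuE.
  by apply: (outer_null NP (addr_gt0 c0 c0) NL); rewrite -muE.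
pose e := Radon_Nikodym (charge_of_finite_measure nu) mu.
have ef x : e x \is a fin_num by exact: Radon_Nikodym_fin_num.
have ei : mu.-integrable setT e by exact: Radon_Nikodym_integrable.
pose d x : R := fine (e x) - c.
have eE : EFin \o (fine \o e) = e by apply/funext => x /=; rewrite fineK.
exists d => u uc.
have ue : mu.-integrable K (EFin \o (fun x => u x * fine (e x))).
  have := @integrableMr _ _ _ mu K mK u e; rewrite -{2}eE; apply.
  - exact: continuous_borel.
  - have [B HB] := continuous_bounded cK uc; exists B; split; first exact: num_real.
    by move=> B' BB' x Kx; apply: (le_trans (HB x Kx)); exact: ltW.
  - exact: integrableS ei.
have uci : mu.-integrable K (EFin \o (fun x : borel X => u x * c)).
  apply: continuous_integrable => // x.
  by apply: (@continuousM R X u (cst c) x); [exact: uc|exact: cst_continuous].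
have dE : (fun x : borel X => u x * d x) = (fun x => u x * fine (e x) - u x * c).
  by apply/funext => x; rewrite /d mulrBr.
rewrite dE; split; first exact: (integrableB mK ue uci).
rewrite RintegralB// RintegralZr//; last exact: continuous_integrable.
rewrite (riesz_integral LP cK closedK muE uc).
have -> : \int[mu]_(x in K) (u x * fine (e x)) = N u.
  rewrite -(riesz_integral NP cK closedK nuE uc) /Rintegral; congr fine.
  rewrite -(Radon_Nikodym_change_of_variables numu)//; last exact: continuous_integrable.
  by apply: eq_integral => x _; rewrite EFinM fineK.
by rewrite /N mulrC addrK.
Qed.

(** The hypothesis only tests h against continuous functions. To reach A, the part of U
    where h < 0, choose an open U' containing A and a continuous v supported in U' and
    equal to 1 on an open G, such that U' differs little from A and from G in measure.
    Then the integral of v h, which is nonnegative, is close to that of h over A by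
    absolute continuity of the integral, and the latter is nonpositive. *)
Lemma density_ge0 (h : borel X -> R) (U : set X) : open U -> mu.-integrable setT (EFin \o h) ->
  (forall v : X -> R, continuous v -> (forall x, 0 <= v x <= 1) -> (forall x, v x != 0 -> U x) ->
    0 <= \int[mu]_x (v x * h x)) ->
  mu (U `&` [set x | h x < 0]) = 0%E.
Proof.
move=> oU hi Hv; set A := _ `&` _.
have mh : measurable_fun setT h by apply/measurable_EFinP; exact: measurable_int hi.
have mA : measurable (A : set (borel X)).
  apply: measurableI; first exact: open_borel.
  rewrite -[X in measurable X]setTI (_ : [set x | _] = h @^-1` `]-oo, 0[%classic); last first.
    by apply/seteqP; split=> x /=; rewrite in_itv.
  by apply: mh => //; exact: measurable_itv.
have aM (B : set (borel X)) (k : borel X -> R) : measurable B -> mu.-integrable setT (EFin \o k) ->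
    mu.-integrable setT (EFin \o (fun x => \1_B x * k x)).
  move=> mB ki; apply: (@integrableMr _ _ _ mu setT measurableT (\1_B) (EFin \o k)) => //.
  exists 1; split=> // M M1 x _ /=; rewrite indicE ger0_norm//.
  by rewrite (le_trans _ (ltW M1))// lern1 leq_b1.
have intE (B : set (borel X)) (k : borel X -> R) :
    \int[mu]_(x in B) k x = \int[mu]_x (\1_B x * k x).
  by rewrite Rintegral_mkcond patch_indic; apply: eq_Rintegral => x _; rewrite /= mulrC.
have ha : mu.-integrable setT (EFin \o (fun x => `|h x|)).
  by have := integrable_abse hi; congr (_.-integrable _ _).
suff int0 : 0 <= \int[mu]_(x in A) h x.
  have hiA : mu.-integrable A (EFin \o h) by exact: integrableS hi.
  have : (\int[mu]_(x in A) `|(h x)%:E| = 0)%E.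
    apply/eqP; rewrite eq_le integral_ge0 ?andbT//.
    rewrite (_ : (\int[mu]_(x in A) _)%E = (\int[mu]_(x in A) (-1 * h x)%:E)%E); last first.
      by apply: eq_integral => x /set_mem[_ /= hx]; rewrite mulN1r ltr0_norm.
    under eq_integral do rewrite EFinM.
    rewrite integralZl//= -[X in (_ * X)%E]fineK; last exact: integral_fune_fin_num.
    by rewrite -EFinM lee_fin mulN1r oppr_le0.
  move=> /(ae_eq_integral_abs mu mA (measurable_int _ hiA)) [N [mN N0 AN]].
  apply/eqP; rewrite eq_le measure_ge0 andbT -N0.
  apply: le_measure; [exact/mem_set|exact/mem_set|].
  move=> x Ax; apply: AN => /= /(_ Ax)[] hx0; have [_ /=] := Ax.
  by rewrite hx0 ltxx.
rewrite intE; apply/ler_addgt0Pr => e e0.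
have e20 : 0 < e / 2 by rewrite divr_gt0.
(* Sets of measure less than dl contribute less than e / 2 to the integral of |h|. *)
have [dl [dl0 Hdl]] := integral_normr_continuous hi e20.
have outf : outer L A \is a fin_num by rewrite -muE fin_num_measure.
have [_ [U0 [oU0 AU0] <-] U0lt] := lb_ereal_inf_adherent dl0 outf.
pose U' := U0 `&` U.
have oU' : open U' by exact: openI.
have AU' : A `<=` U' by move=> x Ax; split; [exact: AU0|case: Ax].
have mU' : measurable (U' : set (borel X)) by exact: open_borel.
have muU' : mu U' = inner L U' by rewrite muE outer_open.
have innf : inner L U' \is a fin_num by rewrite -muU' fin_num_measure.
have [_ [E0 [w [wc w0 wE wU]] <-] E0lt] := ub_ereal_sup_adherent dl0 innf.
pose G := [set x | 2^-1 < w x].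
have oG : open G.
  by apply: (@open_comp _ _ w [set t : R | _ < t]); [move=> x _; exact: wc|exact: open_gt].
have mG : measurable (G : set (borel X)) by exact: open_borel.
have GU' : G `<=` U' by move=> x Gx; apply: wU; rewrite gt_eqF// (lt_trans _ Gx)// invr_gt0.
have w2c : continuous (fun x => 2 * w x - 1).
  move=> x; apply: (@continuousB R R^o X (fun x => 2 * w x) (cst 1) x); last exact: cst_continuous.
  by apply: (@continuousM R X (cst 2) w x); [exact: cst_continuous|exact: wc].
have EG : inside (R := R) E0 G.
  exists (fun x => Num.max (2 * w x - 1) 0); split=> [|x|x /wE wx|x].
  - by move=> x; apply: (@continuous_max R X (fun x => 2 * w x - 1) (cst 0) x); [exact: w2c|exact: cst_continuous].
  - by rewrite le_max lexx orbT.
  - by rewrite le_max; apply/orP; left; lra.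
  - move=> /eqP mx; rewrite /G /= ltNge; apply/negP => wx; apply: mx.
    by rewrite max_r//; lra.
have fA : mu A \is a fin_num by exact: fin_num_measure.
have mD (B : set (borel X)) : measurable B -> (mu (U' `\` B) = mu U' - mu (U' `&` B))%E.
  by move=> mB; apply: measureD => //; rewrite -ge0_fin_numE// fin_num_measure.
have m1 : (mu (U' `\` A) < dl%:E)%E.
  rewrite mD//.
  rewrite (_ : U' `&` A = A); last by apply/setIidPr.
  rewrite lteBlDr// muU' muE addeC; apply: le_lt_trans U0lt.
  by apply: inner_le; exact: subIsetl.
have m2 : (mu (U' `\` G) < dl%:E)%E.
  rewrite mD//.
  rewrite (_ : U' `&` G = G); last by apply/setIidPr.
  have fG : mu G \is a fin_num by exact: fin_num_measure.
  rewrite lteBlDr// muU' [mu G]muE outer_open//.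
  rewrite -lteBlDl//; apply: lt_le_trans E0lt _; exact: inner_ge.
have I1 := Hdl _ (measurableD mU' mA) m1.
have I2 := Hdl _ (measurableD mU' mG) m2.
pose v x := Num.min (2 * w x) 1.
have vc : continuous v.
  move=> x; apply: (@continuous_min R X (fun x => 2 * w x) (cst 1) x); last exact: cst_continuous.
  by apply: (@continuousM R X (cst 2) w x); [exact: cst_continuous|exact: wc].
have v01 x : 0 <= v x <= 1 by rewrite /v le_min ge_min lexx orbT ler01 mulr_ge0.
have vU' x : v x != 0 -> U' x.
  move=> vx; apply: wU; apply: contraNneq vx => wx.
  by rewrite /v wx mulr0 min_l.
have vG x : G x -> v x = 1.
  by rewrite /G /v /= => Gx; rewrite min_r//; lra.
have := Hv v vc v01 (fun x vx => (vU' x vx).2).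
pose k x := \1_A x * h x + (\1_(U' `\` A) x * `|h x| + \1_(U' `\` G) x * `|h x|).
have i1 := aM _ _ mA hi.
have i2 := aM _ _ (measurableD mU' mA) ha.
have i3 := aM _ _ (measurableD mU' mG) ha.
have i23 := integrableD measurableT i2 i3.
have vk : \int[mu]_x (v x * h x) <= \int[mu]_x k x.
  apply: le_Rintegral => //.
  - apply: (@integrableMr _ _ _ mu setT measurableT v (EFin \o h)) => //.
      exact: continuous_borel.
    exists 1; split=> // M M1 x _ /=; have /andP[v0 v1] := v01 x.
    by rewrite ger0_norm// (le_trans v1)// ltW.
  - exact: (integrableD measurableT i1 i23).
  - move=> x _; rewrite /k; have /andP[v0 v1] := v01 x.
    have n0 := normr_ge0 (h x).
    have vh : v x * h x <= `|h x|.
      by rewrite (le_trans (ler_norm _))// normrM (ger0_norm v0) ler_piMl.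
    rewrite !indicE.
    have [Ux|nU] := pselect (U' x); last first.
      have -> : v x = 0 by apply/eqP; apply: contrapT => /negP /vU'.
      rewrite mul0r [x \in A]memNset; last by move/AU'.
      by rewrite mul0r add0r addr_ge0// mulr_ge0.
    have [Ax|nA] := pselect (A x); last first.
      rewrite [x \in A]memNset// mul0r add0r (_ : x \in U' `\` A); last by apply/mem_set.
      by rewrite mul1r (le_trans vh)// lerDl mulr_ge0.
    rewrite [x \in A]mem_set// mul1r (_ : x \in U' `\` A = false); last by apply/memNset => -[].
    rewrite mul0r add0r.
    have [Gx|nG] := pselect (G x); first by rewrite vG// mul1r lerDl mulr_ge0.
    rewrite (_ : x \in U' `\` G); last by apply/mem_set.
    have [_ /= hx] := Ax.
    rewrite mul1r (ltr0_norm hx) subrr; apply: mulr_ge0_le0 => //; exact: ltW.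
move=> H0; have := le_trans H0 vk; rewrite /k (RintegralD measurableT i1 i23) (RintegralD measurableT i2 i3).
rewrite -!intE; move: I1 I2; lra.
Qed.

End Densities.

(** * Convex hulls of compact sets *)

Section ConvexHulls.
Context {R : realType} {N : nat}.
Implicit Types (P : set 'rV[R]_N) (v w d c : 'rV[R]_N).

Definition combination P m v := exists (t : 'I_m -> R) (w : 'I_m -> 'rV[R]_N),
  [/\ forall i, 0 <= t i, \sum_i t i = 1, forall i, P (w i) & v = \sum_i t i *: w i].

(** More than N + 1 points have an affine dependency a. Moving the weights along a until
    the first of them vanishes removes a point. *)
Lemma caratheodory_step P m v : (N < m)%N -> combination P m.+1 v -> combination P m v.
Proof.
move=> Nm [t [w [t0 t1 Pw vE]]].
pose A := \matrix_(i < m.+1) row_mx (w i) (1 : 'rV[R]_1).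
have : kermx A != 0.
  rewrite kermx_eq0; apply/negP => /eqP rA.
  by have := rank_leq_col A; rewrite rA addn1 ltnNge Nm.
case/rowV0Pn => a /sub_kermxP aA a0.
have aw : \sum_i a 0 i *: row_mx (w i) (1 : 'rV[R]_1) = 0.
  transitivity (a *m A); last exact: aA.
  by rewrite mulmx_sum_row; apply: eq_bigr => i _; rewrite rowK.
have a1 : \sum_i a 0 i = 0.
  have := congr1 (fun M : 'rV[R]_(N + 1) => M 0 (rshift N ord0)) aw; rewrite summxE [RHS]mxE => E; rewrite -[RHS]E.
  by apply: eq_bigr => i _; rewrite mxE row_mxEr mxE eqxx mulr1.
have a2 : \sum_i a 0 i *: w i = 0.
  have := congr1 (fun M => lsubmx M) aw; rewrite linear_sum/= linear0 => E; rewrite -[RHS]E.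
  by apply: eq_bigr => i _; rewrite linearZ/= row_mxKl.
have [j aj] : exists j, 0 < a 0 j.
  apply: contrapT => /forallNP an; case/negP: a0; apply/eqP/rowP => i; rewrite mxE.
  have ai k : 0 <= - a 0 k by rewrite oppr_ge0 leNgt; apply/negP/an.
  have /eqP : \sum_k - a 0 k = 0 by rewrite sumrN a1 oppr0.
  rewrite psumr_eq0// => /allP/(_ i); rewrite mem_index_enum => /(_ isT)/=.
  by rewrite oppr_eq0 => /eqP.
case: (@arg_minP _ _ _ j (fun i => 0 < a 0 i) (fun i => t i / a 0 i) aj) => i0 ai0 imin.
pose s := t i0 / a 0 i0.
have s0 : 0 <= s by rewrite divr_ge0// ltW.
have t' i : 0 <= t i - s * a 0 i.
  rewrite subr_ge0; have [ai|ai] := ltP 0 (a 0 i).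
    by rewrite -ler_pdivlMr//; exact: imin.
  by rewrite (le_trans _ (t0 i))// mulr_ge0_le0.
have ti0 : t i0 - s * a 0 i0 = 0 by rewrite /s divfK ?subrr// gt_eqF.
exists (fun k => t (lift i0 k) - s * a 0 (lift i0 k)), (fun k => w (lift i0 k)); split=> //.
- have : \sum_i (t i - s * a 0 i) = 1 by rewrite sumrB t1 -mulr_sumr a1 mulr0 subr0.
  by rewrite (bigD1_ord i0)//= ti0 add0r.
- have : \sum_i (t i - s * a 0 i) *: w i = v.
    under eq_bigr do rewrite scalerBl -scalerA.
    by rewrite sumrB -scaler_sumr a2 scaler0 subr0.
  by rewrite (bigD1_ord i0)//= ti0 scale0r add0r => <-.
Qed.

Lemma caratheodory P v : convex_hull P v -> exists2 m, (m <= N)%N & combination P m.+1 v.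
Proof.
move=> [m]; elim: m => [|m IHm].
  by move=> [t [w [_ t1 _ _]]]; move/eqP: t1; rewrite big_ord0 eq_sym oner_eq0.
have [mN|Nm] := leqP m N; first by exists m.
by move=> /(caratheodory_step Nm).
Qed.

(** Joining with P one point at a time exhibits the hull as an iterated image of compact
    sets. *)
Fixpoint iterated_join P k : set 'rV[R]_N := if k is k'.+1 then
  [set z | exists s x y, [/\ 0 <= s <= 1, iterated_join P k' x, P y & z = x + s *: (y - x)]] else P.

Lemma iterated_join_compact P k : compact P -> compact (iterated_join P k).
Proof.
move=> cP; elim: k => [//|k IHk] /=.
pose f (z : R * ('rV[R]_N * 'rV[R]_N)) := z.2.1 + z.1 *: (z.2.2 - z.2.1).
have := @continuous_compact _ _ f (`[0, 1]%classic `*` (iterated_join P k `*` P)).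
have -> : f @` (`[0, 1]%classic `*` (iterated_join P k `*` P)) =
    [set z | exists s x y, [/\ 0 <= s <= 1, iterated_join P k x, P y & z = x + s *: (y - x)]].
  apply/seteqP; split=> z.
    move=> [[s [x y]] [/= s01 [Qx Py]] <-]; by exists s, x, y; split=> //; rewrite -in_itv.
  move=> [s [x [y [s01 Qx Py ->]]]]; exists (s, (x, y)) => //.
apply.
  apply: continuous_subspaceT => z; rewrite /f.
  have c1 : {for z, continuous (fun z : R * ('rV[R]_N * 'rV[R]_N) => z.2.1)}.
    by apply: continuous_comp; [exact: cvg_snd|exact: cvg_fst].
  have c2 : {for z, continuous (fun z : R * ('rV[R]_N * 'rV[R]_N) => z.2.2)}.
    by apply: continuous_comp; [exact: cvg_snd|exact: cvg_snd].
  apply: cvgD; first exact: c1.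
  apply: cvgZ; first exact: cvg_fst.
  by apply: cvgB; [exact: c2|exact: c1].
apply: compact_setX; first exact: segment_compact.
exact: compact_setX.
Qed.

Lemma sub_iterated_join P k : P `<=` iterated_join P k.
Proof.
elim: k => [//|k IHk] x Px; exists 0, x, x.
by rewrite lexx ler01 subrr scaler0 addr0; split=> //; exact: IHk.
Qed.

Lemma iterated_join_le P k l : (k <= l)%N -> iterated_join P k `<=` iterated_join P l.
Proof.
elim: l => [|l IHl]; first by rewrite leqn0 => /eqP->.
rewrite leq_eqVlt => /orP[/eqP->//|kl] x /(IHl kl) Qx.
case: l Qx {IHl kl} => [|l] Qx.
  by apply: sub_iterated_join.
have : exists y, P y by elim: l.+1 x Qx => [|k' IH] x; [exists x|move=> [_ [_ [y [_ _ ? _]]]]; exists y].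
by move=> [y Py]; exists 0, x, y; rewrite lexx ler01 scale0r addr0.
Qed.

Lemma combination_join P m v : combination P m.+1 v -> iterated_join P m v.
Proof.
elim: m v => [|m IHm] v [t [w [t0 t1 Pw ->]]].
  by move: t1; rewrite !big_ord1 => ->; rewrite scale1r; exact: Pw.
move: t1; rewrite big_ord_recr [in X in _ -> _ _ X]big_ord_recr /=; set s := t ord_max => t1.
have s0 : 0 <= s := t0 _.
have [sE|s1] := eqVneq s 1.
  have T0 : \sum_(i < m.+1) t (widen_ord (leqnSn m.+1) i) = 0.
    by move: t1; rewrite sE => /eqP; rewrite -subr_eq0 addrK => /eqP.
  have ti i : t (widen_ord (leqnSn m.+1) i) = 0.
    move/eqP: T0; rewrite psumr_eq0// => /allP/(_ i); rewrite mem_index_enum.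
    by move=> /(_ isT)/eqP.
  rewrite big1 ?add0r; last by move=> i _; rewrite ti scale0r.
  rewrite sE scale1r; exact: (@sub_iterated_join P m.+1).
have s1' : s < 1 by rewrite lt_neqAle s1/= -t1 lerDr sumr_ge0.
pose x := \sum_(i < m.+1) (t (widen_ord (leqnSn m.+1) i) / (1 - s)) *: w (widen_ord (leqnSn m.+1) i).
have d0 : 1 - s != 0 by rewrite subr_eq0 eq_sym.
exists s, x, (w ord_max); split=> //.
- by rewrite s0 ltW.
- apply: IHm; exists (fun i => t (widen_ord (leqnSn m.+1) i) / (1 - s)), (fun i => w (widen_ord (leqnSn m.+1) i)).
  split=> // [i|]; first by rewrite divr_ge0// subr_ge0 ltW.
  by rewrite -mulr_suml -[X in X / _](addrK s) t1 divff.
- rewrite scalerBr addrCA addrC; congr (_ + _).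
  rewrite -[X in X - _]scale1r -scalerBl /x scaler_sumr; apply: eq_bigr => i _.
  by rewrite scalerA mulrCA divff// mulr1.
Qed.

Lemma join_hull P k : iterated_join P k `<=` convex_hull P.
Proof.
elim: k => [|k IHk] z /=.
  by exists 1%N, (fun=> 1), (fun=> z); split=> //; rewrite ?big_ord1// scale1r.
move=> [s [x [y [/andP[s0 s1] /IHk[m [t [w [t0 t1 Pw xE]]]] Py ->]]]].
exists m.+1, (fun i => if unlift ord0 i is Some j then (1 - s) * t j else s),
  (fun i => if unlift ord0 i is Some j then w j else y); split.
- by move=> i; case: (unlift ord0 i) => [j|]//; rewrite mulr_ge0// subr_ge0.
- rewrite big_ord_recl unlift_none; under eq_bigr do rewrite liftK.
  by rewrite -mulr_sumr t1 mulr1 addrC subrK.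
- by move=> i; case: (unlift ord0 i).
- rewrite big_ord_recl unlift_none; under eq_bigr do rewrite liftK -scalerA.
  by rewrite -scaler_sumr -xE scalerBl scale1r scalerBr addrCA.
Qed.

Lemma convex_hullE P : convex_hull P = iterated_join P N.
Proof.
apply/seteqP; split; last exact: join_hull.
by move=> v /caratheodory[m mN /combination_join]; exact: iterated_join_le.
Qed.

Lemma convex_hull_compact P : compact P -> compact (convex_hull P).
Proof. by rewrite convex_hullE; exact: iterated_join_compact. Qed.

Lemma convex_hull_segment P (s : R) x y : 0 <= s <= 1 -> convex_hull P x -> convex_hull P y ->
  convex_hull P (x + s *: (y - x)).
Proof.
move=> /andP[s0 s1] [m [t [w [t0 t1 Pw xE]]]] [m' [t' [w' [t0' t1' Pw' yE]]]].
exists (m + m')%N, (fun i => match fintype.split i with inl j => (1 - s) * t j | inr j => s * t' j end),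
  (fun i => match fintype.split i with inl j => w j | inr j => w' j end); split.
- by move=> i; case: (fintype.split i) => j; rewrite mulr_ge0// subr_ge0.
- rewrite big_split_ord/=; under eq_bigr do rewrite (unsplitK (inl _)).
  under [X in _ + X]eq_bigr do rewrite (unsplitK (inr _)).
  by rewrite -!mulr_sumr t1 t1' !mulr1 subrK.
- by move=> i; case: (fintype.split i).
- rewrite big_split_ord/=; under eq_bigr do rewrite (unsplitK (inl _)) -scalerA.
  under [X in _ = _ + X]eq_bigr do rewrite (unsplitK (inr _)) -scalerA.
  by rewrite -!scaler_sumr -xE -yE scalerBl scale1r scalerBr addrAC addrA.
Qed.

Definition dotp c w := \sum_i c 0 i * w 0 i.

Lemma dotp_continuous c : continuous (dotp c).
Proof.
apply: continuous_bigsum => i _ w.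
by apply: (@continuousM R _ (cst (c 0 i)) (fun w : 'rV[R]_N => w 0 i) w);
  [exact: cst_continuous|exact: coord_continuous].
Qed.

(** The normal is z - d for the point z of the hull closest to d. *)
Lemma separation P d : compact P -> ~ convex_hull P d ->
  exists c (r : R), dotp c d < r /\ forall w, P w -> r < dotp c w.
Proof.
move=> cP nd; have [P0|/set0P P0] := eqVneq P set0.
  exists 0, 1; split=> [|w]; last by rewrite P0.
  by rewrite /dotp big1 ?ltr01// => i _; rewrite mxE mul0r.
have PH : P `<=` convex_hull P by move=> x Px; apply: (@join_hull P 0).
pose f v := \sum_i (v 0 i - d 0 i) ^+ 2.
have fc : continuous f.
  apply: continuous_bigsum => i _ v.
  have c1 : {for v, continuous (fun v : 'rV[R]_N => v 0 i - d 0 i)}.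
    by apply: (@continuousB R R^o _ (fun v : 'rV[R]_N => v 0 i) (cst (d 0 i)) v);
      [exact: coord_continuous|exact: cst_continuous].
  exact: (continuousM c1 c1).
have [||z /set_mem Hz zmin] := @compact_EVT_min _ R f (convex_hull P) _ (convex_hull_compact cP).
- by have [x Px] := P0; exists x; exact: PH.
- exact: continuous_subspaceT.
pose c := z - d.
have c0 : 0 < dotp c c.
  rewrite lt_neqAle; apply/andP; split; last by apply: sumr_ge0 => i _; rewrite -expr2 sqr_ge0.
  apply/negP => /eqP/esym/eqP; rewrite psumr_eq0; last by move=> i _; rewrite -expr2 sqr_ge0.
  move=> /allP H; apply: nd; suff <- : z = d by [].
  apply/rowP => i; have := H i (mem_index_enum _).
  by rewrite /= -expr2 sqrf_eq0 !mxE subr_eq0 => /eqP.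
have dB u v : dotp c (u - v) = dotp c u - dotp c v.
  by rewrite /dotp -sumrB; apply: eq_bigr => i _; rewrite !mxE mulrBr.
have key w : P w -> 0 <= dotp c (w - z).
  move=> Pw; rewrite leNgt; apply/negP => neg.
  pose q := dotp (w - z) (w - z).
  have q0 : 0 <= q by apply: sumr_ge0 => i _; rewrite -expr2 sqr_ge0.
  have fE (s : R) : f (z + s *: (w - z)) = f z + s * (2 * dotp c (w - z) + s * q).
    rewrite /f /dotp /q /dotp !mulr_sumr -big_split/= mulr_sumr -big_split/=.
    by apply: eq_bigr => i _; rewrite !mxE; ring.
  pose s := Num.min 1 (- dotp c (w - z) / (q + 1)).
  have q1 : 0 < q + 1 by rewrite ltr_pwDr.
  have s0 : 0 < s by rewrite lt_min ltr01 divr_gt0// oppr_gt0.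
  have sq : s * q <= - dotp c (w - z).
    have H : s * (q + 1) <= - dotp c (w - z) by rewrite -ler_pdivlMr// ge_min lexx orbT.
    by rewrite (le_trans _ H)// ler_wpM2l ?lerDl// ltW.
  have := zmin (z + s *: (w - z)).
  rewrite fE lerDl; rewrite mem_set; last first.
    by apply: convex_hull_segment; [rewrite ltW//= ge_min lexx|exact: Hz|exact: PH].
  move=> /(_ isT); rewrite pmulr_rge0// => H; move: H sq neg; lra.
exists c, (dotp c d + dotp c c / 2); split; first by rewrite ltrDl divr_gt0.
move=> w /key; have : dotp c z = dotp c d + dotp c c by rewrite {3}/c dB addrC subrK.
by rewrite (dB w z) => E; rewrite E; move: c0; lra.
Qed.

Lemma coord_le_norm w i : `|w 0 i| <= `|w|.
Proof.
by rewrite [leRHS]/Num.Def.normr/= mx_normrE; apply: le_trans; last exact: (le_bigmax _ _ (0, i)).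
Qed.

(** There are countably many half-spaces with rational coefficients, so that null sets
    attached to them can be united. *)
Lemma rational_separation P d : compact P -> ~ convex_hull P d ->
  exists (c : 'rV[rat]_N) (r : rat), dotp (map_mx ratr c) d < ratr r /\
    forall w, P w -> ratr r < dotp (map_mx ratr c) w.
Proof.
move=> cP nd; have [c [r [cd cw]]] := separation cP nd.
have [B [B0 [HB Hd]]] : exists B : R, 0 < B /\ (forall w, P w -> forall i, `|w 0 i| <= B) /\ forall i, `|d 0 i| <= B.
  have [M [_ HM]] := compact_bounded cP.
  exists (`|M| + 1 + `|d|); split; first by rewrite ltr_pwDl// ltr_pwDr.
  split=> [w Pw i|i].
    rewrite (@le_trans _ _ `|w|)//; first exact: coord_le_norm.
    by rewrite (@le_trans _ _ (`|M| + 1))// ?lerDl//; apply: HM => //; rewrite ltr_pwDr// ler_norm.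
  rewrite (@le_trans _ _ `|d|)//; first exact: coord_le_norm.
  by rewrite lerDr addr_ge0.
(* By compactness of P the strict inequalities hold with a uniform margin e. *)
have [e [e0 ecd ecw]] : exists e : R, [/\ 0 < e, dotp c d + e <= r & forall w, P w -> r + e <= dotp c w].
  have [P0|/set0P P0] := eqVneq P set0.
    by exists (r - dotp c d); split; [rewrite subr_gt0|rewrite addrC subrK|rewrite P0].
  have [w0 /set_mem Pw0 wmin] := @compact_EVT_min _ R (dotp c) P P0 cP (continuous_subspaceT (@dotp_continuous c)).
  exists (Num.min (r - dotp c d) (dotp c w0 - r)); split.
  - by rewrite lt_min !subr_gt0 cd cw.
  - by rewrite -lerBrDl ge_min lexx.
  - move=> w Pw; rewrite -lerBrDl ge_min; apply/orP; right; rewrite lerD2r; apply: wmin; exact: mem_set.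
pose h := e / (3 * (N.+1%:R * B)).
have NB : 0 < N.+1%:R * B by rewrite mulr_gt0.
have h0 : 0 < h by rewrite divr_gt0// mulr_gt0.
have /choice[q Hq] : forall i, exists q : rat, `|ratr q - c 0 i| <= h.
  move=> i; have [q] := @rat_in_itvoo R (c 0 i - h) (c 0 i + h) ltac:(lra).
  rewrite in_itv/= => /andP[h1 h2]; exists q; rewrite ler_norml; apply/andP; split; lra.
have [r' Hr'] := @rat_in_itvoo R (r - e / 3) (r + e / 3) ltac:(lra).
exists (\row_i q i), r'.
have close w : (forall i, `|w 0 i| <= B) -> `|dotp (map_mx ratr (\row_i q i)) w - dotp c w| <= e / 3.
  move=> wB; rewrite /dotp -sumrB (le_trans (ler_norm_sum _ _ _))//.
  apply: (@le_trans _ _ (\sum_(i < N) h * B)).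
    apply: ler_sum => i _; rewrite !mxE -mulrBl normrM; apply: ler_pM => //.
  rewrite sumr_const card_ord -[leLHS]mulr_natr.
  apply: (@le_trans _ _ (h * B * N.+1%:R)); first by rewrite ler_wpM2l ?ler_nat//; apply: mulr_ge0; exact: ltW.
  rewrite le_eqVlt; apply/orP; left; apply/eqP; rewrite /h; field.
  by rewrite !gt_eqF.
move: Hr'; rewrite in_itv/= => /andP[r1 r2]; split.
  by have := close d Hd; rewrite ler_norml => /andP[_ h2]; move: e0 ecd; lra.
move=> w Pw; have := close w (HB w Pw); rewrite ler_norml => /andP[h1 _].
have := ecw w Pw; move: e0; lra.
Qed.

End ConvexHulls.

(** * Extending a functional to a compactly supported one *)

Section LocallyBounded.
Context {R : realType} {A : Type} (D : set A) (f : A -> R).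

Definition locally_bounded (u : A -> R) :=
  forall k : nat, bounded_on (D `&` [set z | f z <= k%:R]) u.

Definition locbdd_pred : {pred A -> R^o} := fun u => `[< locally_bounded u >].

Record locbdd := Locbdd { locbdd_val :> A -> R^o ; _ : locbdd_val \in locbdd_pred }.

HB.instance Definition _ := [isSub for locbdd_val].
HB.instance Definition _ := [Choice of locbdd by <:].

Lemma locally_bounded_lin (t : R) u v : locally_bounded u -> locally_bounded v ->
  locally_bounded (fun z => t * u z + v z).
Proof. by move=> bu bv k; apply: bounded_lin. Qed.

Lemma locbdd_submod_closed : GRing.subsemimod_closed locbdd_pred.
Proof.
have b0 : locally_bounded (0 : A -> R^o) by move=> k; exact: (bounded_cst _ 0).
split; first split.
- exact/asboolP.
- move=> u v /asboolP bu /asboolP bv; apply/asboolP.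
  have := locally_bounded_lin 1 bu bv; congr locally_bounded.
  by apply/funext => z; rewrite mul1r.
- move=> t u /asboolP bu; apply/asboolP.
  have := locally_bounded_lin t bu b0; congr locally_bounded.
  by apply/funext => z; rewrite addr0.
Qed.

HB.instance Definition _ := GRing.isSubmodClosed.Build R (A -> R^o) locbdd_pred
  locbdd_submod_closed.
HB.instance Definition _ := [SubChoice_isSubLmodule of locbdd by <:].

Lemma locbddP (u : locbdd) : locally_bounded u.
Proof. by case: u => u /= /asboolP. Qed.

Lemma locbdd_ext (u v : locbdd) : (forall z, u z = v z) -> u = v.
Proof. by move=> uv; apply/val_inj/funext. Qed.

Lemma locbddDE (u v : locbdd) z : (u + v) z = u z + v z.
Proof. by []. Qed.

Lemma locbddZE (t : R) (u : locbdd) z : (t *: u) z = t * u z.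
Proof. by []. Qed.

Lemma locbddNE (u : locbdd) z : (- u) z = - u z.
Proof. by []. Qed.

Lemma locally_bounded_sum n (h : 'I_n -> A -> R) : (forall i, locally_bounded (h i)) ->
  locally_bounded (fun z => \sum_i h i z).
Proof. by move=> bh k; apply: bounded_sum => i; exact: bh. Qed.

End LocallyBounded.

Section CompactExtension.
Context {R : realType} {A : Type} (D : set A) (f : A -> R).
Context {G : lmodType R} (dG : G -> A -> R) (S : G -> R).
Hypothesis dG_lin : forall (t : R) a b z, dG (t *: a + b) z = t * dG a z + dG b z.
Hypothesis S_lin : forall (t : R) a b, S (t *: a + b) = t * S a + S b.
Hypothesis S_pos : forall a, (forall z, D z -> 0 <= dG a z) -> 0 <= S a.
Hypothesis dG_bounded : forall a, locally_bounded D f (dG a).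
Hypothesis dG_dominates : forall u, locally_bounded D f u ->
  exists a, forall z, D z -> u z <= dG a z.
Local Notation E := (locbdd D f).

Let S0 : S 0 = 0.
Proof.
have := S_lin 1 0 0; rewrite scaler0 addr0 mul1r => /eqP.
by rewrite -subr_eq0 opprD addrA subrr sub0r oppr_eq0 => /eqP.
Qed.

Let SD a b : S (a + b) = S a + S b.
Proof. by rewrite -[a]scale1r S_lin mul1r scale1r. Qed.

Let SZ (t : R) a : S (t *: a) = t * S a.
Proof. by rewrite -[t *: a]addr0 S_lin S0 !addr0. Qed.

Let dG0 z : dG 0 z = 0.
Proof.
have := dG_lin 1 0 0 z; rewrite scaler0 addr0 mul1r => /eqP.
by rewrite -subr_eq0 opprD addrA subrr sub0r oppr_eq0 => /eqP.
Qed.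

Let dGD a b z : dG (a + b) z = dG a z + dG b z.
Proof. by rewrite -[a]scale1r dG_lin mul1r scale1r. Qed.

Let dGZ (t : R) a z : dG (t *: a) z = t * dG a z.
Proof. by rewrite -[t *: a]addr0 dG_lin dG0 !addr0. Qed.

Definition majorants (u : A -> R) := [set S a | a in [set a | forall z, D z -> u z <= dG a z]].

(** The sublinear functional to be extended: L <= upper_value makes L positive and forces
    the value S a on dG a. *)
Definition upper_value (u : E) := inf (majorants u).

Let majorants_nonempty (u : E) : majorants u !=set0.
Proof. by have [a Ha] := dG_dominates (locbddP u); exists (S a), a. Qed.

Let majorants_bounded (u : E) : has_lbound (majorants u).
Proof.
have [b Hb] := dG_dominates (locbddP (- u)).
exists (- S b) => _ [a Ha <-]; rewrite -subr_ge0 opprK -SD; apply: (S_pos (a := a + b)) => z Dz.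
rewrite dGD -(addrN (u z)); apply: lerD; [exact: Ha|exact: Hb].
Qed.

Let upper_le (u : E) a : (forall z, D z -> u z <= dG a z) -> upper_value u <= S a.
Proof. by move=> Ha; apply: ge_inf; [exact: majorants_bounded|exists a]. Qed.

Let upper_sub (u v : E) : upper_value (u + v) <= upper_value u + upper_value v.
Proof.
rewrite -lerBlDr; apply: lb_le_inf => // _ [a Ha <-].
rewrite lerBlDr -lerBlDl; apply: lb_le_inf => // _ [b Hb <-].
by rewrite lerBlDl -SD; apply: upper_le => z Dz; rewrite dGD lerD ?Ha ?Hb.
Qed.

Let upper_hom_le (t : R) (u : E) : 0 < t -> upper_value (t *: u) <= t * upper_value u.
Proof.
move=> t0; rewrite -ler_pdivrMl//; apply: lb_le_inf => // _ [a Ha <-].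
rewrite ler_pdivrMl// -SZ; apply: upper_le => z Dz.
by rewrite dGZ; apply: ler_wpM2l (Ha z Dz); exact: ltW.
Qed.

Let upper_hom (t : R) (u : E) : 0 < t -> upper_value (t *: u) = t * upper_value u.
Proof.
move=> t0; apply/eqP; rewrite eq_le upper_hom_le//=.
have ti : 0 < t^-1 by rewrite invr_gt0.
have := upper_hom_le (t *: u) ti; rewrite scalerA mulVf ?gt_eqF// scale1r.
by rewrite ler_pdivlMl.
Qed.

(** For the support: if for every k some u_k vanishing on {f <= k} had L(u_k) > 0, the sum
    of the u_k / L(u_k) would be locally finite, hence locally bounded, while L takes on it
    a value larger than every integer. *)
Lemma compact_extension : exists (k : nat) (L : (A -> R) -> R),
  positive_functional (D `&` [set z | f z <= k%:R]) L /\ forall a, L (dG a) = S a.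
Proof.
have [L [Ll Lp]] := hahn_banach upper_sub upper_hom.
have L0 : L 0 = 0.
  have := Ll 1 0 0; rewrite scaler0 addr0 mul1r => /eqP.
  by rewrite -subr_eq0 opprD addrA subrr sub0r oppr_eq0 => /eqP.
have LZ (t : R) u : L (t *: u) = t * L u by rewrite -[t *: u]addr0 Ll L0 !addr0.
have LB u v : L (v - u) = L v - L u by rewrite addrC -scaleN1r Ll mulN1r addrC.
have Lpos (u : E) : (forall z, D z -> 0 <= u z) -> 0 <= L u.
  move=> u0; rewrite -oppr_le0 -mulN1r -LZ; apply: le_trans (Lp _) _.
  rewrite -[leRHS]S0; apply: upper_le => z Dz.
  by rewrite dG0 locbddZE mulN1r oppr_le0 u0.
have Lle (u v : E) : (forall z, D z -> u z <= v z) -> L u <= L v.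
  move=> uv; rewrite -subr_ge0 -LB; apply: Lpos => z Dz.
  by rewrite locbddDE locbddNE subr_ge0; exact: uv.
pose dE a : E := Locbdd (asboolT (dG_bounded a)).
have LdG a : L (dE a) = S a.
  have le1 b : L (dE b) <= S b by apply: le_trans (Lp _) _; exact: upper_le.
  have dEN : dE (-1 *: a) = -1 *: dE a.
    by apply: locbdd_ext => z; rewrite locbddZE; exact: dGZ.
  have := le1 (-1 *: a); rewrite dEN LZ SZ !mulN1r lerN2 => le2.
  by apply/eqP; rewrite eq_le le1.
have [k Hk] : exists k : nat, forall u : E, (forall z, D z -> f z <= k%:R -> u z = 0) -> L u = 0.
  apply: contrapT => /forallNP H.
  have /choice[u Hu] : forall k : nat, exists u : E, (forall z, D z -> f z <= k%:R -> u z = 0) /\ 0 < L u.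
    move=> k; have := H k; move/existsNP => [u /not_implyP[u0 Lu0]].
    have bu : locally_bounded D f (fun z => `|u z|).
      by move=> l; have [M HM] := locbddP u l; exists M => z Kz; rewrite normr_id HM.
    exists (Locbdd (asboolT bu)); split=> [z Dz fz /=|]; first by rewrite u0 ?normr0.
    rewrite lt_neqAle eq_sym; apply/andP; split; last by apply: Lpos => z Dz /=.
    apply/eqP => La; apply: Lu0; apply/eqP; rewrite eq_le -{1}La Lle/=; last by move=> z _ /=; exact: ler_norm.
      have : L (-1 *: u) <= 0 by rewrite -La; apply: Lle => z _; rewrite locbddZE mulN1r; have := ler_norm (- u z); rewrite normrN; exact.
    by rewrite LZ mulN1r oppr_le0.
  pose N z := (Num.truncn (f z)).+1.
  have fN z : f z < (N z)%:R by exact: truncnS_gt.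
  pose t j := (L (u j))^-1.
  have t0 j : 0 < t j by rewrite invr_gt0; have [] := Hu j.
  pose v j z := t j * `|u j z|.
  have v0 j z : 0 <= v j z by rewrite mulr_ge0// ltW.
  have vz j z : D z -> (N z <= j)%N -> v j z = 0.
    move=> Dz Nj; rewrite /v (proj1 (Hu j)) ?normr0 ?mulr0//.
    by rewrite (le_trans (ltW (fN z)))// ler_nat.
  pose w z := \sum_(j < N z) v j z.
  have wE m z : D z -> (N z <= m)%N -> w z = \sum_(j < m) v j z.
    move=> Dz Nm; rewrite /w (big_ord_widen _ (fun j => v j z) Nm) big_mkcond/=.
    by apply: eq_bigr => j _; case: ltnP => // Nj; rewrite vz.
  have bw : locally_bounded D f w.
    move=> k; have := @locally_bounded_sum R A D f k.+1 (fun j z => v j z) _ k.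
    case=> [j l|M HM].
      have [M HM] := locbddP (u j) l; exists (t j * M) => z Kz.
      by rewrite /v normrM normr_id (gtr0_norm (t0 j)) ler_pM2l// HM.
    exists M => z [Dz fz]; rewrite (wE k.+1)//; first exact: HM.
    by rewrite ltnS truncn_le_nat (le_lt_trans fz)// ltr_nat.
  pose W : E := Locbdd (asboolT bw).
  have wm m : m%:R <= L W.
    pose P : E := \sum_(j < m) t j *: u j.
    have -> : m%:R = L P.
      rewrite /P; elim: m {P} => [|m IHm]; first by rewrite big_ord0 L0.
      rewrite big_ord_recr/= addrC Ll -IHm mulVf ?gt_eqF//; last by have [] := Hu m.
      by rewrite addrC natr1.
    apply: Lle => z Dz.
    have -> : P z = \sum_(j < m) t j * u j z.
      by rewrite /P; elim/big_rec2: _ => // j y s _ <-.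
    have [Nm|mN] := leqP (N z) m.
      rewrite /= (wE m)//; apply: ler_sum => j _; rewrite ler_wpM2l ?ler_norm// ltW//.
    rewrite /= (wE (N z) z Dz (leqnn _)).
    apply: (@le_trans _ _ (\sum_(j < m) v j z)).
      by apply: ler_sum => j _; rewrite ler_wpM2l ?ler_norm// ltW.
    rewrite (big_ord_widen _ (fun j => v j z) (ltnW mN)) big_mkcond/=.
    by apply: ler_sum => j _; case: ifP.
  have := wm (Num.truncn (L W)).+1; rewrite leNgt => /negP; apply; exact: truncnS_gt.
pose K := D `&` [set z | f z <= k%:R].
(* A function bounded on K only becomes locally bounded once cut off outside K. *)
pose cut (u : A -> R) : A -> R := fun z => \1_K z * u z.
have bcut u : bounded_on K u -> locally_bounded D f (cut u).
  move=> [M HM] l; exists `|M| => z [Dz _]; rewrite /cut indicE.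
  case: (boolP (z \in K)) => [/set_mem Kz|_]; last by rewrite mul0r normr0.
  by rewrite mul1r (le_trans (HM z Kz))// ler_norm.
pose M (u : A -> R) := L (insubd 0 (cut u : A -> R^o)).
have ME u (bu : bounded_on K u) : M u = L (Locbdd (asboolT (bcut u bu))).
  rewrite /M; congr L; apply: val_inj; rewrite /= insubdK//.
  exact/asboolP/bcut.
exists k, M; split.
  split=> [t u v bu bv|u bu u0].
    have buv := bounded_lin t bu bv; rewrite !ME -Ll; congr L; apply/val_inj/funext => z /=.
    by rewrite /cut mulrDr mulrCA.
  rewrite ME; apply: Lpos => z Dz /=; rewrite /cut indicE.
  by case: (boolP (z \in K)) => [/set_mem Kz|_]; rewrite ?mul0r// mul1r u0.
move=> a; have ba : bounded_on K (dG a) by exact: dG_bounded.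
rewrite ME -LdG; apply/eqP; rewrite -subr_eq0 -LB; apply/eqP; apply: Hk => z Dz fz.
rewrite locbddDE locbddNE -[X in X - _ = _]/(cut (dG a) z) -[X in _ - X = _]/(dG a z).
by rewrite /cut indicE mem_set// mul1r subrr.
Qed.

End CompactExtension.

(** * Disintegration over the base *)

Section FiniteFrames.
Context {R : realType} {n q : nat} {X : smooth_manifold R n} (g : riemannian_metric X).
Local Notation C := (smoothfun X).
Local Notation T := (vfield X).
Local Notation p := q.+1.
Variable phi : kform X p.

Lemma exterior_d_linear (k : nat) (t : R) (a b : kform X k) V x :
  exterior_d (t *: a + b) V x = t * exterior_d a V x + exterior_d b V x.
Proof.
have Z (c : kform X k) U : ext_deriv (t *: c) U = t *: ext_deriv c U.
  rewrite /ext_deriv scaler_sumr; apply: eq_bigr => i _.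
  rewrite -[(t *: c) _]/(t *: c _) vfieldZ.
  have -> : \sum_(j < k | (i <= j)%N) (t *: c) (upd (U \o lift i) j (bracket (U i) (U (lift i j)))) =
      t *: \sum_(j < k | (i <= j)%N) c (upd (U \o lift i) j (bracket (U i) (U (lift i j)))).
    by rewrite scaler_sumr.
  by rewrite -scalerBr smoothfun_scaleAr.
rewrite -[exterior_d (t *: a + b) V]/(ext_deriv (fun U => (t *: a) U + b U) V).
by rewrite ext_derivD Z sfDE sfZE.
Qed.

Lemma smooth_has_bumps : @has_bumps R X.
Proof.
move=> x U oU Ux; have [F [Fx FU]] := exists_frame oU Ux.
exists (frame_b F); split=> //; first exact: smoothfun_continuous.
exact: frame_b_ge0.
Qed.

Lemma multilinear_bounded (K : set X) (F : ('I_p -> T) -> C) : compact K -> multilinear F ->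
  exists2 M : R, 0 <= M & forall x V, K x -> ONplane g phi x V -> `|F V x| <= M.
Proof.
move=> cK FL.
have mphi : multilinear phi by apply: form_multilinear; exact: form_is_form.
have phi0 x V : K x -> ONplane g phi x V -> 0 < phi V x by move=> _ [_ ->].
have FN : multilinear (fun V => - F V) by move=> V i h W W'; rewrite FL; ring.
have [M M0 HM] := plane_domination_compact cK FL mphi phi0.
have [N N0 HN] := plane_domination_compact cK FN mphi phi0.
exists (M + N) => [|x V Kx pV]; first by rewrite addr_ge0// ltW.
have := HM x V Kx pV; have := HN x V Kx pV; rewrite pV.2 sfNE !mulr1 ler_norml => h1 h2.
by apply/andP; split; lra.
Qed.

Lemma frame_A_linear (Fr : local_frame X) (h : C) W W' j :
  frame_A Fr (h *: W + W') j = h * frame_A Fr W j + frame_A Fr W' j.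
Proof. by rewrite /frame_A !vfield_addE !vfield_scaleE; ring. Qed.

Lemma frame_prod_multilinear (Fr : local_frame X) (J : 'I_p -> 'I_n) :
  multilinear (fun V : 'I_p -> T => \prod_l frame_A Fr (V l) (J l)).
Proof.
move=> V i h W W'; rewrite (bigD1 i)//= [in X in h * X](bigD1 i)//= [in X in _ = _ + X](bigD1 i)//=.
rewrite !updE frame_A_linear mulrDl mulrA.
by congr (_ * _ + _ * _); apply: eq_bigr => l li; rewrite !upd_neq.
Qed.

Lemma finite_frames (K : set X) : compact K -> exists (M : nat) (Fr : 'I_M -> local_frame X),
  forall x, K x -> exists m, 0 < frame_b (Fr m) x.
Proof.
move=> cK; have /choice[fr Hfr] := frame_at (X := X).
move: cK; rewrite compact_cover => /(_ X K (fun x => [set z | 0 < frame_b (fr x) z])) [].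
- move=> x _; apply: (@open_comp _ _ (frame_b (fr x)) [set t | 0 < t]); last exact: open_gt.
  by move=> z _; exact: smoothfun_continuous.
- by move=> x Kx; exists x => //; exact: Hfr.
move=> D _ KD; pose s := finmap.enum_fset D.
exists (size s), (fun m => fr (nth (point : X) s m)) => x /KD[y /= yD xy].
have ys : (index y s < size s)%N by rewrite index_mem.
by exists (Ordinal ys); rewrite /= nth_index.
Qed.

Variables (M : nat) (Fr : 'I_M -> local_frame X).
(** Indexes the monomials in the frame coefficients of the vectors of a tuple, for all the
    frames of a finite family. *)
Definition slot : finType := ('I_M * {ffun 'I_p -> 'I_n})%type.
Implicit Types (i : slot) (b : kform X p).

Definition plane_fun i (V : 'I_p -> T) : C := \prod_l frame_A (Fr i.1) (V l) (i.2 l).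

Definition form_comp i b : C := b (frame_E (Fr i.1) \o i.2).

(** The common denominator in multilinear_frame, summed over the frames; it is positive
    wherever one of the frames is defined. *)
Definition frame_weight (x : X) : R := \sum_m (frame_b (Fr m) ^+ 3) x ^+ p.

Lemma plane_fun_multilinear i : multilinear (plane_fun i).
Proof. exact: frame_prod_multilinear. Qed.

Lemma frame_weight_expand b V x :
  frame_weight x * b V x = \sum_i form_comp i b x * plane_fun i V x.
Proof.
rewrite /frame_weight mulr_suml.
rewrite -(pair_bigA _ (fun m J => form_comp (m, J) b x * plane_fun (m, J) V x))/=.
apply: eq_bigr => m _.
have bL : multilinear b by apply: form_multilinear; exact: form_is_form.
rewrite (multilinear_frame (Fr m) V x bL); apply: eq_bigr => J _.
by rewrite mulrC /plane_fun sf_prodE.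
Qed.

Lemma frame_weight_continuous : continuous frame_weight.
Proof.
apply: continuous_bigsum => m _ x.
rewrite (_ : (fun z => _) = ((frame_b (Fr m) ^+ 3) ^+ p : C)); first exact: smoothfun_continuous.
by apply/funext => z; rewrite [RHS]sfXE.
Qed.

Lemma frame_weight_gt0 x : (exists m, 0 < frame_b (Fr m) x) -> 0 < frame_weight x.
Proof.
have t0 m : 0 <= (frame_b (Fr m) ^+ 3) x ^+ p.
  by rewrite sfXE !exprn_ge0//; exact: frame_b_ge0.
move=> [m bm]; rewrite /frame_weight (bigD1 m)//; apply: ltr_pwDl; last by apply: sumr_ge0 => i _; exact: t0.
by rewrite sfXE !exprn_gt0.
Qed.

End FiniteFrames.
Arguments slot : clear implicits.
Arguments frame_weight {R n} q {X M} Fr x.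

Section Disintegration.
Context {R : realType} {n q : nat} {X : smooth_manifold R n} (g : riemannian_metric X).
Local Notation C := (smoothfun X).
Local Notation T := (vfield X).
Local Notation p := q.+1.
Variable phi : kform X p.
Variable K : set X.
Hypothesis cK : compact K.
Let closedK : closed K.
Proof. exact: compact_closed (carrier_hausdorff (s := X)) cK. Qed.

Definition planes_over : set (X * ('I_p -> T)) := [set z | ONplane g phi z.1 z.2 /\ K z.1].

Variable Lam : (X * ('I_p -> T) -> R) -> R.
Hypothesis LamP : positive_functional planes_over Lam.

Variables (M : nat) (Fr : 'I_M -> local_frame X).
Hypothesis FrK : forall x, K x -> exists m, 0 < frame_b (Fr m) x.
Local Notation I := (slot n q M).
Implicit Types (i : I) (b : kform X p) (u v : X -> R) (V : 'I_p -> T) (x : X).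

Lemma frame_weight_lower : exists2 dl : R, 0 < dl & forall x, K x -> dl <= frame_weight q Fr x.
Proof.
have [K0|/set0P K0] := eqVneq K set0; first by exists 1; rewrite ?K0.
have wc : {within K, continuous (frame_weight q Fr)}.
  by apply: continuous_subspaceT => x; exact: frame_weight_continuous.
have [x0 /set_mem Kx0 xmin] := @compact_EVT_min _ R (frame_weight q Fr) K K0 cK wc.
exists (frame_weight q Fr x0); first by apply: frame_weight_gt0; exact: FrK.
by move=> x Kx; apply: xmin; exact: mem_set.
Qed.

Variable dl : R.
Hypothesis dl0 : 0 < dl.
Hypothesis dlK : forall x, K x -> dl <= frame_weight q Fr x.

(** Agrees with frame_weight on K, and is bounded below everywhere so that one can divide
    by it. *)
Definition clamped_weight x := Num.max (frame_weight q Fr x) dl.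

Definition scaled_comp (i : I) (b : kform X p) (x : X) : R := form_comp Fr i b x / clamped_weight x.

Lemma clamped_weight_ge x : dl <= clamped_weight x.
Proof. by rewrite le_max lexx orbT. Qed.

Lemma clamped_weight_gt0 x : 0 < clamped_weight x.
Proof. exact: lt_le_trans (clamped_weight_ge x). Qed.

Lemma scaled_comp_continuous i b : continuous (scaled_comp i b).
Proof.
move=> x; apply: (@continuousM R X (form_comp Fr i b) (fun x => (clamped_weight x)^-1) x).
  exact: smoothfun_continuous.
apply: continuousV; first by rewrite gt_eqF// clamped_weight_gt0.
apply: (@continuous_max R X (frame_weight q Fr) (cst dl) x); last exact: cst_continuous.
exact: frame_weight_continuous.
Qed.

Lemma scaled_expand b V x : K x -> b V x = \sum_i scaled_comp i b x * plane_fun Fr i V x.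
Proof.
move=> Kx; have w0 : frame_weight q Fr x != 0.
  by rewrite gt_eqF// (lt_le_trans dl0)// dlK.
apply: (mulfI w0); rewrite frame_weight_expand mulr_sumr; apply: eq_bigr => i _.
rewrite /scaled_comp /clamped_weight max_l ?dlK// mulrA [_ * (_ / _)]mulrC.
by rewrite mulfVK.
Qed.

Definition base_functional (u : X -> R) := Lam (fun z => u z.1).
Definition slot_functional (i : I) (u : X -> R) := Lam (fun z => u z.1 * plane_fun Fr i z.2 z.1).

Lemma base_bounded u : bounded_on K u -> bounded_on planes_over (fun z => u z.1).
Proof. by move=> [B HB]; exists B => z [_ Kz]; exact: HB. Qed.

Lemma slot_bound i : exists2 B : R, 0 < B &
  forall z, planes_over z -> `|plane_fun Fr i z.2 z.1| <= B.
Proof.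
have [B B0 HB] := multilinear_bounded g phi cK (plane_fun_multilinear Fr i).
exists (B + 1) => [|z [pz Kz]]; first by rewrite ltr_wpDl.
by rewrite (le_trans (HB _ _ Kz pz))// lerDl.
Qed.

Lemma slot_bounded u i : bounded_on K u ->
  bounded_on planes_over (fun z => u z.1 * plane_fun Fr i z.2 z.1).
Proof.
move=> [B HB]; have [B' B'0 HB'] := slot_bound i; exists (B * B') => z pz.
by rewrite normrM ler_pM// ?HB'//; case: pz => _; exact: HB.
Qed.

Lemma base_positive : positive_functional K base_functional.
Proof.
split=> [t u v bu bv|u bu u0].
  by rewrite /base_functional (functional_linear LamP t (base_bounded bu) (base_bounded bv)).
by apply: (functional_pos LamP) => [|z [_ Kz]]; [exact: base_bounded|exact: u0].
Qed.

Lemma slot_linear i (t : R) u v : bounded_on K u -> bounded_on K v ->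
  slot_functional i (fun x => t * u x + v x) = t * slot_functional i u + slot_functional i v.
Proof.
move=> bu bv; rewrite /slot_functional -(functional_linear LamP t (slot_bounded i bu) (slot_bounded i bv)).
by congr Lam; apply/funext => z; rewrite mulrDl mulrA.
Qed.

Lemma slotZ i (t : R) u : bounded_on K u ->
  slot_functional i (fun x => t * u x) = t * slot_functional i u.
Proof.
move=> bu; rewrite /slot_functional -(functionalZ LamP); last exact: slot_bounded.
by congr Lam; apply/funext => z; rewrite mulrA.
Qed.

(** On the planes over K the function plane_fun i is bounded. *)
Lemma slot_dominated i : exists2 c : R, 0 < c & forall u, bounded_on K u ->
  (forall x, K x -> 0 <= u x) -> `|slot_functional i u| <= c * base_functional u.
Proof.
have [B B0 HB] := slot_bound i; exists B => // u bu u0.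
have key (s : R) : `|s| = 1 -> s * slot_functional i u <= B * base_functional u.
  move=> s1; rewrite /slot_functional /base_functional -!(functionalZ LamP).
  - apply: (functional_le LamP).
    + by have [D HD] := slot_bounded i bu; exists D => z pz; rewrite normrM s1 mul1r HD.
    + have [D HD] := base_bounded bu; exists (B * D) => z pz.
      by rewrite normrM (gtr0_norm B0) ler_pM2l// HD.
    move=> z pz; have [_ Kz] := pz; rewrite mulrCA [B * _]mulrC; apply: ler_wpM2l; first exact: u0.
    by rewrite (le_trans (ler_norm _))// normrM s1 mul1r HB.
  - exact: base_bounded.
  - exact: slot_bounded.
rewrite ler_norml lerNl -mulN1r !key ?normrN1//=.
by rewrite -[leLHS]mul1r key// normr1.
Qed.

Lemma base_form_bounded b : bounded_on planes_over (fun z => b z.2 z.1).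
Proof.
have bL : multilinear b by apply: form_multilinear; exact: form_is_form.
have [B B0 HB] := multilinear_bounded g phi cK bL.
by exists B => z [pz Kz]; exact: HB.
Qed.

Lemma functional_form b : Lam (fun z => b z.2 z.1) = \sum_i slot_functional i (scaled_comp i b).
Proof.
rewrite /slot_functional -(functional_sum LamP); last first.
  by move=> i; apply: slot_bounded; apply: continuous_bounded => //; exact: scaled_comp_continuous.
apply: (functional_eq LamP); first exact: base_form_bounded.
by move=> z [_ Kz]; exact: scaled_expand.
Qed.

(** This bound is the continuity of the current: the right-hand side only involves finitely
    many coefficients of b on a compact set. *)
Lemma functional_form_estimate : exists2 c : R, 0 <= c & forall b (e : R), 0 <= e ->
  (forall i x, K x -> `|form_comp Fr i b x| <= e) -> `|Lam (fun z => b z.2 z.1)| <= c * e.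
Proof.
have /choice[B HB] : forall i, exists B : R, 0 < B /\
    forall z, planes_over z -> `|plane_fun Fr i z.2 z.1| <= B.
  by move=> i; have [B B0 HB] := slot_bound i; exists B.
pose c1 := \sum_i dl^-1 * B i.
have c10 : 0 <= c1.
  by apply: sumr_ge0 => i _; rewrite mulr_ge0 ?invr_ge0 ?ltW//; have [] := HB i.
have L1 : 0 <= Lam (cst 1) by apply: (functional_pos LamP) => //; exact: bounded_cst.
exists (c1 * Lam (cst 1)); first exact: mulr_ge0.
move=> b e e0 He.
have pb z : planes_over z -> `|b z.2 z.1| <= c1 * e.
  move=> pz; have [_ Kz] := pz; rewrite (scaled_expand _ _ Kz) (le_trans (ler_norm_sum _ _ _))//.
  rewrite /c1 mulr_suml; apply: ler_sum => i _; rewrite normrM mulrAC.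
  apply: ler_pM => //; last by have [_] := HB i; exact.
  rewrite /scaled_comp normrM mulrC; apply: ler_pM => //; last exact: He.
  rewrite ger0_norm ?invr_ge0 ?(ltW (clamped_weight_gt0 _))//.
  by rewrite lef_pV2 ?posrE ?clamped_weight_gt0 ?clamped_weight_ge.
have key (s : R) : `|s| = 1 -> s * Lam (fun z => b z.2 z.1) <= c1 * Lam (cst 1) * e.
  move=> s1; rewrite mulrAC -(functionalZ LamP); last exact: base_form_bounded.
  rewrite -(functionalZ LamP); last exact: bounded_cst.
  apply: (functional_le LamP).
  - by exists (c1 * e) => z pz; rewrite normrM s1 mul1r pb.
  - by exists `|c1 * e * 1| => z _.
  - by move=> z pz; rewrite mulr1 (le_trans (ler_norm _))// normrM s1 mul1r pb.
rewrite ler_norml lerNl -mulN1r !key ?normrN1//=.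
by rewrite -[leLHS]mul1r key// normr1.
Qed.

Variable mu : {finite_measure set (borel X) -> \bar R}.
Hypothesis muE : forall A, mu A = outer base_functional A.
Variable d : I -> borel X -> R.
Hypothesis d_density : forall i u, continuous u ->
  mu.-integrable K (EFin \o (fun x => u x * d i x)) /\
  \int[mu]_(x in K) (u x * d i x) = slot_functional i u.
Let mK : measurable (K : set (borel X)) := measurable_compact closedK.

(** The field of p-vectors of the current, as functionals on forms: the coefficients of b
    are paired with the densities. *)
Definition tangent (x : borel X) : kform X p -> R^o :=
  fun b => \1_K x * \sum_i scaled_comp i b x * d i x.

Lemma integral_cut (k : borel X -> R) : mu.-integrable K (EFin \o k) ->
  mu.-integrable setT (EFin \o (fun x => \1_K x * k x)) /\
  \int[mu]_x (\1_K x * k x) = \int[mu]_(x in K) k x.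
Proof.
move=> /(integrable_mkcond _ mK) ik.
have E : (EFin \o k) \_ K = EFin \o (fun x => \1_K x * k x).
  by rewrite epatch_indic; apply/funext => x /=; rewrite -EFinM mulrC.
split; first by rewrite -E.
by rewrite [RHS]Rintegral_mkcond patch_indic; apply: eq_Rintegral => x _ /=; rewrite mulrC.
Qed.

Lemma Rintegral_sum (J : Type) (r : seq J) (h : J -> borel X -> R) :
  (forall j, mu.-integrable K (EFin \o h j)) ->
  mu.-integrable K (EFin \o (fun x => \sum_(j <- r) h j x)) /\
  \int[mu]_(x in K) (\sum_(j <- r) h j x) = \sum_(j <- r) \int[mu]_(x in K) h j x.
Proof.
move=> ih; elim: r => [|j r [IH1 IH2]].
  rewrite big_nil (_ : (fun x => _) = cst 0); last by apply/funext => x; rewrite big_nil.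
  by split; [exact: integrable0|rewrite Rintegral_cst ?mul0r].
rewrite (_ : (fun x => _) = (fun x => h j x + \sum_(j <- r) h j x)); last first.
  by apply/funext => x; rewrite big_cons.
split; first exact: (integrableD mK (ih j) IH1).
by rewrite (RintegralD mK (ih j) IH1) IH2 big_cons.
Qed.

Lemma tangent_integral b : mu.-integrable setT (EFin \o (fun x => tangent x b)) /\
  \int[mu]_x (tangent x b) = Lam (fun z => b z.2 z.1).
Proof.
have ih i : mu.-integrable K (EFin \o (fun x : borel X => scaled_comp i b x * d i x)).
  by have [] := d_density i (@scaled_comp_continuous i b).
have [s1 s2] := Rintegral_sum (index_enum I) ih.
have [c1 c2] := integral_cut s1; split; first exact: c1.
rewrite [LHS]c2 s2 functional_form; apply: eq_bigr => i _.
by have [] := d_density i (@scaled_comp_continuous i b).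
Qed.

Definition plane_vectors x : set 'rV[R]_#|I| :=
  [set v | exists2 V, ONplane g phi x V & v = \row_k plane_fun Fr (enum_val k) V x].

Definition density_vector (x : borel X) : 'rV[R]_#|I| := \row_k d (enum_val k) x.

Lemma tangent_hull x : (forall x xi, unit_simple g x xi -> xi phi <= 1) ->
  K x -> convex_hull (plane_vectors x) (density_vector x) ->
  convex_hull (phi_planes g phi x) (tangent x).
Proof.
move=> phi_le1 Kx [m [t [w [t0 t1 Pw dE]]]].
have /choice[V HV] : forall l, exists V, ONplane g phi x V /\
    w l = \row_k plane_fun Fr (enum_val k) V x.
  by move=> l; have [V pV wV] := Pw l; exists V.
have diE i : d i x = \sum_l t l * plane_fun Fr i (V l) x.
  have := congr1 (fun v : 'rV[R]_#|I| => v 0 (enum_rank i)) dE.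
  rewrite mxE enum_rankK summxE => ->; apply: eq_bigr => l _.
  by rewrite mxE (proj2 (HV l)) mxE enum_rankK.
exists m, t, (fun l => simple_pvector x (V l)); split=> // [l|].
  have [[oV phi1] _] := HV l; split; last exact: phi1.
  exact: orthonormal_unit_simple.
apply/funext => b; rewrite /tangent indicE mem_set// mul1r fct_sumE.
transitivity (\sum_l t l * b (V l) x); last by apply: eq_bigr.
under [RHS]eq_bigr => l _ do rewrite (scaled_expand _ _ Kx) mulr_sumr.
rewrite exchange_big/=; apply: eq_bigr => i _.
by rewrite diE mulr_sumr; apply: eq_bigr => l _; rewrite mulrCA.
Qed.

(** phi is 1 on planes, so this is the form whose sign says on which side of the hyperplane
    of equation c.v = r the vector of the plane_fun i V lies. *)
Definition half_form (c : 'rV[rat]_#|I|) (r : rat) V : C :=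
  \sum_i (ratr (c 0 (enum_rank i)) *: plane_fun Fr i V) - ratr r *: phi V.

Lemma half_form_multilinear c r : multilinear (half_form c r).
Proof.
move=> V l h W W'; rewrite /half_form.
have phiL : multilinear phi by apply: form_multilinear; exact: form_is_form.
rewrite phiL.
under eq_bigr => i _ do rewrite (plane_fun_multilinear Fr i) scalerDr smoothfun_scaleAr.
rewrite big_split/= -mulr_sumr scalerDr smoothfun_scaleAr; ring.
Qed.

Lemma half_formE c r x V : ONplane g phi x V -> half_form c r V x =
  dotp (map_mx ratr c) (\row_k plane_fun Fr (enum_val k) V x) - ratr r.
Proof.
move=> [_ phi1]; rewrite /half_form sfBE sf_sumE sfZE phi1 mulr1; congr (_ - _).
rewrite /dotp (reindex (@enum_rank I))/=; last by apply: onW_bij; exact: enum_rank_bij.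
by apply: eq_bigr => i _; rewrite !mxE enum_rankK.
Qed.

Definition half_space c r : set X := [set x | forall V, ONplane g phi x V -> 0 < half_form c r V x].

Lemma half_space_open c r : open (half_space c r).
Proof.
rewrite openE => x Ux; have HL := half_form_multilinear c r.
have ZL : multilinear (fun _ : 'I_p -> T => (0 : C)) by move=> V l h W W'; rewrite mulr0 addr0.
have [N [N0 HN]] := plane_domination ZL HL Ux.
rewrite /interior; apply: filterS HN => z Hz V pV.
by have := Hz V pV; rewrite sf0E pmulr_rgt0.
Qed.

Definition half_density c r (x : borel X) : R :=
  dotp (map_mx ratr c) (density_vector x) - ratr r.

Lemma half_densityE c r x : half_density c r x =
  \sum_i ratr (c 0 (enum_rank i)) * d i x - ratr r.
Proof.
rewrite /half_density /dotp (reindex (@enum_rank I))/=; last by apply: onW_bij; exact: enum_rank_bij.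
by congr (_ - _); apply: eq_bigr => i _; rewrite !mxE enum_rankK.
Qed.

Lemma half_density_integral c r u : continuous u ->
  mu.-integrable K (EFin \o (fun x : borel X => u x * half_density c r x)) /\
  \int[mu]_(x in K) (u x * half_density c r x) =
  Lam (fun z => u z.1 * half_form c r z.2 z.1).
Proof.
have cont1 (t : R) (v : X -> R) : continuous v -> continuous (fun x => t * v x).
  by move=> vc x; apply: (@continuousM R X (cst t) v x); [exact: cst_continuous|exact: vc].
have i1 (v : X -> R) : continuous v -> mu.-integrable K (EFin \o (v : borel X -> R)).
  exact: continuous_integrable.
move=> uc; pose h i (x : borel X) := ratr (c 0 (enum_rank i)) * u x * d i x.
have hi i := d_density i (cont1 (ratr (c 0 (enum_rank i))) u uc).
have [s1 s2] := Rintegral_sum (index_enum I) (fun i => (hi i).1).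
have uE : (fun x : borel X => u x * half_density c r x) =
    (fun x => \sum_i (ratr (c 0 (enum_rank i)) * u x * d i x) - ratr r * u x).
  apply/funext => x; rewrite half_densityE mulrBr mulr_sumr [u x * ratr r]mulrC; congr (_ - _).
  by apply: eq_bigr => i _; rewrite mulrA [u x * _]mulrC.
have iru := i1 _ (cont1 (ratr r) u uc).
rewrite uE; split; first exact: (integrableB mK s1 iru).
rewrite (RintegralB mK s1 iru) s2 RintegralZl//; last exact: i1.
have bu := continuous_bounded cK uc.
rewrite (riesz_integral base_positive cK closedK muE uc).
have -> : \sum_i \int[mu]_(x in K) (ratr (c 0 (enum_rank i)) * u x * d i x) =
    \sum_i ratr (c 0 (enum_rank i)) * slot_functional i u.
  apply: eq_bigr => i _; rewrite (hi i).2; exact: slotZ.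
pose G i := (fun z : X * ('I_p -> T) => ratr (c 0 (enum_rank i)) * (u z.1 * plane_fun Fr i z.2 z.1)).
have bG i : bounded_on planes_over (G i).
  have := bounded_lin (ratr (c 0 (enum_rank i))) (slot_bounded i bu) (bounded_cst planes_over 0).
  by move=> [B HB]; exists B => z pz; have := HB z pz; rewrite addr0.
have bs := bounded_sum (index_enum I) bG.
have -> : \sum_i ratr (c 0 (enum_rank i)) * slot_functional i u = Lam (fun z => \sum_i G i z).
  rewrite (functional_sum LamP)//; apply: eq_bigr => i _.
  by rewrite (functionalZ LamP)//; exact: slot_bounded.
rewrite -mulN1r mulrA mulN1r addrC -(functional_linear LamP _ (base_bounded bu) bs).
apply: (functional_eq LamP); first exact: bounded_lin (base_bounded bu) bs.
move=> z [pz Kz]; rewrite /half_form sfBE sf_sumE sfZE pz.2 mulr1 mulrBr mulr_sumr.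
rewrite addrC mulNr [u z.1 * ratr r]mulrC; congr (_ - _).
by apply: eq_bigr => i _; rewrite /G sfZE mulrCA.
Qed.

Lemma half_density_integrable c r :
  mu.-integrable setT (EFin \o (fun x => \1_K x * half_density c r x)).
Proof.
have [k1 _] := half_density_integral c r (@cst_continuous _ _ (1 : R)).
have E1 : (fun x : borel X => cst 1 x * half_density c r x) = half_density c r.
  by apply/funext => x; rewrite mul1r.
by move: k1; rewrite E1 => /integral_cut[].
Qed.

(** Over the open set of the points whose planes all lie on the positive side, the
    integral of v (c.d - r) is Lam (v half_form), which is nonnegative for all continuous
    v >= 0. *)
Lemma half_density_null c r :
  mu.-negligible (half_space c r `&` [set x | \1_K x * half_density c r x < 0]).
Proof.
have hi := half_density_integrable c r.
exists (half_space c r `&` [set x | \1_K x * half_density c r x < 0]); split=> //.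
  apply: measurableI; first by apply: open_borel; exact: half_space_open.
  have mh : measurable_fun setT (fun x : borel X => \1_K x * half_density c r x).
    by apply/measurable_EFinP; exact: measurable_int hi.
  rewrite -[X in measurable X]setTI.
  rewrite (_ : [set x | _] = (fun x => \1_K x * half_density c r x) @^-1` `]-oo, 0[%classic).
    by apply: mh => //; exact: measurable_itv.
  by apply/seteqP; split=> x /=; rewrite in_itv.
apply: (density_ge0 muE (half_space_open c r) hi) => v vc v01 vU.
have [k2 k3] := half_density_integral c r vc; have [_ k4] := integral_cut k2.
rewrite (_ : (fun x => _) = (fun x : borel X => \1_K x * (v x * half_density c r x))); last first.
  by apply/funext => x; rewrite mulrCA.
rewrite k4 k3; apply: (functional_pos LamP).
  have HL := half_form_multilinear c r.
  have [B B0 HB] := multilinear_bounded g phi cK HL.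
  exists B => z [pz Kz]; rewrite normrM -[leRHS]mul1r; apply: ler_pM => //; last exact: HB.
  by have /andP[v0 v1] := v01 z.1; rewrite ger0_norm.
move=> z [pz Kz]; have /andP[v0 v1] := v01 z.1.
have [->|vz] := eqVneq (v z.1) 0; first by rewrite mul0r.
by rewrite mulr_ge0// ltW//; exact: (vU _ vz).
Qed.

Hypothesis phi_le1 : forall x xi, unit_simple g x xi -> xi phi <= 1.

(** Outside the null sets of half_density_null for rational (c, r), no rational half-space
    separates the density vector from the plane vectors. *)
Lemma tangent_ae : {ae mu, forall x, convex_hull (phi_planes g phi x) (tangent x)}.
Proof.
pose Bad (k : nat) : set (borel X) :=
  if unpickle k is Some cr then half_space cr.1 cr.2 `&`
    [set x | \1_K x * half_density (cr : 'rV[rat]_#|I| * rat).1 cr.2 x < 0] else set0.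
have nB : mu.-negligible (\bigcup_k Bad k).
  apply: negligible_bigcup => k; rewrite /Bad; case: unpickle => [cr|]; last exact: negligible_set0.
  exact: half_density_null.
have nK : mu.-negligible (~` K).
  exists (~` K); split=> //; first exact: (@measurableC _ (borel X)).
  exact: (riesz_null base_positive closedK muE).
apply: (negligibleS _ (negligibleU nK nB)) => x /= nH.
have [Kx|nKx] := pselect (K x); [right|by left].
have cP : compact (plane_vectors x).
  by apply: plane_compact => i; exact: plane_fun_multilinear.
have nd : ~ convex_hull (plane_vectors x) (density_vector x).
  by move=> dH; apply: nH; exact: tangent_hull.
have [c [r [cd cP']]] := rational_separation cP nd.
exists (pickle (c, r)) => //; rewrite /Bad pickleK; split.
  move=> V pV; rewrite half_formE// subr_gt0; apply: cP'.
  by exists V.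
by rewrite /= indicE mem_set// mul1r subr_lt0.
Qed.

Lemma tangent_measurable b : measurable_fun setT (fun x : borel X => tangent x b : R).
Proof.
by apply/measurable_EFinP; have [ib _] := tangent_integral b; exact: measurable_int ib.
Qed.

Lemma tangent_eintegral b : ((Lam (fun z => b z.2 z.1))%:E = \int[mu]_x (tangent x b)%:E)%E.
Proof.
have [ib <-] := tangent_integral b; rewrite /Rintegral fineK//.
exact: integrable_fin_num.
Qed.

End Disintegration.

(** * Positive currents and their boundaries *)

Section FormTopology.
Context {R : realType} {n k : nat} {X : smooth_manifold R n}.

(** The topology of forms contains uniform convergence on compact sets of the values on
    fixed vector fields, which is the jet of order 0. *)
Lemma near_form_small (b0 : kform X k) (V : 'I_k -> vfield X) (K : set X) (e : R) :
  compact K -> 0 < e -> \forall b \near b0, forall x, K x -> `|(b0 - b) V x| <= e.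
Proof.
move=> cK e0.
pose ev : kform X k -> {family compact, X -> R} := fun b => smoothfun_val (b V).
have jc : continuous (@jets R n X k : kform X k -> _) by exact: initial_continuous.
have evc : continuous ev.
  have pc : continuous (proj (([::], V) : seq (vfield X) * ('I_k -> vfield X)) \o (@jets R n X k : kform X k -> _)).
    by move=> b; apply: continuous_comp; [exact: jc|exact: proj_continuous].
  exact: pc.
have H := evc b0 _ (fam_nbhs (ev b0) (entourage_ball R (PosNum e0)) cK).
near=> b => x Kx.
have : ball (b0 V x) e (b V x) by move: x Kx; near: b; exact: H.
by rewrite /ball/= => /ltW.
Unshelve. all: by end_near. Qed.

Lemma near_forms_small (I : finType) (V : I -> 'I_k -> vfield X) (b0 : kform X k) (K : set X) (e : R) :
  compact K -> 0 < e -> \forall b \near b0, forall i x, K x -> `|(b0 - b) (V i) x| <= e.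
Proof.
move=> cK e0; apply: (@filter_forall _ I (fun i b => forall x, K x -> `|(b0 - b) (V i) x| <= e) (nbhs b0)).
by move=> i; exact: near_form_small.
Qed.

End FormTopology.

Section PositiveCurrents.
Context {R : realType} {n q : nat} {X : smooth_manifold R n} (g : riemannian_metric X).
Local Notation p := q.+1.
Variable phi : kform X p.
Hypothesis phi_le1 : forall x xi, unit_simple g x xi -> xi phi <= 1.

(** Assembles the density vector, the tangent field and the continuity estimate for one
    finite family of frames covering K. *)
Lemma positive_functional_current (K : set X) (Lam : (X * ('I_p -> vfield X) -> R) -> R) :
  compact K -> positive_functional (planes_over g phi K) Lam ->
  exists T : current X p, positive_current g phi T /\ forall b, T b = Lam (fun z => b z.2 z.1).
Proof.
move=> cK LamP; have closedK : closed K := compact_closed (@carrier_hausdorff _ _ X) cK.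
have [M [Fr FrK]] := finite_frames cK.
have [dl dl0 dlK] := frame_weight_lower (q := q) cK FrK.
have LP := base_positive LamP.
have bX : @has_bumps R X by exact: smooth_has_bumps.
have [mu muE] := riesz_measure LP bX cK.
have /choice[d Hd] : forall i : slot n q M, exists d : borel X -> R,
    forall u : X -> R, continuous u -> mu.-integrable K (EFin \o (fun x => u x * d x)) /\
      \int[mu]_(x in K) (u x * d x) = slot_functional Lam Fr i u.
  move=> i; have [c c0 Hc] := slot_dominated cK LamP Fr i.
  exact (density LP bX cK closedK muE c0 (slot_linear cK LamP Fr i) Hc).
pose T0 : kform X p -> R^o := fun b => Lam (fun z => b z.2 z.1).
have T0lin (t : R) a b : T0 (t *: a + b) = t *: T0 a + T0 b.
  have := functional_linear LamP t (base_form_bounded g phi cK a) (base_form_bounded g phi cK b).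
  exact.
pose T1 : {linear kform X p -> R^o} := HB.pack T0 (GRing.isLinear.Build R (kform X p) R^o *:%R T0 T0lin).
have T1c : continuous T1.
  move=> b0; apply/(@cvgrPdist_lt R R^o (kform X p) (nbhs b0) _ T1 (T1 b0)) => e e0.
  have [c c0 Hc] := functional_form_estimate cK LamP dl0 dlK.
  have c1 : 0 < c + 1 by rewrite ltr_wpDl.
  have e1 : 0 < e / (c + 1) by rewrite divr_gt0.
  apply: filterS (near_forms_small (fun i : slot n q M => frame_E (Fr i.1) \o i.2) b0 cK e1) => b small.
  have -> : T1 b0 - T1 b = T0 (b0 - b) by rewrite -[T0 _]/(T1 _) linearB.
  apply: (@le_lt_trans _ _ (c * (e / (c + 1)))).
    by apply: Hc => //; exact: ltW.
  by rewrite mulrA ltr_pdivrMr// [c * e]mulrC ltr_pM2l// ltrDl.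
exists (Current T1c); split=> //.
exists mu, (tangent K Fr dl d); split.
- move=> C cC; have mC : measurable (C : set (borel X)).
    apply: measurable_compact; exact: compact_closed (@carrier_hausdorff _ _ X) cC.
  by rewrite -ge0_fin_numE// fin_num_measure.
- exact: (tangent_measurable cK LamP dl0 dlK Hd).
- exact: (tangent_ae cK LamP dl0 dlK muE Hd phi_le1).
- exact: (tangent_eintegral cK LamP dl0 dlK Hd).
Qed.

Lemma positive_current_ge0 (T : current X p) (b : kform X p) :
  positive_current g phi T -> Lambda_positive g phi b -> 0 <= T b.
Proof.
move=> [mu [Tv [_ mT hullT TE]]] bpos.
rewrite -lee_fin TE (@ae_eq_integral _ _ _ mu setT (fun x => `|(Tv x b)%:E|)%E)//.
- by apply: integral_ge0 => x _; exact: abse_ge0.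
- exact/measurable_EFinP.
- by apply: measurableT_comp => //; exact/measurable_EFinP.
apply: (negligibleS _ hullT) => x /= nx hx; apply: nx => _; move: hx => [m [t [w [t0 _ Pw TvE]]]].
suff Tb : 0 <= Tv x b by rewrite /= ger0_norm.
rewrite TvE fct_sumE; apply: sumr_ge0 => l _; apply: mulr_ge0; [exact: t0|exact: bpos (Pw l)].
Qed.

End PositiveCurrents.

Theorem theorem9p1 (R : realType) (n q : nat) (X : smooth_manifold R n)
    (g : riemannian_metric X) (nabla : levi_civita g)
    (phi : kform X q.+1)
    (phi_calibration : calibration g phi)
    (X_noncompact : ~ compact [set: X])
    (X_convex : strictly_convex nabla phi)
    (phi_exact : exact_form phi)
    (S : current X q) :
  (exists T : current X q.+1,
     positive_current g phi T /\ (forall a : kform X q, S a = current_boundary T a))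
  <->
  (forall a : kform X q, Lambda_positive g phi (exterior_d a) -> 0 <= S a).
Proof.
have [_ dphi phi_le1] := phi_calibration.
split=> [[T [Tpos ST]] a da|S_pos].
  by rewrite ST; exact: positive_current_ge0 Tpos da.
have [f [W gradW hess] f_proper] := X_convex.
have hess_gt0 x V : ONplane g phi x V -> 0 < phi_hessian nabla phi W V x.
  move=> [oV phi1]; apply: (hess x (simple_pvector x V)).
  by split; [exact: orthonormal_unit_simple|exact: phi1].
pose D : set (X * ('I_q.+1 -> vfield X)) := [set z | ONplane g phi z.1 z.2].
pose h (z : X * ('I_q.+1 -> vfield X)) : R := f z.1.
pose dG (a : kform X q) (z : X * ('I_q.+1 -> vfield X)) : R := exterior_d a z.2 z.1.
have dG_lin (t : R) a b z : dG (t *: a + b) z = t * dG a z + dG b z.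
  exact: exterior_d_linear.
have S_lin (t : R) a b : S (t *: a + b) = t * S a + S b by rewrite linearP.
have S_ge0 a : (forall z, D z -> 0 <= dG a z) -> 0 <= S a.
  move=> a0; apply: S_pos; apply/Lambda_positiveP => // x V pV.
  exact: (a0 (x, V)).
have dG_bounded a : locally_bounded D h (dG a).
  move=> k; have aL : multilinear (exterior_d a).
    by apply: form_multilinear; exact: form_is_form.
  have [M _ HM] := multilinear_bounded g phi (f_proper k%:R) aL.
  by exists M => z [pz fz]; exact: HM.
have dG_dominates u : locally_bounded D h u -> exists a, forall z, D z -> u z <= dG a z.
  move=> bu; have /choice[c Hc] : forall k : nat, exists c : R,
      forall z, (D `&` [set z | h z <= k%:R]) z -> `|u z| <= c by move=> k; exact: bu.
  have [k x V fx pV|a Ha] := psh_domination phi_le1 dphi gradW hess_gt0 f_proper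
      (F := fun x V => u (x, V)) (c := c).
    by rewrite (le_trans (ler_norm _))//; apply: Hc.
  by exists a => -[x V] pV; exact: Ha.
have [k [Lam [LamP LamS]]] := compact_extension dG_lin S_lin S_ge0 dG_bounded dG_dominates.
have [T [Tpos TL]] := positive_functional_current phi_le1 (f_proper k%:R) LamP.
by exists T; split=> // a; rewrite -LamS /current_boundary TL.
Qed.
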